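(* Let $m\geq1$ be an integer and let $N=\left\lfloor\frac{(m+1)^2}{4}\right\rfloor$, $e=\left\lfloor\frac{m^2}{4}\right\rfloor$. The series $h_{m+2}^*(y)$ (defined in the context with $n=m+2$) has the following properties. (i) There are positive integers $\gamma_{m,0},\ldots,\gamma_{m,e}$ such that $$h_{m+2}^*(y)=y^N\sum_{j=0}^e\gamma_{m,j}\,y^j(1+y)^{2e-2j}.$$ They are given by the finite formula $$\gamma_{m,j}=\sum_{(f,a,b,c)}\left(\prod_{1\leq p<r\leq m}(f_{pr}+1)\right)\left(\prod_{i=1}^m\frac{m!}{a_i!\,b_i!\,c_i!}\right),$$ where the sum is over all arrays of nonnegative integers $f=(f_{pr})_{1\leq p<r\leq m}$, $(a_i)_{i=1}^m$, $(b_i)_{i=1}^m$, $(c_i)_{i=1}^m$ such that for every $1\leq i\leq m$ $$a_i+b_i+c_i=m,\qquad 2a_i+b_i=2(m-i)+\sum_{r>i}f_{ir}-\sum_{p<i}f_{pi},$$ and $\sum_{i=1}^m c_i=N+j$. Consequently $$h_{m+2}^*(y)=y^NA_m(y),\qquad A_m(y)=\sum_{k=0}^{2e}a_{m,k}y^k\in\mathbb Z[y],$$ where every $a_{m,k}$ ($0\le k\le 2e$) is positive. In particular the order at zero of $h_{m+2}^*(y)$ is exactly $N$, and its degree is $N+2e$. (ii) Every zero of $A_m(y)$ is a negative real number. Thus $h_{m+2}^*(y)$ has a zero of multiplicity $N$ at zero and all its other zeros are negative. (iii) The coefficients $a_{m,k}$ are palindromic and, when $e\geq1$, increase strictly to their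 middle coefficient: $$a_{m,k}=a_{m,2e-k}\quad(0\leq k\leq2e),\qquad 0<a_{m,0}<a_{m,1}<\cdots<a_{m,e}.$$ They satisfy $$a_{m,k}^2\geq\frac{(k+1)(2e-k+1)}{k(2e-k)}\,a_{m,k-1}a_{m,k+1}\qquad(1\leq k<2e).$$ For $m=1$ the assertions read $h_3^*(y)=y$ and $A_1(y)=1$.
   Context: Iterated Laurent series: for a field $K$, $K((z_1))\cdots((z_r))$ is defined recursively as the field of formal Laurent series in $z_r$ (exponents bounded below) with coefficients in $K((z_1))\cdots((z_{r-1}))$. Every rational function in $K(z_1,\ldots,z_r)$ has a unique image (expansion) in this field; e.g. for $i<j$, $\frac1{z_i-z_j}=\sum_{k\geq0}z_i^{-k-1}z_j^k$. The constant term $\mathrm{CT}_{z_1,\ldots,z_r}F$ is the coefficient of $z_1^0\cdots z_r^0$ in $F$. For $n\geq3$ and integers $t\geq0$ define $$h_n(t)=\mathrm{CT}_{x_2,\ldots,x_n}\frac{(1-x_n)\prod_{i=2}^{n-1}x_i^{n-1}\prod_{i=2}^{n-1}(x_i-x_n)}{x_n^t\prod_{i=2}^{n}(1-x_i)^3\prod_{2\leq i<j\leq n}(x_i-x_j)^2},$$ where the rational function is expanded in $\mathbb Q((x_2))\cdots((x_n))$. Define the formal power series $$h_n^*(y)=(1-y)^{(n-1)^2+1}\sum_{t\geq0}h_n(t)y^t\in\mathbb Q[[y]].$$ Empty products equal $1$ and empty sums equal $0$. Assertions about zeros of a nonzero constant polynomial hold vacuously. *)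

(* Defs.v *)
From HB Require Import structures.
From mathcomp Require Import all_boot all_order all_algebra.
From mathcomp Require Import zify ring.
From mathcomp Require Import boolp classical_sets functions cardinality fsbigop.
From mathcomp Require Import reals complex.

Set Implicit Arguments.
Unset Strict Implicit.
Unset Printing Implicit Defensive.

Import Order.TTheory GRing.Theory Num.Theory.

Local Open Scope ring_scope.

Definition bounded_below (K : fieldType) : {pred int -> K} :=
  fun f => `[< exists n : int, forall k, k < n -> f k = 0 >].

Record laurent (K : fieldType) := MkLaurent {
  lcoef :> int -> K;
  lcoef_bounded : lcoef \in @bounded_below K
}.

Arguments MkLaurent {K} lcoef lcoef_bounded.

HB.instance Definition _ (K : fieldType) := [isSub for @lcoef K].
HB.instance Definition _ (K : fieldType) := [Choice of laurent K by <:].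

Section LaurentZmodule.
Variable K : fieldType.

Lemma bounded_belowP (f : int -> K) :
  reflect (exists n : int, forall k, k < n -> f k = 0) (f \in @bounded_below K).
Proof. exact: asboolP. Qed.

Fact bounded_below_zmod_closed : zmod_closed (@bounded_below K).
Proof.
split=> [|f g /bounded_belowP [m fm] /bounded_belowP [n gn]].
  by apply/bounded_belowP; exists 0.
apply/bounded_belowP; exists (Num.min m n) => k; rewrite lt_min => /andP[km kn].
by rewrite /= fctE /= opprfctE fm// gn// subr0.
Qed.

HB.instance Definition _ :=
  GRing.isZmodClosed.Build (int -> K) (@bounded_below K) bounded_below_zmod_closed.
HB.instance Definition _ := [SubChoice_isSubZmodule of laurent K by <:].

Implicit Types f g h : laurent K.

Lemma laurentP f g : (forall k, f k = g k) <-> f = g.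
Proof. by split=> [fg|->//]; apply/val_inj/funext. Qed.

Lemma lcoef0 k : (0 : laurent K) k = 0.
Proof. by []. Qed.

Lemma lcoefD f g k : (f + g) k = f k + g k.
Proof. by []. Qed.

Lemma lcoefN f k : (- f) k = - f k.
Proof. by []. Qed.

Definition lbound f (m : int) := forall k, k < m -> f k = 0.

Lemma lboundP f : exists m, lbound f m.
Proof. by have /bounded_belowP := lcoef_bounded f. Qed.

Lemma lbound_le f m n : n <= m -> lbound f m -> lbound f n.
Proof. by move=> nm fm k kn; rewrite fm//; apply: lt_le_trans kn nm. Qed.

End LaurentZmodule.

Section LaurentMul.
Variable K : fieldType.
Implicit Types (f g h : laurent K) (m n p : int).

(* For each k only finitely many terms of this sum are nonzero. *)
Definition lmul_fun f g : int -> K :=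
  fun k => \sum_(i \in [set: int]) f i * g (k - i).

(* Coefficients m, ..., m + d of f, as a polynomial. *)
Definition ltrunc m d f : {poly K} := \poly_(i < d.+1) f (m + i%:Z).

Lemma ltrunc_coef m d f i : (i <= d)%N -> (ltrunc m d f)`_i = f (m + i%:Z).
Proof. by move=> id; rewrite coef_poly ltnS id. Qed.

Lemma lmul_fun_low f g m n k : lbound f m -> lbound g n -> k < m + n ->
  lmul_fun f g k = 0.
Proof.
move=> fm gn kmn; rewrite /lmul_fun fsbig1// => i _.
have [/fm ->|mi] := ltP i m; first by rewrite mul0r.
by rewrite gn ?mulr0//; lia.
Qed.

Lemma lmul_fun_trunc f g m n d D : lbound f m -> lbound g n -> (d <= D)%N ->
  lmul_fun f g (m + n + d%:Z) = (ltrunc m D f * ltrunc n D g)`_d.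
Proof.
move=> fm gn dD; rewrite /lmul_fun coefM.
pose s := [seq m + i%:Z | i <- iota 0 d.+1].
have s_uniq : uniq s.
  by rewrite map_inj_uniq ?iota_uniq// => i j /addrI [].
rewrite (fsbigE s) => //; last first.
  move=> i _ nis; have [/fm ->|mi] := ltP i m; first by rewrite mul0r.
  rewrite gn ?mulr0//; rewrite ltNge; apply: contra nis => le_n.
  apply/mapP; exists `|i - m|%N; first by rewrite mem_iota; lia.
  by lia.
rewrite big_map (eq_bigl xpredT) => [|i]; last by rewrite in_setT.
rewrite -[d.+1 in LHS]subn0 -/(index_iota 0 d.+1) big_mkord.
apply: eq_bigr => i _; have id := ltn_ord i.
by rewrite !ltrunc_coef; try lia; congr (f _ * g _); lia.
Qed.

Fact lmul_bounded f g : lmul_fun f g \in @bounded_below K.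
Proof.
have [m fm] := lboundP f; have [n gn] := lboundP g.
by apply/bounded_belowP; exists (m + n) => k; apply: lmul_fun_low.
Qed.

Definition lmul f g := MkLaurent (lmul_fun f g) (lmul_bounded f g).

Lemma lmul_bound f g m n : lbound f m -> lbound g n -> lbound (lmul f g) (m + n).
Proof. by move=> fm gn k; apply: lmul_fun_low. Qed.

Lemma lmulE f g m n d D : lbound f m -> lbound g n -> (d <= D)%N ->
  lmul f g (m + n + d%:Z) = (ltrunc m D f * ltrunc n D g)`_d.
Proof. exact: lmul_fun_trunc. Qed.

Lemma eq_above m f g : lbound f m -> lbound g m ->
  (forall d : nat, f (m + d%:Z) = g (m + d%:Z)) -> f = g.
Proof.
move=> fm gm fg; apply/laurentP => k; have [km|mk] := ltP k m.
  by rewrite fm// gm.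
by have -> : k = m + `|k - m|%N%:Z by lia.
Qed.

Fact lmulC : commutative lmul.
Proof.
move=> f g; have [m fm] := lboundP f; have [n gn] := lboundP g.
apply: (@eq_above (m + n)) => [||d]; first exact: lmul_bound.
  by rewrite addrC; apply: lmul_bound.
by rewrite (lmulE fm gn (leqnn d)) [m + n]addrC (lmulE gn fm (leqnn d)) mulrC.
Qed.

Lemma lmul_trunc f g m n d D : lbound f m -> lbound g n -> (d <= D)%N ->
  (ltrunc (m + n) D (lmul f g))`_d = (ltrunc m D f * ltrunc n D g)`_d.
Proof. by move=> fm gn dD; rewrite ltrunc_coef// (lmulE fm gn dD). Qed.

Lemma lmul3E f g h m n p d : lbound f m -> lbound g n -> lbound h p ->
  lmul (lmul f g) h (m + n + p + d%:Z) =
  (ltrunc m d f * ltrunc n d g * ltrunc p d h)`_d.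
Proof.
move=> fm gn hp; rewrite (lmulE (lmul_bound fm gn) hp (leqnn d)) !coefM.
apply: eq_bigr => i _; congr (_ * _).
by rewrite lmul_trunc// -ltnS.
Qed.

Fact lmulA : associative lmul.
Proof.
move=> f g h; have [m fm] := lboundP f; have [n gn] := lboundP g.
have [p hp] := lboundP h.
rewrite lmulC; apply: (@eq_above (m + n + p)) => [||d].
- by rewrite -addrA addrC; do !apply: lmul_bound.
- by do !apply: lmul_bound.
- rewrite (lmul3E _ fm gn hp) (_ : m + n + p = n + p + m); last by ring.
  by rewrite (lmul3E _ gn hp fm) mulrC mulrA.
Qed.

Fact lmulDl : left_distributive lmul +%R.
Proof.
move=> f g h; have [m1 fm] := lboundP f; have [m2 gm] := lboundP g.
have [n hn] := lboundP h; pose m := Num.min m1 m2.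
have {}fm : lbound f m by apply: lbound_le fm; rewrite ge_min lexx.
have {}gm : lbound g m by apply: lbound_le gm; rewrite ge_min lexx orbT.
have fgm : lbound (f + g) m by move=> k km; rewrite lcoefD fm// gm// addr0.
apply: (@eq_above (m + n)) => [||d]; first exact: lmul_bound.
  by move=> k km; rewrite lcoefD !(@lmul_bound _ _ m n)// addr0.
rewrite lcoefD !(lmulE _ hn (leqnn d))// -coefD -mulrDl; congr ((_ * _ : {poly K})`_d).
by apply/polyP => i; rewrite coefD !coef_poly; case: ifP; rewrite ?addr0.
Qed.

Fact lseries_bounded (u : nat -> K) :
  (fun k : int => if k is Posz i then u i else 0) \in @bounded_below K.
Proof. by apply/bounded_belowP; exists 0; case. Qed.

Definition lseries (u : nat -> K) : laurent K := MkLaurent _ (lseries_bounded u).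

Definition lconst (c : K) : laurent K := lseries (fun i => c *+ (i == 0)%N).

Definition lvar : laurent K := lseries (fun i => (i == 1)%N%:R).

Lemma lseries_bound u : lbound (lseries u) 0.
Proof. by case. Qed.

Lemma lseriesE u (i : nat) : lseries u i = u i.
Proof. by []. Qed.

Lemma lseries_trunc u d i : (i <= d)%N -> (ltrunc 0 d (lseries u))`_i = u i.
Proof. by move=> id; rewrite ltrunc_coef. Qed.

Fact lmul1 : left_id (lconst 1) lmul.
Proof.
move=> f; have [m fm] := lboundP f.
apply: (@eq_above m) => // [|d].
  by rewrite -[m]add0r; apply: lmul_bound => //; apply: lseries_bound.
rewrite -[X in lmul _ _ (X + _)](add0r m).
rewrite (lmulE (@lseries_bound _) fm (leqnn d)).
suff -> : ltrunc 0 d (lconst 1) = 1 by rewrite mul1r ltrunc_coef.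
apply/polyP => i; rewrite coef_poly add0r lseriesE coef1.
by case: ifP => //; case: i.
Qed.

Fact lone_neq0 : lconst 1 != 0.
Proof.
apply/eqP => /laurentP/(_ 0); rewrite lcoef0 => /eqP.
by rewrite (oner_eq0 K).
Qed.

HB.instance Definition _ := GRing.Zmodule_isComNzRing.Build (laurent K)
  lmulA lmulC lmul1 lmulDl lone_neq0.

Lemma lcoefM f g k : (f * g) k = \sum_(i \in [set: int]) f i * g (k - i).
Proof. by []. Qed.

Lemma lcoef1 k : (1 : laurent K) k = (k == 0)%:R.
Proof. by case: k => // -[]. Qed.

(* Inversion of a power series with nonzero constant term: the first n + 1
   coefficients of the inverse. *)
Fixpoint sinv_seq (a : nat -> K) (n : nat) : seq K :=
  if n is n'.+1 then
    let s := sinv_seq a n' in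
    rcons s (- (\sum_(i < n) a (n - i)%N * s`_i) / a 0%N)
  else [:: (a 0%N)^-1].

Definition sinv a (n : nat) := (sinv_seq a n)`_n.

Lemma size_sinv_seq a (n : nat) : size (sinv_seq a n) = n.+1.
Proof. by elim: n => //= n IHn; rewrite size_rcons IHn. Qed.

Lemma sinv_seqE a (n i : nat) : (i <= n)%N -> (sinv_seq a n)`_i = sinv a i.
Proof.
elim: n => [|n IHn] /=; first by rewrite leqn0 => /eqP->.
rewrite leq_eqVlt => /predU1P[->//|]; rewrite ltnS => le_in.
by rewrite nth_rcons size_sinv_seq ltnS le_in IHn.
Qed.

Lemma sinvP a (n : nat) : a 0%N != 0 ->
  \sum_(i < n.+1) a (n - i)%N * sinv a i = (n == 0)%N%:R.
Proof.
move=> a0; case: n => [|n].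
  by rewrite big_ord_recl big_ord0 addr0 /sinv /= mulfV.
rewrite big_ord_recr /= subnn {2}/sinv /= nth_rcons size_sinv_seq ltnn eqxx.
set s := \sum_(i < n.+1) _; set s' := \sum_(i < n.+1) _.
have -> : s = s' by apply: eq_bigr => i _; rewrite sinv_seqE// -ltnS.
by rewrite mulNr mulrN [a 0%N * _]mulrC divfK// subrr.
Qed.

Lemma lorderP f : f != 0 -> exists2 m, lbound f m & f m != 0.
Proof.
move=> f0; have [m fm] := lboundP f.
have exd : exists d : nat, f (m + d%:Z) != 0.
  apply: contrapT => nex; move/eqP: f0; apply; apply: (eq_above fm) => // d.
  by rewrite lcoef0; apply/eqP; apply: contrapT => /negP nd; apply: nex; exists d.
have [d fd min_d] := ex_minnP exd; exists (m + d%:Z) => // k kd.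
have [/fm//|mk] := ltP k m; apply/eqP; apply: contraLR kd => fk.
rewrite -leNgt; have := min_d `|k - m|%N.
have -> : m + `|k - m|%N%:Z = k by lia.
by move=> /(_ fk); lia.
Qed.

Fact lshift_bounded f n : (fun k : int => f (k + n)) \in @bounded_below K.
Proof.
have [m fm] := lboundP f; apply/bounded_belowP; exists (m - n) => k km.
by rewrite fm//; lia.
Qed.

Definition lshift n f := MkLaurent _ (lshift_bounded f n).

Lemma laurent_unitP f : f != 0 -> exists g, g * f = 1.
Proof.
move=> /lorderP[m fm fm0]; pose a i := f (m + i%:Z).
pose g := lshift m (lseries (sinv a)).
have gm : lbound g (- m).
  by move=> k km; apply: (@lseries_bound (sinv a)); rewrite -ltrBrDr sub0r.
exists g; apply: (@eq_above 0) => [||d].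
- by rewrite -(addNr m); apply: lmul_bound.
- by move=> k k0; rewrite lcoef1; case: k k0.
rewrite -[X in (g * f) (X + _)](addNr m) (lmulE gm fm (leqnn d)) lcoef1 add0r.
rewrite eqz_nat -(@sinvP a d) ?/a ?addr0// coefM.
apply: eq_bigr => i _; have := ltn_ord i; rewrite ltnS => id.
rewrite mulrC !ltrunc_coef ?leq_subr//; congr (_ * _).
by rewrite /g /= (_ : - m + _ + m = i%:Z)//; ring.
Qed.

Definition linv f : laurent K :=
  if pselect (exists g, g * f = 1) is left ex then projT1 (cid ex) else 0.

Fact lmulVf f : f != 0 -> linv f * f = 1.
Proof.
by move=> /laurent_unitP ex; rewrite /linv; case: pselect => // ex'; case: cid.
Qed.

Fact linv0 : linv 0 = 0.
Proof.
rewrite /linv; case: pselect => // ex; case: (cid ex) => g /= /esym/eqP.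
by rewrite mulr0 oner_eq0.
Qed.

HB.instance Definition _ :=
  GRing.ComNzRing_isField.Build (laurent K) lmulVf linv0.

End LaurentMul.

Section LaurentExpansion.
Variable K : fieldType.

Lemma lcoef_constM (c : K) (f : laurent K) k : (lconst c * f) k = c * f k.
Proof.
rewrite lcoefM (fsbigE [:: 0]) //= => [|i _].
  by rewrite big_cons big_nil in_setT /= mulr1n addr0 subr0.
by rewrite inE; case: i => [[]|] //= *; rewrite ?mulr0n mul0r.
Qed.

Lemma lcoef_varM (f : laurent K) k : (lvar K * f) k = f (k - 1).
Proof.
rewrite lcoefM (fsbigE [:: 1]) //= => [|i _].
  by rewrite big_cons big_nil in_setT /= mul1r addr0.
by rewrite inE; case: i => [[|[]]|] //= *; rewrite mul0r.
Qed.

(* 1 / (c - z) = sum_k c^(-k-1) z^k *)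
Lemma lconst_sub_var_inv (c : K) : c != 0 ->
  (lconst c - lvar K)^-1 = lseries (fun k => c ^- k.+1).
Proof.
move=> c0; set g := lseries _.
suff e : (lconst c - lvar K) * g = 1.
  have u0 : lconst c - lvar K != 0.
    by apply/eqP => u0; move: e; rewrite u0 mul0r => /esym/eqP; rewrite oner_eq0.
  by apply: (mulfI u0); rewrite e mulfV.
apply/laurentP => k; rewrite mulrBl lcoefD lcoefN lcoef_constM lcoef_varM lcoef1.
case: k => [[|k]|k].
- by rewrite /= expr1 mulfV// subr0.
- rewrite (_ : Posz k.+1 - 1 = Posz k); last by lia.
  by rewrite /= exprS invfM mulrA mulfV// mul1r subrr.
- by rewrite !(@lseries_bound _ _)// mulr0 subr0.
Qed.

End LaurentExpansion.

(* K((z_1))...((z_r)) *)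
Fixpoint ilaurent (K : fieldType) (r : nat) : fieldType :=
  if r is r'.+1 then laurent (ilaurent K r') else K.

(* The variable z_i of K((z_1))...((z_r)), for 1 <= i <= r. *)
Fixpoint ivar (K : fieldType) (r i : nat) : ilaurent K r :=
  if r is r'.+1 then
    if i == r'.+1 then lvar (ilaurent K r') else lconst (ivar K r' i)
  else 0.

Fixpoint CT (K : fieldType) (r : nat) : ilaurent K r -> K :=
  if r is r'.+1 then fun F => CT (lcoef F 0) else id.

(* The expansion map K(z_1, ..., z_r) -> K((z_1))...((z_r)) is a morphism of
   fields sending z_i to ivar K r i, so a rational function is expanded by
   evaluating it at the ivar's with the operations of the field ilaurent K r.
   Here x_2, ..., x_n play the role of z_1, ..., z_(n-1). *)
Definition h_integrand (n t : nat) : ilaurent rat n.-1 :=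
  let x (i : nat) := ivar rat n.-1 i.-1 in
  ((1 - x n) * (\prod_(2 <= i < n) x i ^+ n.-1) * \prod_(2 <= i < n) (x i - x n))
  / (x n ^+ t * (\prod_(2 <= i < n.+1) (1 - x i) ^+ 3)
     * \prod_(2 <= i < n.+1) \prod_(i.+1 <= j < n.+1) (x i - x j) ^+ 2).

Definition h (n t : nat) : rat := CT (h_integrand n t).

(* Q[[y]] is regarded as a subring of Q((y)). *)
Definition yvar : laurent rat := lvar rat.

Definition hstar (n : nat) : laurent rat :=
  (1 - yvar) ^+ (n.-1 ^ 2).+1 * lseries (h n).

Definition has_order (f : laurent rat) (n : int) :=
  f n != 0 /\ forall k, k < n -> f k = 0.

Definition has_degree (f : laurent rat) (n : int) :=
  f n != 0 /\ forall k, n < k -> f k = 0.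

Definition ordN (m : nat) : nat := (m.+1 ^ 2) %/ 4.
Definition halfe (m : nat) : nat := (m ^ 2) %/ 4.

Definition gamma_array (m : nat) : Type :=
  ('M[nat]_m * {ffun 'I_m -> nat} * {ffun 'I_m -> nat} * {ffun 'I_m -> nat})%type.
HB.instance Definition _ (m : nat) := Choice.on (gamma_array m).

(* Arrays (f_pr) indexed by p < r are encoded as strictly upper triangular
   matrices. The ordinal i : 'I_m stands for the index i + 1 of the formula. *)
Definition gamma_index (m j : nat) : set (gamma_array m) :=
  [set u : gamma_array m | let: (f, a, b, c) := u in
    [/\ forall p r : 'I_m, (r <= p)%N -> f p r = 0%N,
        forall i, (a i + b i + c i = m)%N,
        forall i : 'I_m, (2 * a i + b i)%:Z =
          2 * (m%:Z - i.+1%:Z) + \sum_(r < m | (i < r)%N) (f i r)%:Z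
                               - \sum_(p < m | (p < i)%N) (f p i)%:Z
      & (\sum_(i < m) c i = ordN m + j)%N]]%classic.
Arguments gamma_index : clear implicits.

Definition gamma_weight (m : nat) (u : gamma_array m) : nat :=
  let: (f, a, b, c) := u in
  (\prod_(p < m) \prod_(r < m | (p < r)%N) (f p r + 1)
   * \prod_(i < m) (m`! %/ ((a i)`! * (b i)`! * (c i)`!)))%N.

Definition gamma (m j : nat) : nat :=
  \big[addn/0%N]_(u \in gamma_index m j) gamma_weight u.

Definition negative_real (R : realType) (z : R[i]%C) : Prop :=
  exists2 x : R, x < 0 & z = x%:C%C.

(* Main.v *)
(* Expanding the factors 1 / (x_i - x_j) ^ 2 writes h(t) as a sum over flows f, that is
   nonnegative integers on the pairs i < j, of prod (f_p + 1) times a product over the vertices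
   of coefficients that depend only on the net flow there.  Shifting f on one pair telescopes
   such sums; the resulting Ward identities make them invariant under translations and Moebius
   transformations of the generating function of the vertex coefficients, and turn h* into the
   sum with vertex coefficients [w ^ d] (w + y) ^ m (1 + w) ^ m.  The gamma expansion is read off
   from (w + y) (1 + w) = w ^ 2 + (1 + y) w + y.

   For the zeros, take the vertex coefficients from prod_k (w + z_k), with 2m variables, and show
   that the sum does not vanish if all Im z_k > 0.  The weight prod (f_p + 1) is the stationary
   state of a heat equation on flows, whose energy is at least 2 on every nonzero flow; hence it
   is the limit of the evolution that starts at the zero flow.  One step of the evolution applies
   the multiplier 1 - eps d ^ 2 to prod_k (w + z_k) and the multiplier q ^ (j ^ 2) in each z_k,
   and both preserve nonvanishing.  By homogeneity, (y, ..., y, 1, ..., 1) can be rotated into the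
   upper half-plane unless y is a negative real number. *)

From HB Require Import structures.
From mathcomp Require Import all_boot all_order all_algebra perm.
From mathcomp Require Import zify ring lra.
From mathcomp Require Import boolp classical_sets functions cardinality fsbigop.
From mathcomp Require Import reals realalg complex.
Require Import Defs.

Set Implicit Arguments.
Unset Strict Implicit.
Unset Printing Implicit Defensive.

Import Order.TTheory GRing.Theory Num.Theory.

Local Open Scope ring_scope.

(** * Flows and Ward identities *)

(** Every flow sum is finite: a large value on one pair forces a very negative [net] at some vertex,
    where the coefficient vanishes. The box bound [K] stays free, so that truncations of different
    length can be compared.

    Three changes of variable act in turn: u -> u + y moves the pole at x_n to 0; u -> (1 - y) u
    produces a power of 1 - y which, with (1 - x_n) ^ -2, is exactly cancelled by the prefactor of
    h*; a Moebius flow trades the triple pole at 1 for the factor (1 + w) ^ m.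

    The part on zeros works over any archimedean real closed field: the reals serve for (ii), the
    real algebraic numbers for the rational inequalities in (iii). Explicit estimates therefore
    replace analysis: a lower bound from the roots plays the role of Hurwitz's theorem, dyadic roots
    that of exponentials, and O(e ^ 2) bounds that of derivatives. Each of the two factors of an
    evolution step preserves nonvanishing exactly, but their product matches the generator only to
    first order, so short steps are iterated while the accumulated error is controlled. *)

Section Flows.
Variable n : nat.

Definition pairs := {p : 'I_n * 'I_n | (p.1 < p.2)%N}.

Implicit Types (p : pairs) (f : pairs -> nat) (i : 'I_n).

Definition src p : 'I_n := (val p).1.
Definition tgt p : 'I_n := (val p).2.

Lemma src_lt_tgt p : (src p < tgt p)%N.
Proof. exact: (valP p). Qed.

(** Twice the number of pairs with source [i]: the contribution of the zero flow. *)
Definition lam i : int := (n.-1 - i)%N%:Z *+ 2.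

Definition excess f i : int :=
  \sum_(p | src p == i) (f p)%:Z - \sum_(p | tgt p == i) (f p)%:Z.

(* The exponent of [u_i^-1] in [\prod_p u_(src p) ^ (- f p - 2) * u_(tgt p) ^ f p]. *)
Definition net f i : int := lam i + excess f i.

Definition wt f : nat := \prod_p (f p).+1.

Lemma sum_excess (R : comNzRingType) f (c : 'I_n -> R) :
  \sum_i c i * (excess f i)%:~R = \sum_p (f p)%:R * (c (src p) - c (tgt p)).
Proof.
have mx (s : pairs -> 'I_n) : \sum_i c i * (\sum_(p | s p == i) (f p)%:Z)%:~R =
    \sum_p (f p)%:R * c (s p).
  under eq_bigr => i _ do rewrite rmorph_sum mulr_sumr.
  rewrite (exchange_big_dep xpredT) //=; apply: eq_bigr => p _.
  by rewrite (big_pred1 (s p)) => [|i]; rewrite 1?eq_sym // mulrC -pmulrn.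
under eq_bigr => i _ do rewrite rmorphB mulrBr.
rewrite sumrB !mx -sumrB; apply: eq_bigr => p _.
by rewrite mulrBr.
Qed.

Lemma big_pairs (R : Type) (idx : R) (op : Monoid.com_law idx)
    (F : 'I_n -> 'I_n -> R) :
  \big[op/idx]_p F (src p) (tgt p) =
  \big[op/idx]_(i < n) \big[op/idx]_(j < n | (i < j)%N) F i j.
Proof.
rewrite pair_big_dep /=.
rewrite [RHS](reindex_omap (val : pairs -> _) insub) /=; last first.
  by move=> q lt_q; rewrite insubT.
apply: eq_bigl => -[q lt_q] /=; rewrite lt_q /=.
by rewrite insubT; apply/esym/eqP; congr Some; apply: val_inj.
Qed.

Lemma big_src (R : Type) (idx : R) (op : Monoid.com_law idx) i
    (F : 'I_n -> R) :
  \big[op/idx]_(p | src p == i) F (tgt p) =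
  \big[op/idx]_(j < n | (i < j)%N) F j.
Proof.
rewrite big_mkcond (big_pairs op (fun a b => if a == i then F b else idx)).
rewrite (bigD1 i) //= [X in op _ X]big1 ?Monoid.mulm1 => [|j /negPf nji].
  by apply: eq_bigr => j _; rewrite eqxx.
by rewrite big1 // => k _; rewrite nji.
Qed.

Lemma big_tgt (R : Type) (idx : R) (op : Monoid.com_law idx) i
    (F : 'I_n -> R) :
  \big[op/idx]_(p | tgt p == i) F (src p) =
  \big[op/idx]_(j < n | (j < i)%N) F j.
Proof.
rewrite big_mkcond (big_pairs op (fun a b => if b == i then F a else idx)).
rewrite [RHS]big_mkcond; apply: eq_bigr => j _ /=.
rewrite (big_mkcond (fun b : 'I_n => (j < b)%N)) (bigD1 i) //= eqxx.
by rewrite big1 ?Monoid.mulm1 // => k /negPf ->; rewrite if_same.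
Qed.

Lemma card_below (k : nat) : (k <= n)%N -> #|[pred j : 'I_n | (j < k)%N]| = k.
Proof.
move=> kn; rewrite -sum1_card -[RHS](card_ord k) -sum1_card.
by rewrite (big_ord_widen n (fun=> 1%N)).
Qed.

Lemma card_src i : #|[pred p | src p == i]| = (n.-1 - i)%N.
Proof.
rewrite -sum1_card (big_src _ i (fun=> 1%N)) sum1_card.
have := cardC [pred j : 'I_n | (j < i.+1)%N].
rewrite card_below // card_ord => e.
suff -> : #|[pred j : 'I_n | (i < j)%N]| = #|[predC [pred j : 'I_n | (j < i.+1)%N]]|.
  by move: #|_| e => c e; have := ltn_ord i; lia.
by apply: eq_card => j; rewrite !inE ltnS -ltnNge.
Qed.

Lemma card_tgt i : #|[pred p | tgt p == i]| = i.
Proof.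
by rewrite -sum1_card (big_tgt _ i (fun=> 1%N)) sum1_card card_below // ltnW.
Qed.

Lemma sum_net (R : comNzRingType) f (c : 'I_n -> R) :
  \sum_i c i * (net f i)%:~R =
  \sum_i c i * (lam i)%:~R + \sum_p (f p)%:R * (c (src p) - c (tgt p)).
Proof.
rewrite -sum_excess -big_split; apply: eq_bigr => i _.
by rewrite /net rmorphD mulrDr.
Qed.

Lemma sum_lam : \sum_i lam i = (n * n.-1)%N%:Z.
Proof.
have sumI k : (\sum_(i < k) 2 * i = k * k.-1)%N.
  by elim: k => [|k IH]; rewrite ?big_ord0 // big_ord_recr IH /=; case: k {IH} => //=; lia.
rewrite -sumI (big_morph Posz PoszD (erefl _)) (reindex_inj rev_ord_inj) /=.
by apply: eq_bigr => i _; rewrite /lam /=; have := ltn_ord i; lia.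
Qed.

Lemma total_net f : \sum_i net f i = (n * n.-1)%N%:Z.
Proof.
have := sum_net f (fun=> 1 : int).
rewrite [X in _ = _ + X]big1 ?addr0 => [|p _]; last by rewrite subrr mulr0.
under eq_bigr => i _ do rewrite mul1r intz.
by under [in RHS]eq_bigr => i _ do rewrite mul1r intz; rewrite sum_lam.
Qed.

(** Pair [net] with the potential i: each unit of flow climbs by at least 1, so [f p] is at most
    \sum_i i * (lam i - net f i), whose terms are bounded. This confines all later sums to a box. *)
Lemma net_bound f (T : nat) :
  (forall i, - T%:Z <= net f i) -> forall p, (f p <= n * n * (2 * n + T))%N.
Proof.
move=> geT p.
have := sum_net f (fun i => i%:Z); under eq_bigr => i _ do rewrite intz.
under [in RHS]eq_bigr => i _ do rewrite intz.
set s1 := \sum_i _; set s2 := \sum_i _; set s3 := \sum_p _ => e.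
have s3E : \sum_p (f p)%:Z * ((tgt p)%:Z - (src p)%:Z) = s2 - s1.
  rewrite e opprD addNKr /s3 -sumrN; apply: eq_bigr => q _.
  by rewrite -mulrN opprB natz.
have le1 : (f p)%:Z <= s2 - s1.
  rewrite -s3E (bigD1 p) //=; apply: (@le_trans _ _ ((f p)%:Z * ((tgt p)%:Z - (src p)%:Z))).
    by rewrite ler_peMr //; have := src_lt_tgt p; lia.
  rewrite lerDl sumr_ge0 // => q _; rewrite mulr_ge0 //.
  by have := src_lt_tgt q; lia.
have le2 : s2 - s1 <= \sum_(i < n) (n * (2 * n + T))%N%:Z.
  rewrite /s1 /s2 -sumrB; apply: ler_sum => i _; rewrite -mulrBr.
  have := ltn_ord i; have := geT i; rewrite /lam; nia.
rewrite -lez_nat (le_trans le1) // (le_trans le2) //.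
by rewrite sumr_const card_ord -mulr_natr natz -PoszM lez_nat mulnC mulnA.
Qed.

(** This form fits the weight: raising [f p] by 1 multiplies [wt] by (f p + 2) / (f p + 1), so a
    factor f p + 2 at one end telescopes against f p at the other. [net_shiftE] is the analogue with
    source and target exchanged. *)
Lemma netE f i :
  net f i = \sum_(p | src p == i) ((f p)%:Z + 2) - \sum_(p | tgt p == i) (f p)%:Z.
Proof.
rewrite big_split /= sumr_const card_src /net /excess /lam addrA; congr (_ - _).
by rewrite addrC; congr (_ + _); lia.
Qed.

Lemma net_shiftE f i :
  net f i - (n.-1)%:Z *+ 2 =
  \sum_(p | src p == i) (f p)%:Z - \sum_(p | tgt p == i) ((f p)%:Z + 2).
Proof.
rewrite [in RHS]big_split /= sumr_const card_tgt /net /excess /lam.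
set a := \sum_(_ | _) _; set b := \sum_(_ | _) _; move: a b => a b.
by have := ltn_ord i; lia.
Qed.

(** * Flow sums over a box and their Ward identities *)

Section Box.
Variable K : nat.
Local Notation box := {ffun pairs -> 'I_K.+1}.
Implicit Types (g : box).

Definition bx g p : nat := g p.

Definition upd g p (v : 'I_K.+1) : box := [ffun q => if q == p then v else g q].

Lemma upd_id g p : upd g p (g p) = g.
Proof. by apply/ffunP => q; rewrite ffunE; case: eqP => [->|]. Qed.

Lemma updE g p v : upd g p v p = v.
Proof. by rewrite ffunE eqxx. Qed.

Lemma upd_upd g p v w : upd (upd g p v) p w = upd g p w.
Proof. by apply/ffunP => q; rewrite !ffunE; case: eqP. Qed.

Lemma excess_upd g p (v : 'I_K.+1) i :
  excess (bx (upd g p v)) i = excess (bx g) i + (v%:Z - (g p)%:Z) * ((src p == i)%:R - (tgt p == i)%:R).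
Proof.
have sumU (s : pairs -> 'I_n) : \sum_(q | s q == i) (bx (upd g p v) q)%:Z =
    \sum_(q | s q == i) (bx g q)%:Z + (v%:Z - (g p)%:Z) * (s p == i)%:R.
  have [spi|spi] := eqVneq (s p) i; last first.
    rewrite mulr0 addr0; apply: eq_bigr => q /eqP sqi; rewrite /bx ffunE.
    by case: eqP => // qp; rewrite -qp sqi eqxx in spi.
  rewrite (bigD1 p) /= ?spi // [in RHS](bigD1 p) /= ?spi // /bx updE mulr1.
  rewrite addrAC subrKC; congr (_ + _); apply: eq_bigr => q /andP[_ /negPf qp].
  by rewrite /bx ffunE qp.
rewrite /excess !sumU mulrBr; ring.
Qed.

Lemma net_upd g p (v : 'I_K.+1) i :
  net (bx (upd g p v)) i = net (bx g) i + (v%:Z - (g p)%:Z) * ((src p == i)%:R - (tgt p == i)%:R).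
Proof. by rewrite /net excess_upd addrA. Qed.

Lemma src_neq_tgt p : (src p == tgt p) = false.
Proof. by apply/negbTE/eqP => e; have := src_lt_tgt p; rewrite e ltnn. Qed.

Lemma net_upd_src g p v : net (bx (upd g p v)) (src p) = net (bx g) (src p) + (v%:Z - (g p)%:Z).
Proof. by rewrite net_upd eqxx eq_sym src_neq_tgt subr0 mulr1. Qed.

Lemma net_upd_tgt g p v : net (bx (upd g p v)) (tgt p) = net (bx g) (tgt p) - (v%:Z - (g p)%:Z).
Proof. by rewrite net_upd eqxx src_neq_tgt sub0r mulrN1. Qed.

Lemma net_upd_neq g p v i : i != src p -> i != tgt p -> net (bx (upd g p v)) i = net (bx g) i.
Proof.
rewrite net_upd ![i == _]eq_sym => /negPf -> /negPf ->.
by rewrite subr0 mulr0 addr0.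
Qed.

Lemma wt_upd g p v : (wt (bx (upd g p v)) * (g p).+1 = wt (bx g) * v.+1)%N.
Proof.
rewrite /wt (bigD1 p) //= [in RHS](bigD1 p) //= /bx updE.
rewrite (eq_bigr (fun q => (g q).+1)); last first.
  by move=> q /negPf qp; rewrite /bx ffunE qp.
by rewrite mulnAC [RHS]mulnAC (mulnC v.+1).
Qed.

(* Cyclic shift of one coordinate: the bijection behind the telescoping sums. *)
Lemma reindex_shift (R : nmodType) p (F : box -> R) :
  \sum_g F g = \sum_g F (upd g p (ordS (g p))).
Proof.
rewrite (reindex (fun g => upd g p (ordS (g p)))) //.
exists (fun g => upd g p (ord_pred (g p))) => g _.
  by rewrite upd_upd updE ordSK upd_id.
by rewrite upd_upd updE ord_predK upd_id.
Qed.

(** The constant term of \prod_i P(u_i) * \prod_p (u_(src p) - u_(tgt p)) ^ -2, where P(u) has the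
    coefficients [phi], restricted to flows with values at most [K]. *)
Definition Lam (R : pzSemiRingType) (phi : int -> R) : R :=
  \sum_g (wt (bx g))%:R * \prod_i phi (net (bx g) i).

(** Telescoping along one pair: the shift is cyclic, and the two boundary conditions kill the term
    that wraps around. *)
Lemma sum_shift_eq (R : nmodType) p (F G : box -> R) :
  (forall g (lt_gK : (g p < K)%N), F g = G (upd g p (inord (g p).+1))) ->
  (forall g, g p = K :> nat -> F g = 0) ->
  (forall g, g p = 0%N :> nat -> G g = 0) ->
  \sum_g F g = \sum_g G g.
Proof.
move=> FG F0 G0; rewrite [RHS](reindex_shift p); apply: eq_bigr => g _.
have [lt_gK|] := ltnP (g p) K.
  rewrite FG //; congr (G (upd _ _ _)); apply: val_inj.
  by rewrite /= inordK ?ltnS // modn_small ?ltnS.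
rewrite leq_eqVlt ltnNge -ltnS ltn_ord orbF => /eqP eK.
by rewrite F0 // G0 // updE /= -eK modnn.
Qed.

Section Ward.
Variables (R : comNzRingType) (phi : int -> R) (T : nat).
Hypothesis phi0 : forall d : int, d < - T%:Z -> phi d = 0.
Hypothesis K_large : (n * n * (2 * n + T.+1) < K)%N.

Let Phi g i (e : int) := phi (net (bx g) i + e) * \prod_(j | j != i) phi (net (bx g) j).

(** Room for [T.+1] instead of [T] is needed because the argument at [i] is shifted by [e]. *)
Lemma Phi_edge g i e p : g p = K :> nat -> -1 <= e <= 1 -> Phi g i e = 0.
Proof.
move=> gK /andP[e1 e2]; case: (pselect (exists j, net (bx g) j < - T.+1%:Z)) => [[j lt_j]|nex].
  rewrite /Phi; have [<-|ji] := eqVneq j i; first by rewrite phi0 ?mul0r //; lia.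
  by rewrite (bigD1 j) //= (phi0 (d := net (bx g) j)) ?mul0r ?mulr0 //; lia.
have ge_i j : - T.+1%:Z <= net (bx g) j.
  by rewrite leNgt; apply/negP => lt_j; apply: nex; exists j.
by have := net_bound ge_i p; rewrite /bx gK leqNgt K_large.
Qed.

(** One more unit on [p] raises [net] by 1 at the source and lowers it by 1 at the target, so a
    shift at one end before the move equals the same shift at the other end after it. *)
Lemma Phi_src_tgt g p (v : 'I_K.+1) : v = (g p).+1 :> nat ->
  Phi g (src p) 1 = Phi (upd g p v) (tgt p) 1 /\
  Phi g (tgt p) (- 1) = Phi (upd g p v) (src p) (- 1).
Proof.
move=> vE; have st := src_neq_tgt p; have ts := st; rewrite eq_sym in ts.
rewrite /Phi !(bigD1 (P := fun j => j != src p) (tgt p)) ?ts //=.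
rewrite !(bigD1 (P := fun j => j != tgt p) (src p)) ?st //=.
rewrite net_upd_src net_upd_tgt vE.
pose rest g' := \prod_(j | (j != src p) && (j != tgt p)) phi (net (bx g') j).
have restC g' : \prod_(j | (j != tgt p) && (j != src p)) phi (net (bx g') j) = rest g'.
  by apply: eq_bigl => j; rewrite andbC.
have restU : rest (upd g p v) = rest g.
  by apply: eq_bigr => j /andP[js jt]; rewrite net_upd_neq.
rewrite !restC -!/(rest _) restU.
have -> : (g p).+1%:Z - (g p)%:Z = 1 by lia.
by rewrite subrK addrK; split; rewrite mulrCA.
Qed.

Lemma wt_step g p (v : 'I_K.+1) : v = (g p).+1 :> nat ->
  (wt (bx g) * (g p).+2 = wt (bx (upd g p v)) * (g p).+1)%N.
Proof. by move=> vE; rewrite wt_upd vE. Qed.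

(** Serves both identities: [s], [t] are source and target in [ward_down] and exchanged in
    [ward_up]. The sum splits over pairs, and each pair telescopes. *)
Let ward (s t : pairs -> 'I_n) (e : int) (c : box -> 'I_n -> int) : -1 <= e <= 1 ->
  (forall g i, c g i = \sum_(p | s p == i) ((g p)%:Z + 2) - \sum_(p | t p == i) (g p)%:Z) ->
  (forall g p (v : 'I_K.+1), v = (g p).+1 :> nat -> Phi g (s p) e = Phi (upd g p v) (t p) e) ->
  \sum_g (wt (bx g))%:R * \sum_i (c g i)%:~R * Phi g i e = 0.
Proof.
move=> e1 cE PhiE; under eq_bigr => g _.
  under eq_bigr => i _.
    rewrite cE rmorphB !rmorph_sum mulrBl !mulr_suml; over.
  rewrite sumrB mulrBr; over.
rewrite sumrB; apply/eqP; rewrite subr_eq0; apply/eqP.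
rewrite [LHS](eq_bigr (fun g => \sum_p (wt (bx g) * (g p).+2)%:R * Phi g (s p) e)); last first.
  move=> g _; rewrite (exchange_big_dep xpredT) //= mulr_sumr; apply: eq_bigr => p _.
  rewrite (big_pred1 (s p)) => [|i]; last by rewrite eq_sym.
  by rewrite mulrA natrM; congr (_ * _ * _); rewrite -[2]/(2%:Z) -PoszD addn2 -pmulrn.
rewrite [RHS](eq_bigr (fun g => \sum_p (wt (bx g) * (g p))%:R * Phi g (t p) e)); last first.
  move=> g _; rewrite (exchange_big_dep xpredT) //= mulr_sumr; apply: eq_bigr => p _.
  rewrite (big_pred1 (t p)) => [|i]; last by rewrite eq_sym.
  by rewrite mulrA natrM -pmulrn.
rewrite exchange_big [RHS]exchange_big; apply: eq_bigr => p _ /=.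
apply: (sum_shift_eq (p := p)) => [g lt_gK|g gK|g ->].
- have vE : (inord (g p).+1 : 'I_K.+1) = (g p).+1 :> nat by rewrite inordK.
  by rewrite (wt_step vE) (PhiE _ _ _ vE) updE vE.
- by rewrite (Phi_edge _ gK e1) mulr0.
- by rewrite muln0 mul0r.
Qed.

(** Infinitesimal translation: \sum_d d * phi (d + 1) * u ^ d is u * (P / u)', and P / u is what is
    integrated against du when the constant term is read as a residue. *)
Lemma ward_down :
  \sum_g (wt (bx g))%:R * \sum_i (net (bx g) i)%:~R * Phi g i 1 = 0.
Proof.
by apply: (ward (s := src) (t := tgt)) => // [g i|g p v vE]; [exact: netE|exact: (Phi_src_tgt vE).1].
Qed.

(** Infinitesimal Moebius transformation: for n > 0 the vertex factor has the coefficients of u ^ 2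
    * P' - (2 n - 3) * u * P. *)
Lemma ward_up :
  \sum_g (wt (bx g))%:R * \sum_i (net (bx g) i - n.-1%:Z *+ 2)%:~R * Phi g i (- 1) = 0.
Proof.
apply: oppr_inj; rewrite oppr0 -[RHS](@ward tgt src (- 1) (fun g i => - (net (bx g) i - n.-1%:Z *+ 2))) //.
- rewrite -sumrN; apply: eq_bigr => g _; rewrite -mulrN -sumrN; congr (_ * _).
  by apply: eq_bigr => i _; rewrite rmorphN mulNr.
- by move=> g i; rewrite net_shiftE opprB.
- by move=> g p v vE; exact: (Phi_src_tgt vE).2.
Qed.

End Ward.

End Box.

End Flows.

(** * Iterated Laurent series *)

Section Embedding.
Variable K : fieldType.

Lemma lconst_zmod_morphism : zmod_morphism (@lconst K).
Proof.
by move=> a b; apply/laurentP; case=> [[|k]|k]; rewrite !(lcoefD, lcoefN) /= ?subrr.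
Qed.

HB.instance Definition _ :=
  GRing.isZmodMorphism.Build K (laurent K) (@lconst K) lconst_zmod_morphism.

Lemma lconst_monoid_morphism : monoid_morphism (@lconst K).
Proof.
split=> [|a b]; first by [].
by apply/laurentP => k; rewrite lcoef_constM; case: k => [[|k]|k]; rewrite /= ?mulr0.
Qed.

HB.instance Definition _ :=
  GRing.isMonoidMorphism.Build K (laurent K) (@lconst K) lconst_monoid_morphism.

Lemma lseriesM (a b : nat -> K) :
  lseries a * lseries b = lseries (fun k => \sum_(i < k.+1) a i * b (k - i)%N).
Proof.
apply: (@eq_above _ (0 + 0)) => [||d].
- by apply: lmul_bound; apply: lseries_bound.
- exact: lseries_bound.
rewrite (lmulE (@lseries_bound _ a) (@lseries_bound _ b) (leqnn d)) coefM.
rewrite [in RHS]addr0 add0r lseriesE; apply: eq_bigr => i _.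
by rewrite !lseries_trunc ?leq_subr // -ltnS.
Qed.

Lemma lvarXE (n : nat) k : (lvar K ^+ n) k = (k == n)%:R.
Proof.
elim: n k => [|n IH] k; first by rewrite expr0 lcoef1.
by rewrite exprS lcoef_varM IH; congr (_%:R); lia.
Qed.

Lemma lvar_neq0 : lvar K != 0.
Proof.
by apply/eqP => /laurentP/(_ 1) /= /eqP; rewrite (oner_eq0 K).
Qed.

Lemma lcoef_varzM (f : laurent K) (n k : int) : (lvar K ^ n * f) k = f (k - n).
Proof.
have pos (m : nat) (g : laurent K) j : (lvar K ^+ m * g) j = g (j - m%:Z).
  elim: m j => [|m IH] j; first by rewrite mul1r subr0.
  by rewrite exprS -mulrA lcoef_varM IH; congr (g _); lia.
case: n => n; first exact: pos.
have := pos n.+1 (lvar K ^ (Negz n) * f) (k - Negz n).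
rewrite mulrA mulfV ?expf_neq0 ?lvar_neq0 // mul1r => ->.
by congr (_ _); lia.
Qed.

End Embedding.

(** * Weight filtration on iterated Laurent series *)

Section Order.
Variable K : fieldType.

(* Every monomial of [F] has weight at least [k], where [u_i] has weight [i]. *)
Fixpoint ordge (r : nat) : int -> ilaurent K r -> Prop :=
  if r is r'.+1 then fun k F => forall j, ordge (k - j * r'.+1%:Z) (lcoef F j)
  else fun k F => 0 < k -> F = 0.
Arguments ordge {r}.

Lemma ordge0 r k : @ordge r k 0.
Proof. by elim: r k => //= r IH k j; apply: IH. Qed.

Lemma ordgeD r k (F G : ilaurent K r) : ordge k F -> ordge k G -> ordge k (F + G).
Proof.
elim: r k F G => [|r IH] k F G /=; last by move=> HF HG j; apply: IH.
by move=> HF HG k0; rewrite HF // HG // addr0.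
Qed.

Lemma ordgeN r k (F : ilaurent K r) : ordge k F -> ordge k (- F).
Proof.
elim: r k F => [|r IH] k F /=; last by move=> HF j; apply: IH.
by move=> HF k0; rewrite HF // oppr0.
Qed.

Lemma ordgeB r k (F G : ilaurent K r) : ordge k F -> ordge k G -> ordge k (F - G).
Proof. by move=> HF HG; apply: ordgeD => //; apply: ordgeN. Qed.

Lemma ordge_le r k l (F : ilaurent K r) : l <= k -> ordge k F -> ordge l F.
Proof.
elim: r k l F => [|r IH] k l F lk /=; last by move=> HF j; apply: IH (HF j); lia.
by move=> HF l0; apply: HF; apply: lt_le_trans lk.
Qed.

Lemma ordgeM r k l (F G : ilaurent K r) :
  ordge k F -> ordge l G -> ordge (k + l) (F * G).
Proof.
elim: r k l F G => [|r IH] k l F G.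
  move=> /= HF HG; case: (ltP 0 k) => [/HF ->|k0]; first by rewrite mul0r.
  by move=> kl; rewrite HG ?mulr0 //; lia.
move=> HF HG j; rewrite (@lcoefM (ilaurent K r)); apply: big_ind => [|x y|i _].
- exact: ordge0.
- exact: ordgeD.
have -> : k + l - j * r.+1%:Z = (k - i * r.+1%:Z) + (l - (j - i) * r.+1%:Z) by ring.
exact: IH.
Qed.

Lemma ordge_nat r (n : nat) : @ordge r 0 n%:R.
Proof.
elim: n => [|n IH]; first exact: ordge0.
rewrite -natr1; apply: ordgeD => //.
elim: r {n IH} => [|r IH] // j; rewrite (@lcoef1 (ilaurent K r)); case: eqP => [->|_].
  by rewrite mul0r subr0.
exact: ordge0.
Qed.

Lemma ordge1 r : @ordge r 0 1.
Proof. exact: (@ordge_nat r 1). Qed.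

Lemma ordgeX r k (F : ilaurent K r) n : ordge k F -> ordge (k * n%:Z) (F ^+ n).
Proof.
move=> HF; elim: n => [|n IH]; first by rewrite mulr0; apply: ordge1.
rewrite exprS (_ : k * n.+1%:Z = k + k * n%:Z); last by lia.
exact: ordgeM.
Qed.

Lemma ordge_const r k (c : ilaurent K r) : ordge k c -> @ordge r.+1 k (lconst c).
Proof.
move=> Hc; case=> [[|j]|j] /=; rewrite ?mulr0n; try exact: ordge0.
by rewrite mul0r subr0.
Qed.

Lemma ordge_ivar r i : (0 < i <= r)%N -> ordge i%:Z (ivar K r i).
Proof.
elim: r => [|r IH] /=; first by case: i.
case: eqP => [-> _ j|ir i_r]; last by apply/ordge_const/IH; lia.
case: j => [[|[|j]]|j] /=; try exact: ordge0.
by rewrite mul1r subrr; apply: ordge1.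
Qed.

Lemma ivar_neq0 r i : (0 < i <= r)%N -> ivar K r i != 0.
Proof.
elim: r => [|r IH] /=; first by case: i.
case: (i =P r.+1) => [-> _|ir i_r]; first exact: lvar_neq0.
by rewrite fmorph_eq0 IH //; lia.
Qed.

Lemma ordge_ivarV r i : (0 < i <= r)%N -> ordge (- i%:Z) (ivar K r i)^-1.
Proof.
elim: r => [|r IH] /=; first by case: i.
case: eqP => [-> _ j|ir i_r]; last first.
  by rewrite -fmorphV; apply: ordge_const; apply: IH; lia.
have := lcoef_varzM (1 : laurent (ilaurent K r)) (-1) j; rewrite mulr1 => ->.
rewrite (@lcoef1 (ilaurent K r)); case: eqP => [j1|_]; last exact: ordge0.
by apply: ordge_le (ordge1 _); nia.
Qed.

(** In \sum_k u_i ^ (- k - 1) * u_j ^ k the weight grows by j - i > 0 with k, so the first term has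
    the least weight. *)
Lemma ordge_subV r i j : (0 < i < j)%N -> (j <= r)%N ->
  ordge (- i%:Z) (ivar K r i - ivar K r j)^-1.
Proof.
elim: r => [|r IH] ij jr /=; first by lia.
rewrite ifF; last by lia.
case: eqP => [jE|jr1]; last first.
  by rewrite -rmorphB -fmorphV; apply: ordge_const; apply: IH => //; lia.
have i_r : (0 < i <= r)%N by lia.
rewrite lconst_sub_var_inv ?ivar_neq0 //.
case=> [k|k] /=; last exact: ordge0.
rewrite -exprVn; apply: ordge_le (ordgeX k.+1 (ordge_ivarV i_r)).
by nia.
Qed.

Lemma ordge_1subV r i : (0 < i <= r)%N -> ordge 0 (1 - ivar K r i)^-1.
Proof.
elim: r => [|r IH] /=; first by case: i.
case: eqP => [-> _|ir i_r]; last first.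
  rewrite -(rmorph1 (@lconst (ilaurent K r))) -rmorphB -fmorphV.
  by apply: ordge_const; apply: IH; lia.
change (ordge (r := r.+1) 0 (lconst 1 - lvar (ilaurent K r))^-1).
rewrite lconst_sub_var_inv ?oner_eq0 //; case=> [k|k] /=; last exact: ordge0.
by rewrite expr1n invr1; apply: ordge_le (ordge1 _); nia.
Qed.

Lemma CT_zmod_morphism r : zmod_morphism (@CT K r).
Proof. by elim: r => //= r IH F G; rewrite -IH. Qed.

HB.instance Definition _ r :=
  GRing.isZmodMorphism.Build (ilaurent K r) K (@CT K r) (@CT_zmod_morphism r).

Lemma CT_ordge r k (F : ilaurent K r) : 0 < k -> ordge k F -> CT F = 0.
Proof.
elim: r k F => [|r IH] k F k0 /=; first exact.
by move=> /(_ 0); rewrite mul0r subr0; apply: IH.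
Qed.

Lemma CT_monomial r (e : nat -> int) :
  CT (\prod_(i < r) ivar K r i.+1 ^ e i) = [forall i : 'I_r, e i == 0]%:R.
Proof.
elim: r => [|r IH].
  by rewrite big_ord0 /=; case: forallP => // -[] [].
set L : fieldType := laurent (ilaurent K r).
have E : \prod_(i < r.+1) (ivar K r.+1 i.+1 : L) ^ e i =
    lvar (ilaurent K r) ^ e r * lconst (\prod_(i < r) ivar K r i.+1 ^ e i).
  rewrite big_ord_recr [LHS]mulrC /= eqxx; congr (_ * _).
  rewrite rmorph_prod; apply: eq_bigr => i _.
  rewrite rmorphXz; last by rewrite unitfE ivar_neq0 //= ltn_ord.
  by have -> : (i.+1 == r.+1) = false by rewrite eqSS; have := ltn_ord i; lia.
transitivity (CT ((lvar (ilaurent K r) ^ e r * lconst (\prod_(i < r) ivar K r i.+1 ^ e i)) 0)).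
  by rewrite -E.
rewrite lcoef_varzM.
have [er0|er0] := eqVneq (e r) 0.
  rewrite er0 subr0 /= mulr1n IH; congr (_%:R); congr nat_of_bool.
  apply/forallP/forallP => [ei i|ei i]; last exact: (ei (widen_ord (leqnSn r) i)).
  have [ir|] := ltnP i r; first exact: (ei (Ordinal ir)).
  by have := ltn_ord i; rewrite ltnS => ir ri; rewrite (_ : (i : nat) = r) ?er0 //; lia.
rewrite [X in CT X](_ : _ = 0) ?raddf0; last first.
  by rewrite sub0r; case: (e r) er0 => [[|k]|k].
by case: forallP => // /(_ ord_max) /=; rewrite (negPf er0).
Qed.

End Order.

(** * Truncated expansions and their constant terms *)

Section Approximation.
Variables (K : fieldType) (r : nat).
Implicit Types (X Y S T x : ilaurent K r) (o N : int).
Local Notation ordge := (@ordge K r).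

(** The precision [N] is relative to the order [o]: in a product the orders add while [N] is kept,
    so all factors can be truncated at the same length. *)
Definition approx N o X S := ordge o X /\ ordge (o + N) (X - S).

Lemma approx_refl N o X : ordge o X -> approx N o X X.
Proof. by move=> oX; split; rewrite // subrr; apply: ordge0. Qed.

Lemma approxM N o1 o2 X S Y T : 0 <= N ->
  approx N o1 X S -> approx N o2 Y T -> approx N (o1 + o2) (X * Y) (S * T).
Proof.
move=> N0 [oX oXS] [oY oYT]; split; first exact: ordgeM.
have -> : X * Y - S * T = (X - S) * Y + X * (Y - T) - (X - S) * (Y - T).
  by rewrite !mulrBl !mulrBr; ring.
have -> : o1 + o2 + N = o1 + N + o2 by ring.
apply: ordgeB; last first.
  by apply: ordge_le (ordgeM oXS oYT); lia.
apply: ordgeD; first exact: ordgeM.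
rewrite (_ : o1 + N + o2 = o1 + (o2 + N)); last by ring.
  exact: ordgeM.
Qed.

Lemma approx_prod N (I : Type) (s : seq I) (o : I -> int) (X S : I -> ilaurent K r) :
  0 <= N -> (forall i, approx N (o i) (X i) (S i)) ->
  approx N (\sum_(i <- s) o i) (\prod_(i <- s) X i) (\prod_(i <- s) S i).
Proof.
move=> N0 XS; elim: s => [|i s IH]; last by rewrite !big_cons; apply: approxM.
by rewrite !big_nil; apply: approx_refl; apply: ordge1.
Qed.

Lemma CT_approx N o X S : approx N o X S -> 0 < o + N -> CT X = CT S.
Proof.
by move=> [_ oXS] N0; have /eqP := CT_ordge N0 oXS; rewrite raddfB subr_eq0 => /eqP.
Qed.

Lemma one_sub_neq0 x : ordge 1 x -> 1 - x != 0.
Proof.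
move=> ox; apply/eqP => /(congr1 (@CT K r)).
rewrite raddfB /= (CT_ordge ltr01 ox) subr0 raddf0.
have := CT_monomial K r (fun=> 0); rewrite big1 => [->|//].
case: forallP => [_ /eqP|nall _]; first by rewrite oner_eq0.
by apply: nall => i; rewrite eqxx.
Qed.

(** Multiplication by 1 - x lowers the order of the pole, up to a boundary term in x ^ n; this
    drives the induction in [approx_geom]. *)
Lemma geom_binomial_sum (p n : nat) x :
  (1 - x) * \sum_(k < n) 'C(k + p.+1, p.+1)%:R * x ^+ k =
  \sum_(k < n) 'C(k + p, p)%:R * x ^+ k - 'C(n + p, p.+1)%:R * x ^+ n.
Proof.
elim: n => [|n IH].
  by rewrite !big_ord0 mulr0 bin_small ?mul0r ?subr0 // add0n.
rewrite !big_ord_recr /= mulrDr IH addSn addnS !binS !natrD exprS; ring.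
Qed.

Lemma approx_geom (p n : nat) x : ordge 1 x -> ordge 0 (1 - x)^-1 ->
  approx n%:Z 0 ((1 - x) ^- p.+1) (\sum_(k < n) 'C(k + p, p)%:R * x ^+ k).
Proof.
move=> ox ox1; have x1 := one_sub_neq0 ox.
have oxn c : ordge n (c%:R * x ^+ n).
  have -> : n%:Z = 0 + 1 * n%:Z by lia.
  by apply: ordgeM; [apply: ordge_nat|apply: ordgeX].
elim: p => [|p [IH1 IH2]]; split.
- by rewrite expr1.
- rewrite add0r; set s := \sum_(_ < _) _.
  have -> : (1 - x) ^- 1 - s = (1%:R * x ^+ n) * (1 - x)^-1; last first.
    rewrite (_ : n%:Z = n%:Z + 0); last by lia.
  exact: ordgeM.
  have sE : s = \sum_(k < n) x ^+ k.
    by apply: eq_bigr => k _; rewrite addn0 bin0 mul1r.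
  have e : (1 - x) * s = 1 - x ^+ n by rewrite sE -opprB mulNr -subrX1 opprB.
  by apply: (mulfI x1); rewrite mulrBr e expr1 mulrCA divff // mulr1 mul1r subKr.
- by rewrite exprSr invfM -(addr0 0); apply: ordgeM.
- rewrite add0r in IH2 *; set s := \sum_(_ < _) _.
  have -> : (1 - x) ^- p.+2 - s = (1 - x)^-1 *
     (((1 - x) ^- p.+1 - \sum_(k < n) 'C(k + p, p)%:R * x ^+ k)
       + 'C(n + p, p.+1)%:R * x ^+ n).
    apply: (mulfI x1); rewrite mulrBr geom_binomial_sum mulrA divff // mul1r.
    rewrite exprSr invfM mulrCA divff // mulr1; ring.
  have -> : n%:Z = 0 + n%:Z by lia.
  by apply: ordgeM => //; apply: ordgeD.
Qed.

End Approximation.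

(** * The integrand as a sum over flows *)

Section IntegrandExpansion.
(* [n] is kept abstract, so that unification never unfolds [ilaurent rat n.-1]. *)
Variables (n m : nat) (nE : n = m.+2).
Local Notation F := (ilaurent rat n.-1).

(** This is x_(i + 2) of the statement: the indices i < m are the vertices of the flows, and [uv m],
    abbreviated [z], is x_n. *)
Definition uv (i : nat) : F := ivar rat n.-1 i.+1.
Local Notation z := (uv m).

Lemma big_range0S (R : Type) (idx : R) (op : Monoid.law idx) (G : nat -> R) :
  \big[op/idx]_(i < n.-1) G i = op (\big[op/idx]_(i < m) G i) (G m).
Proof. by rewrite -(big_mkord xpredT) nE big_nat_recr // big_mkord. Qed.

Lemma forall_range0S (P : pred nat) :
  [forall i : 'I_n.-1, P i] = [forall i : 'I_m, P i] && P m.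
Proof.
have le_m (i : nat) : (i <= m)%N -> (i < n.-1)%N by rewrite nE.
apply/forallP/andP => [Pn|[/forallP Pm Pmm] i].
  split; last exact: (Pn (Ordinal (le_m m (leqnn m)))).
  by apply/forallP => i; apply: (Pn (Ordinal (le_m i (ltnW (ltn_ord i))))).
have ge_m (k : nat) : (k < n.-1)%N -> (k <= m)%N by rewrite nE.
by have := ge_m _ (ltn_ord i); rewrite leq_eqVlt => /predU1P[->//|im]; apply: (Pm (Ordinal im)).
Qed.

Lemma big_range2 (R : Type) (idx : R) (op : Monoid.law idx) (G : nat -> R) :
  \big[op/idx]_(2 <= i < n) G i = \big[op/idx]_(i < m) G i.+2.
Proof. by rewrite nE !big_add1 /= big_mkord. Qed.

Lemma big_range2S (R : Type) (idx : R) (op : Monoid.law idx) (G : nat -> R) :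
  \big[op/idx]_(2 <= i < n.+1) G i = op (\big[op/idx]_(i < m) G i.+2) (G m.+2).
Proof. by rewrite nE !big_add1 /= big_mkord big_ord_recr. Qed.

Lemma big_range_above (R : Type) (idx : R) (op : Monoid.law idx) (G : nat -> R) (i : 'I_m) :
  \big[op/idx]_(i.+3 <= j < n.+1) G j = op (\big[op/idx]_(j < m | (i < j)%N) G j.+2) (G m.+2).
Proof.
rewrite nE 2!big_add1 /= big_nat_recr //=; congr (op _ _).
by rewrite (big_nat_widenl _ 0%N) // big_mkord.
Qed.

(** The pairs containing x_n are set apart: the product of the x_i - x_n in the numerator reduces
    their squares to first powers, and 1 - x_n cancels once. *)
Lemma integrandE t : h_integrand n t =
  z ^- t * ((1 - z) ^- 2 *
   (\prod_(i < m) (uv i ^+ n.-1 * ((1 - uv i) ^- 3 * (uv i - z)^-1))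
    * \prod_(p : pairs m) (uv (src p) - uv (tgt p)) ^- 2)).
Proof.
rewrite /h_integrand.
have mul_exp3 (a : F) : a * a ^- 3 = a ^- 2.
  have [->|a0] := eqVneq a 0; first by rewrite mul0r expr0n invr0.
  by rewrite [a ^+ 3]exprS invfM mulrA divff // mul1r.
have mul_exp2 (a : F) : a * a ^- 2 = a^-1.
  have [->|a0] := eqVneq a 0; first by rewrite mul0r invr0.
  by rewrite [a ^+ 2]exprS invfM mulrA divff // mul1r expr1.
rewrite !big_range2 !big_range2S /= -/(uv _) big_geq ?mulr1; last by rewrite nE.
have -> : \prod_(i < m) \prod_(i.+3 <= j < n.+1) (uv i - ivar rat n.-1 j.-1) ^+ 2 =
    \prod_(p : pairs m) (uv (src p) - uv (tgt p)) ^+ 2 * \prod_(i < m) (uv i - z) ^+ 2.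
  rewrite (big_pairs _ (fun i j : 'I_m => (uv i - uv j) ^+ 2)) -big_split.
  by apply: eq_bigr => i _; rewrite big_range_above.
have -> : ivar rat n.-1 n.-1 = z by rewrite /uv; congr ivar; rewrite nE.
rewrite -/(uv _) !prodrXl.
set a := 1 - z; set u := \prod_(i < m) uv i; set b := \prod_(i < m) (uv i - z).
set c := \prod_(i < m) (1 - uv i); set q := \prod_p _.
have -> : \prod_(p : pairs m) (uv (src p) - uv (tgt p)) ^- 2 = q ^- 2.
  by rewrite prodfV prodrXl.
have -> : \prod_(i < m) (uv i ^+ n.-1 * ((1 - uv i) ^- 3 / (uv i - z))) =
    u ^+ n.-1 * (c ^- 3 * b^-1).
  by rewrite !big_split /= !prodfV !prodrXl.
rewrite -(mul_exp3 a) -(mul_exp2 b) !invfM.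
by move: (a ^- 3) (b ^- 2) (c ^- 3) (q ^- 2) (z ^- t) => a' b' c' q' z'; ring.
Qed.

Let uvP i : (i <= m)%N -> (0 < i.+1 <= n.-1)%N.
Proof. by rewrite nE. Qed.

Lemma uv_neq0 i : (i <= m)%N -> uv i != 0.
Proof. by move=> im; apply/ivar_neq0/uvP. Qed.

Lemma ordge_uv i : (i <= m)%N -> ordge i.+1%:Z (uv i).
Proof. by move=> im; apply/ordge_ivar/uvP. Qed.

Lemma approx_sub (p : nat) N i j : (i < j <= m)%N ->
  approx N%:Z (- i.+1%:Z * p.+1%:Z) ((uv i - uv j) ^- p.+1)
   (\sum_(k < N) 'C(k + p, p)%:R * (uv i ^ (- k%:Z - p.+1%:Z) * uv j ^+ k)).
Proof.
move=> /andP[ij jm]; have im : (i <= m)%N by lia.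
pose x := uv j / uv i.
have ox : ordge 1 x.
  apply: (@ordge_le _ _ (j.+1%:Z + - i.+1%:Z)); first by lia.
  by apply: ordgeM; [apply: ordge_uv|apply/ordge_ivarV/uvP].
have e1 : uv i - uv j = uv i * (1 - x).
  by rewrite mulrBr mulr1 mulrCA divff ?mulr1 // uv_neq0.
have ox1 : ordge 0 (1 - x)^-1.
  have -> : (1 - x)^-1 = uv i * (uv i - uv j)^-1.
    by rewrite e1 invfM mulrA divff ?mul1r // uv_neq0.
  have -> : 0 = i.+1%:Z + - i.+1%:Z by lia.
  apply: ordgeM; first exact: ordge_uv.
  by apply: ordge_subV; rewrite ?nE //; lia.
have -> : (uv i - uv j) ^- p.+1 = (uv i)^-1 ^+ p.+1 * (1 - x) ^- p.+1.
  by rewrite e1 exprMn invfM exprVn.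
have -> : \sum_(k < N) 'C(k + p, p)%:R * (uv i ^ (- k%:Z - p.+1%:Z) * uv j ^+ k) =
    (uv i)^-1 ^+ p.+1 * \sum_(k < N) 'C(k + p, p)%:R * x ^+ k.
  rewrite mulr_sumr; apply: eq_bigr => k _; rewrite [RHS]mulrCA; congr (_ * _).
  rewrite expfzDr ?uv_neq0 // -!exprz_inv -!exprnP exprMn mulrAC mulrC.
  by congr (_ * _); apply: mulrC.
rewrite -[X in approx _ X](addr0 (- i.+1%:Z * p.+1%:Z)); apply: approxM => //.
  by apply/approx_refl/ordgeX/ordge_ivarV/uvP.
exact: approx_geom.
Qed.

(** Coefficients of 1 / (1 - u) ^ 3, cut off at degree [K]. *)
Definition trc (K : nat) (d : int) : nat :=
  if d is Posz l then if (l <= K)%N then 'C(l.+2, 2) else 0%N else 0%N.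

(** Coefficient of u ^ d in u ^ (m + 1) / ((1 - u) ^ 3 * (u - 'X)), with both expansions truncated;
    'X stands for x_n. *)
Definition shifted_series (K : nat) (d : int) : {poly rat} :=
  \sum_(k < K.+1) (trc K (d + k%:Z - m%:Z))%:R *: 'X^k.

Lemma shifted_seriesE K d : shifted_series K d =
  \sum_(kl : 'I_K.+1 * 'I_K.+1 | m%:Z + (kl.2 : nat)%:Z - (kl.1 : nat)%:Z == d)
     'C(kl.2 + 2, 2)%:R *: 'X^(kl.1).
Proof.
rewrite -(pair_big_dep xpredT (fun k l : 'I_K.+1 => m%:Z + l%:Z - k%:Z == d)
  (fun k l : 'I_K.+1 => 'C(l + 2, 2)%:R *: 'X^k)).
apply: eq_bigr => k _ /=; rewrite -scaler_suml; congr (_ *: _).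
rewrite /trc; case dE: (d + k%:Z - m%:Z) => [l|l].
  have [lK|lK] := leqP l K.
    rewrite (big_pred1 (Ordinal (lK : (l < K.+1)%N))) ?addn2 // => l'.
    by apply/eqP/eqP => [h|->]; [apply: val_inj => /=; lia|rewrite /=; lia].
  by rewrite big1 // => l' /eqP; have := ltn_ord l'; lia.
by rewrite big1 // => l' /eqP; lia.
Qed.

Lemma CT_natM c (X : F) : CT (c%:R * X) = c%:R * CT X.
Proof. by rewrite !mulr_natl raddfMn. Qed.

Lemma CT_uv_monomial (e : 'I_m -> int) (e' : int) :
  CT (\prod_(i < m) uv i ^ e i * z ^ e') = ([forall i, e i == 0] && (e' == 0))%:R.
Proof.
pose e1 (i : nat) := if insub i is Some i' then e i' else e'.
have := @CT_monomial rat n.-1 e1.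
have -> : \prod_(i < n.-1) ivar rat n.-1 i.+1 ^ e1 i = \prod_(i < m) uv i ^ e i * z ^ e'.
  rewrite (big_range0S _ (fun i => uv i ^ e1 i)) /e1 insubF ?ltnn //.
  by congr (_ * _); apply: eq_bigr => i _; rewrite valK.
move=> ->; rewrite (forall_range0S (fun i => e1 i == 0)) /e1 insubF ?ltnn //.
by congr ((_ && _)%:R); apply: eq_forallb => i; rewrite valK.
Qed.

Lemma exprz_sum (x : F) (I : Type) (s : seq I) (P : pred I) (e : I -> int) :
  x != 0 -> x ^ (\sum_(i <- s | P i) e i) = \prod_(i <- s | P i) x ^ e i.
Proof. by move=> x0; apply: (big_morph (fun e => x ^ e)) => // a b; rewrite expfzDr. Qed.

Lemma prod_pair_monomial K (g : {ffun pairs m -> 'I_K.+1}) :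
  \prod_p (uv (src p) ^ (- (g p)%:Z - 2) * uv (tgt p) ^+ g p) =
  \prod_(i < m) uv i ^ (- net (bx g) i).
Proof.
have part (s : pairs m -> 'I_m) (e : pairs m -> int) :
    \prod_p uv (s p) ^ e p = \prod_(i < m) uv i ^ (\sum_(p | s p == i) e p).
  rewrite (partition_big s xpredT) //=; apply: eq_bigr => i _.
  rewrite exprz_sum ?uv_neq0 1?ltnW //.
  by apply: eq_bigr => p /eqP <-.
rewrite big_split /= (part (@src m) (fun p => - (g p)%:Z - 2)).
rewrite (eq_bigr (fun p => uv (tgt p) ^ (g p)%:Z)) // (part (@tgt m)) -big_split.
apply: eq_bigr => i _ /=; rewrite -expfzDr ?uv_neq0 1?ltnW //; congr (_ ^ _).
rewrite netE opprB addrC; congr (_ + _); rewrite -sumrN.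
by apply: eq_bigr => p _; rewrite [RHS]opprD.
Qed.

(** The guard [j <= t] is essential: [t - j] truncates to 0, whereas a negative power of x_n must
    have coefficient 0. *)
Definition coef_pos (P : {poly rat}) (t j : nat) : rat := if (j <= t)%N then P`_(t - j) else 0.

Lemma coef_posD (P Q : {poly rat}) t j :
  coef_pos (P + Q) t j = coef_pos P t j + coef_pos Q t j.
Proof. by rewrite /coef_pos; case: ifP; rewrite ?coefD ?addr0. Qed.

Lemma coef_pos_sum (I : Type) (s : seq I) (P : I -> {poly rat}) t j :
  coef_pos (\sum_(i <- s) P i) t j = \sum_(i <- s) coef_pos (P i) t j.
Proof.
apply: (big_morph (fun P => coef_pos P t j)) => [p q|]; first exact: coef_posD.
by rewrite /coef_pos coef0 if_same.
Qed.

Lemma coef_posZ c (P : {poly rat}) t j : coef_pos (c *: P) t j = c * coef_pos P t j.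
Proof. by rewrite /coef_pos coefZ; case: ifP; rewrite ?mulr0. Qed.

Lemma coef_posXn k t j : coef_pos 'X^k t j = (j + k == t)%N%:R.
Proof.
rewrite /coef_pos coefXn; case: leqP => jt; last by rewrite gtn_eqF // ltn_addr.
by congr (_%:R); congr nat_of_bool; lia.
Qed.

Section Truncation.
Variable K : nat.
Local Notation box := {ffun pairs m -> 'I_K.+1}.
Local Notation kls := {ffun 'I_m -> 'I_K.+1 * 'I_K.+1}.

Let binl (kl : kls) : nat := \prod_i 'C((kl i).2 + 2, 2).
Let sumk (kl : kls) : nat := \sum_i ((kl i).1 : nat).
Let expo (kl : kls) (g : box) (i : 'I_m) : int :=
  m%:Z + ((kl i).2 : nat)%:Z - ((kl i).1 : nat)%:Z - net (bx g) i.

Lemma coef_pos_Lam t j :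
  coef_pos (Lam m K (shifted_series K) : {poly rat}) t j =
  \sum_(g : box) \sum_(kl : kls)
     (binl kl * wt (bx g))%:R *
     ([forall i, expo kl g i == 0] && (j + sumk kl == t)%N)%:R.
Proof.
rewrite /Lam coef_pos_sum; apply: eq_bigr => g _.
under eq_bigr => i _ do rewrite shifted_seriesE big_mkcond.
rewrite bigA_distr_bigA -[X in coef_pos X]/(_ * _) mulr_natl -scaler_nat coef_posZ.
rewrite coef_pos_sum mulr_sumr; apply: eq_bigr => kl _.
rewrite natrM -mulrA [_ * (_ * _)]mulrCA; congr (_ * _).
have [/forallP e0|ne0] := boolP [forall i, expo kl g i == 0].
  rewrite (eq_bigr (fun i => 'C((kl i).2 + 2, 2)%:R *: 'X^((kl i).1))); last first.
    by move=> i _; rewrite ifT // -subr_eq0 e0.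
  rewrite scaler_prod coef_posZ -expr_sum coef_posXn /binl natr_prod.
  by rewrite -/(sumk kl).
rewrite mulr0; have /forallPn [i nei] := ne0.
rewrite (bigD1 i) //= ifF; first by rewrite mul0r /coef_pos coef0 if_same.
by rewrite -subr_eq0 (negPf nei).
Qed.

Definition truncated_integrand t : F :=
  z ^- t * ((\sum_(j < K.+1) 'C(j + 1, 1)%:R * z ^+ j) *
   (\prod_(i < m) (uv i ^+ n.-1 *
       ((\sum_(l < K.+1) 'C(l + 2, 2)%:R * uv i ^+ l) *
        (\sum_(k < K.+1) 'C(k + 0, 0)%:R * (uv i ^ (- k%:Z - 1) * z ^+ k))))
    * \prod_(p : pairs m) \sum_(k < K.+1) 'C(k + 1, 1)%:R *
        (uv (src p) ^ (- k%:Z - 2) * uv (tgt p) ^+ k))).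

Lemma truncated_integrandE t : truncated_integrand t =
  \sum_(j < K.+1) \sum_(kl : kls) \sum_(g : box) (j.+1 * (binl kl * wt (bx g)))%:R *
    (\prod_(i < m) uv i ^ (expo kl g i) * z ^ (j%:Z + (sumk kl)%:Z - t%:Z)).
Proof.
have uvi (i : 'I_m) : uv i != 0 by rewrite uv_neq0 // ltnW.
have z0 : z != 0 by rewrite uv_neq0.
rewrite /truncated_integrand.
have -> : \prod_(i < m) (uv i ^+ n.-1 *
       ((\sum_(l < K.+1) 'C(l + 2, 2)%:R * uv i ^+ l) *
        (\sum_(k < K.+1) 'C(k + 0, 0)%:R * (uv i ^ (- k%:Z - 1) * z ^+ k)))) =
   \sum_(kl : kls) (binl kl)%:R * (\prod_(i < m)
      uv i ^ (m%:Z + ((kl i).2 : nat)%:Z - ((kl i).1 : nat)%:Z) * z ^ (sumk kl)%:Z).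
  transitivity (\prod_(i < m) \sum_(kl : 'I_K.+1 * 'I_K.+1) 'C(kl.2 + 2, 2)%:R *
      (uv i ^ (m%:Z + (kl.2 : nat)%:Z - (kl.1 : nat)%:Z) * z ^+ kl.1)).
    apply: eq_bigr => i _; rewrite -(pair_bigA _ (fun k l : 'I_K.+1 =>
      'C(l + 2, 2)%:R * (uv i ^ (m%:Z + l%:Z - k%:Z) * z ^+ k))) /=.
    rewrite mulr_sumr mulr_sumr; apply: eq_bigr => k _.
    rewrite mulr_suml mulr_sumr; apply: eq_bigr => l _; rewrite addn0 bin0 mul1r.
    have -> : m%:Z + l%:Z - k%:Z = n.-1%:Z + (l%:Z + (- k%:Z - 1)) by rewrite nE; lia.
    rewrite !(expfzDr _ _ (uvi i)) -!exprnP.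
    move: 'C(_, _)%:R (uv i ^ _) => a b; ring.
  rewrite bigA_distr_bigA; apply: eq_bigr => kl _.
  rewrite big_split /= natr_prod; congr (_ * _).
  by rewrite big_split /= -expr_sum.
have -> : \prod_(p : pairs m) \sum_(k < K.+1) 'C(k + 1, 1)%:R *
        (uv (src p) ^ (- k%:Z - 2) * uv (tgt p) ^+ k) =
   \sum_(g : box) (wt (bx g))%:R * \prod_(i < m) uv i ^ (- net (bx g) i).
  rewrite bigA_distr_bigA; apply: eq_bigr => g _.
  rewrite big_split /= prod_pair_monomial; congr (_ * _).
  by rewrite /wt natr_prod; apply: eq_bigr => p _; rewrite bin1 addn1.
rewrite mulr_suml mulr_sumr; apply: eq_bigr => j _.
rewrite mulr_suml !mulr_sumr; apply: eq_bigr => kl _.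
rewrite !mulr_sumr; apply: eq_bigr => g _.
rewrite bin1 addn1 !natrM /expo.
under [in RHS]eq_bigr => i _ do rewrite expfzDr //.
rewrite big_split /= [in RHS]expfzDr // [z ^ (_ + _)]expfzDr //.
rewrite -exprnN -!exprnP; ring.
Qed.

Lemma CT_truncated_integrand t : CT (truncated_integrand t) =
  \sum_(j < K.+1) (j.+1)%:R * coef_pos (Lam m K (shifted_series K) : {poly rat}) t j.
Proof.
rewrite truncated_integrandE raddf_sum; apply: eq_bigr => j _.
rewrite coef_pos_Lam exchange_big mulr_sumr raddf_sum; apply: eq_bigr => kl _.
rewrite mulr_sumr raddf_sum; apply: eq_bigr => g _ /=.
rewrite CT_natM CT_uv_monomial natrM -mulrA; congr (_ * (_ * (_ && _)%:R)).
by rewrite subr_eq0 -PoszD eqz_nat.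
Qed.

End Truncation.

Lemma h_expansion : exists o : nat -> nat, forall t K, (o t <= K)%N ->
  h n t = \sum_(j < K.+1) (j.+1)%:R * coef_pos (Lam m K (shifted_series K) : {poly rat}) t j.
Proof.
(* Orders of the factors at a vertex and at a pair; [o t] is the order of the integrand. Relative
   precision [K.+1] reaches the constant term once [K] is at least the absolute value of [o t]. *)
pose oi (i : 'I_m) : int := i.+1%:Z * n.-1%:Z + (0 + - i.+1%:Z * 1%:Z).
pose op (p : pairs m) : int := - (src p).+1%:Z * 2%:Z.
pose o t : int := - m.+1%:Z * t%:Z + (0 + (\sum_i oi i + \sum_p op p)).
exists (fun t => `|o t|%N) => t K oK; rewrite -CT_truncated_integrand /h.
have ge0N : (0 : int) <= K.+1%:Z by [].
have oz : ordge m.+1%:Z z by apply: ordge_uv.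
have im (i : 'I_m) : (i < m <= m)%N by rewrite ltn_ord leqnn.
have ou1 i : (i <= m)%N -> ordge 1 (uv i).
  by move=> /ordge_uv; apply: ordge_le; lia.
have ou2 i : (i <= m)%N -> ordge 0 (1 - uv i)^-1.
  by move=> /uvP; apply: ordge_1subV.
apply: (@CT_approx _ _ K.+1%:Z (o t)); last by lia.
rewrite integrandE; apply: approxM => //.
  apply: approx_refl; rewrite -exprVn; apply: ordgeX.
  by apply: ordge_ivarV; apply: uvP.
apply: approxM => //.
  exact: (approx_geom 1 K.+1 (ou1 _ (leqnn m)) (ou2 _ (leqnn m))).
apply: approxM => //; last first.
  apply: approx_prod => // p; apply: (approx_sub 1).
  by rewrite src_lt_tgt ltnW.
apply: approx_prod => // i; apply: approxM => //.
  by apply: approx_refl; apply: ordgeX; apply: ordge_uv; rewrite ltnW.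
apply: approxM => //; last first.
  by rewrite -[X in approx _ _ X]expr1; apply: (approx_sub 0); apply: im.
exact: (approx_geom 2 K.+1 (ou1 _ (ltnW (ltn_ord i))) (ou2 _ (ltnW (ltn_ord i)))).
Qed.

End IntegrandExpansion.

(** * Flow sums under change of truncation and of coefficients *)

Section LamTheory.
Variable m : nat.

Lemma big_ffun_widen (R : Type) (idx : R) (op : Monoid.com_law idx) (I : finType)
    (K0 K : nat) (F : (I -> nat) -> R) : (K0 <= K)%N ->
  (forall (g : {ffun I -> 'I_K.+1}) i, (K0 < g i)%N -> F (fun i => g i : nat) = idx) ->
  \big[op/idx]_(g : {ffun I -> 'I_K.+1}) F (fun i => g i : nat) =
  \big[op/idx]_(g : {ffun I -> 'I_K0.+1}) F (fun i => g i : nat).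
Proof.
move=> leK F0; rewrite (bigID (fun g : {ffun I -> 'I_K.+1} => [forall i, (g i <= K0)%N])) /=.
rewrite [X in op _ X]big1 ?Monoid.mulm1; last first.
  move=> g ng; have [i gi] : exists i, ~~ (g i <= K0)%N by apply/existsP; rewrite -negb_forall.
  by apply: (F0 g i); rewrite ltnNge.
rewrite (reindex_onto (fun g : {ffun I -> 'I_K0.+1} => [ffun i => widen_ord (leK : (K0.+1 <= K.+1)%N) (g i)])
  (fun g : {ffun I -> 'I_K.+1} => [ffun i => inord (g i) : 'I_K0.+1])) /=; last first.
  move=> g /forallP gK; apply/ffunP => i; rewrite !ffunE; apply: val_inj.
  by rewrite /= inordK // ltnS.
apply: eq_big => g; last by move=> _; congr F; apply/funext => i; rewrite ffunE.
apply/andP; split; first by apply/forallP => i; rewrite ffunE /= -ltnS.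
by apply/eqP/ffunP => i; rewrite !ffunE; apply: val_inj; rewrite /= inordK.
Qed.

(** One more than the bound in [net_bound], so that reaching it on some pair contradicts [net] >= -
    T at all vertices. *)
Definition Kmin (T : nat) : nat := (m * m * (2 * m + T)).+1.

Lemma net_out_of_box (T K : nat) (f : pairs m -> nat) p :
  (Kmin T <= K)%N -> (K <= f p)%N -> exists i, net f i < - T%:Z.
Proof.
move=> TK Kf; apply: contrapT => nex.
have le_i i : - T%:Z <= net f i.
  by rewrite leNgt; apply/negP => lti; apply: nex; exists i.
by have := net_bound le_i p; rewrite leqNgt (leq_trans _ Kf).
Qed.

Lemma net_sign (f : pairs m -> nat) : (exists i, net f i < 0) \/ (forall i, 0 <= net f i).
Proof.
have [neg|nneg] := pselect (exists i, net f i < 0); [by left|right=> i].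
by rewrite leNgt; apply/negP => i0; apply: nneg; exists i.
Qed.

Lemma Lam_widen (R : comNzRingType) (phi : int -> R) (K0 K : nat) :
  (forall d : int, d < 0 -> phi d = 0) -> (Kmin 0 <= K0 <= K)%N ->
  Lam m K phi = Lam m K0 phi.
Proof.
move=> phi0 /andP[K0min leK].
rewrite /Lam (@big_ffun_widen _ _ _ _ K0 K
  (fun f => (wt f)%:R * \prod_i phi (net f i))) // => g p K0g.
have [i neti] := net_out_of_box (f := bx g) K0min (ltnW K0g).
by rewrite (bigD1 i) //= (phi0 (net _ i)) ?mul0r ?mulr0 // -oppr0.
Qed.

Lemma eq_Lam (R : pzSemiRingType) (phi psi : int -> R) K :
  (forall g : {ffun pairs m -> 'I_K.+1}, \prod_i phi (net (bx g) i) = \prod_i psi (net (bx g) i)) ->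
  Lam m K phi = Lam m K psi.
Proof. by move=> e; apply: eq_bigr => g _; rewrite e. Qed.

Lemma Lam_rmorph (R S : pzSemiRingType) (f : {rmorphism R -> S}) (phi : int -> R) K :
  f (Lam m K phi) = Lam m K (f \o phi).
Proof.
rewrite rmorph_sum; apply: eq_bigr => g _.
by rewrite rmorphM rmorph_nat rmorph_prod.
Qed.

Lemma net_le (f : pairs m -> nat) i : (forall j, 0 <= net f j) ->
  net f i <= (m * m.-1)%N%:Z.
Proof.
by move=> f0; rewrite -(total_net f) (bigD1 i) //= lerDl sumr_ge0.
Qed.

(** Leibniz rule. When [D (phi d)] is a suitable multiple of [phi (d + 1)] or [phi (d - 1)], the
    right-hand side is a Ward identity and the derivative vanishes. *)
Lemma Lam_derivation (R : comNzRingType) (D : R -> R) (phi : int -> R) K :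
  zmod_morphism D -> (forall a b, D (a * b) = D a * b + a * D b) ->
  D (Lam m K phi) = \sum_(g : {ffun pairs m -> 'I_K.+1})
    (wt (bx g))%:R * \sum_i D (phi (net (bx g) i)) * \prod_(j | j != i) phi (net (bx g) j).
Proof.
move=> DB DM.
have D0 : D 0 = 0 by have := DB 0 0; rewrite !subrr.
have DN a : D (- a) = - D a by rewrite -sub0r DB D0 sub0r.
have DD a b : D (a + b) = D a + D b by rewrite -{1}[b]opprK DB DN opprK.
have D1 : D 1 = 0.
  by have /eqP := DM 1 1; rewrite !mulr1 mul1r -subr_eq subrr eq_sym => /eqP.
have Dn (k : nat) : D k%:R = 0.
  by elim: k => // k IH; rewrite -natr1 DD IH D1 addr0.
rewrite (big_morph D DD D0); apply: eq_bigr => g _.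
rewrite DM Dn mul0r add0r; congr (_ * _).
have Dprod (s : seq 'I_m) (F : 'I_m -> R) : uniq s ->
    D (\prod_(i <- s) F i) = \sum_(i <- s) D (F i) * \prod_(j <- s | j != i) F j.
  elim: s => [|i s IH] /=; first by rewrite !big_nil.
  move=> /andP[nis us]; rewrite !big_cons DM IH // eqxx /=; congr (_ + _).
    congr (_ * _); rewrite [RHS]big_seq_cond [LHS]big_seq; apply: eq_bigl => j.
    by case js: (j \in s) => //=; apply/esym/eqP => ji; rewrite -ji js in nis.
  rewrite mulr_sumr [LHS]big_seq [RHS]big_seq; apply: eq_bigr => j js.
  rewrite big_cons ifT; first by rewrite mulrCA.
  by apply/eqP => ji; rewrite ji js in nis.
by rewrite Dprod ?index_enum_uniq.
Qed.

End LamTheory.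

(** * Change of variables *)

Lemma coef_map_coefp0 (R : nzRingType) (p : {poly {poly R}}) k :
  (map_poly (coefp 0) p)`_k = (p`_k)`_0.
Proof. by rewrite coef_map_id0 /= ?coef0. Qed.

Lemma map_derivM (R : comNzRingType) (p q : {poly {poly R}}) :
  map_poly (@deriv R) (p * q) = map_poly (@deriv R) p * q + p * map_poly (@deriv R) q.
Proof.
apply/polyP => k; rewrite coef_map_id0 ?deriv0 // coefD !coefM raddf_sum -big_split.
by apply: eq_bigr => i _; rewrite /= derivM !coef_map_id0 ?deriv0.
Qed.

(** * Invariance under translation *)

Section Translation.
Variables (m T K B : nat) (xi : nat -> rat).
Hypothesis xi0 : forall d, (B < d)%N -> xi d = 0.
Hypothesis K_large : (Kmin m T.+1 <= K)%N.

(* Taylor expansion of [\sum_d xi d * u ^ d] at [u + x]: the coefficient of [u ^ d]. *)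
Definition taylor (e : int) : {poly rat} :=
  if e is Posz d then \poly_(b < B.+1) ('C(d + b, b)%:R * xi (d + b)) else 0.

Lemma coef_taylor (d b : nat) : (taylor d)`_b = 'C(d + b, b)%:R * xi (d + b).
Proof.
rewrite coef_poly; case: ltnP => // Bb.
by rewrite xi0 ?mulr0 // (leq_trans Bb) // leq_addl.
Qed.

Lemma deriv_taylor e : (taylor e)^`() = (e + 1)%:~R * taylor (e + 1).
Proof.
case: e => [d|[|d]]; last 2 first.
- by rewrite /= deriv0 mul0r.
- by rewrite (_ : Negz d.+1 + 1 = Negz d) /= ?deriv0 ?mulr0 //; lia.
rewrite -PoszD addn1 -pmulrn; apply/polyP => b.
rewrite coef_deriv mulr_natl coefMn !coef_taylor addSnnS -!mulrnAl -!mulrnA.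
by congr (_%:R * _); rewrite mulnC mul_bin_left mulnC; congr (_ * _)%N; lia.
Qed.

(** Coefficient of u ^ e in P(u + x) * u / (u - w), where P has the coefficients [xi], x is the
    inner variable and w the outer one, truncated at degree [T]. By translation of u, its [Lam]
    depends on x + w only, up to truncation; it specialises to [taylor] at w = 0 and to
    [geometric_shift] at x = 0. *)
Definition bitaylor (e : int) : {poly {poly rat}} := \poly_(k < T.+1) taylor (e + k%:Z).

Definition mixed_deriv (p : {poly {poly rat}}) : {poly {poly rat}} :=
  p^`() - map_poly (@deriv rat) p.

Lemma coef_mixed_deriv p k :
  (mixed_deriv p)`_k = p`_k.+1 *+ k.+1 - (p`_k)^`().
Proof. by rewrite coefB coef_deriv coef_map_id0 ?deriv0. Qed.

Lemma mixed_derivM p q :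
  mixed_deriv (p * q) = mixed_deriv p * q + p * mixed_deriv q.
Proof.
rewrite /mixed_deriv derivM map_derivM; ring.
Qed.

Lemma mixed_derivB : zmod_morphism mixed_deriv.
Proof.
by move=> p q; apply/polyP => k; rewrite coef_mixed_deriv [RHS]coefB !coef_mixed_deriv !coefB derivB mulrnBl; ring.
Qed.

(** The last term is the price of truncating the outer variable; being divisible by 'X^T, it is
    invisible below degree [T]. *)
Lemma mixed_deriv_bitaylor e : mixed_deriv (bitaylor e) =
  - (e%:~R * bitaylor (e + 1)) - (T.+1%:R * taylor (e + T.+1%:Z))%:P * 'X^T.
Proof.
apply/polyP => k; rewrite coef_mixed_deriv coefB coefN coefCM coefXn.
rewrite -[e%:~R](rmorph_int (@polyC _)) coefCM !coef_poly !ltnS.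
have shift (j : nat) : e + j.+1%:Z = e + 1 + j%:Z by lia.
have eE : (e + k%:Z + 1)%:~R = e%:~R + k.+1%:R :> {poly rat}.
  by rewrite -natr1 !rmorphD addrA.
case: ltngtP => [kT|kT|->].
- rewrite deriv_taylor eE shift.
  rewrite (_ : e + k%:Z + 1 = e + 1 + k%:Z); last by lia.
  by rewrite -mulr_natl mulr0n; ring.
- by rewrite mul0rn deriv0 mulr0n; ring.
- rewrite deriv_taylor (_ : e + T%:Z + 1 = e + T.+1%:Z); last by lia.
  rewrite (_ : e + 1 + T%:Z = e + T.+1%:Z); last by lia.
  rewrite mul0rn mulr1n mulr1 (_ : e + T.+1%:Z = e + T%:Z + 1); last by lia.
  by rewrite -[in RHS]natr1 !rmorphD /= -!pmulrn; ring.
Qed.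

(* The coefficients of [(\sum_d xi d * u ^ d) * u / (u - x)], truncated in [x]. *)
Definition geometric_shift (e : int) : {poly rat} :=
  \poly_(k < T.+1) (if e + k%:Z is Posz d then xi d else 0).

(* By [ward_down], [mixed_deriv] kills [I] up to degree [T], so [I`_s] is [I`_0^`(s) / s!]. *)
Lemma translate_Lam (s : nat) : (s <= T)%N ->
  (Lam m K geometric_shift)`_s =
  (Lam m K taylor)`_s.
Proof.
move=> sT; pose I := Lam m K bitaylor.
have I_step A : (A < T)%N -> I`_A.+1 *+ A.+1 = (I`_A)^`().
  move=> AT; apply/eqP; rewrite -subr_eq0 -coef_mixed_deriv /I.
  rewrite (@Lam_derivation m _ mixed_deriv bitaylor K mixed_derivB mixed_derivM).
  pose Q := \sum_(g : {ffun pairs m -> 'I_K.+1}) (wt (bx g))%:R * \sum_i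
    (T.+1%:R * taylor (net (bx g) i + T.+1%:Z))%:P * \prod_(j | j != i) bitaylor (net (bx g) j).
  set L := \sum_g _.
  have -> : L = - (\sum_(g : {ffun pairs m -> 'I_K.+1}) (wt (bx g))%:R *
      \sum_i (net (bx g) i)%:~R *
         (bitaylor (net (bx g) i + 1) * \prod_(j | j != i) bitaylor (net (bx g) j))) - Q * 'X^T.
    rewrite mulr_suml -opprD -big_split -sumrN; apply: eq_bigr => g _ /=.
    rewrite -mulrA -mulrDr -mulrN; congr (_ * _).
    rewrite mulr_suml -big_split -sumrN; apply: eq_bigr => i _ /=.
    by rewrite mixed_deriv_bitaylor; ring.
  rewrite (@ward_down m K _ bitaylor T); first by rewrite oppr0 sub0r coefN coefMXn AT oppr0.
    move=> d dT; apply/polyP => k; rewrite coef_poly coef0; case: ltnP => // kT.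
    have : d + k%:Z < 0 by lia.
    by case: (d + k%:Z).
  exact: K_large.
have I_fact A : (A <= T)%N -> I`_A *+ A`! = (I`_0)^`(A).
  elim: A => [|A IH] AT; first by rewrite fact0.
  by rewrite factS mulrnA I_step // derivnS -IH 1?ltnW // derivMn.
have /(congr1 (fun p : {poly rat} => p`_0)) := I_fact s sT.
rewrite coef_derivn addn0 ffactnn coefMn.
have -> : I`_0 = Lam m K taylor.
  rewrite -[I`_0]/(coefp 0 I) Lam_rmorph; congr Lam; apply/funext => e /=.
  by rewrite coef_poly addr0.
have -> : (I`_s)`_0 = (map_poly (coefp 0) I)`_s by rewrite coef_map_coefp0.
rewrite Lam_rmorph.
have -> : Lam m K (map_poly (coefp 0) \o bitaylor) = Lam m K geometric_shift.
  congr Lam; apply/funext => e; apply/polyP => k; rewrite /= coef_map_coefp0 !coef_poly.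
  case: ltnP => _; rewrite ?coef0 //=.
  case: (e + k%:Z) => [d|d]; last by rewrite coef0.
  by have := coef_taylor d 0; rewrite bin0 mul1r addn0.
move=> /eqP; rewrite -subr_eq0 -mulrnBl mulrn_eq0 subr_eq0.
by rewrite gtn_eqF ?fact_gt0 //= => /eqP.
Qed.

End Translation.

(** * Invariance under a Moebius flow *)

Section Moebius.
Variables (m K : nat) (R : comNzRingType) (y : R).
Hypothesis char0 : forall (x : R) k, x *+ k.+1 = 0 -> x = 0.
Hypothesis m_gt0 : (0 < m)%N.
Hypothesis K_large : (Kmin m 1 <= K)%N.

(** The sum of all [net] values, by [total_net]: a value beyond [D] forces a negative one elsewhere,
    so series in w may be cut at this degree. *)
Let D := (m * m.-1)%N.
Let s1 : {poly R} := 1 - 'X.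
Let tw : {poly {poly R}} := 1 - s1%:P * 'X.
Let X1 : {poly {poly R}} := 'X + y%:P%:P * tw.
Let B1 : {poly {poly R}} := 1 + 'X%:P * 'X.
Let G1 : {poly {poly R}} := \poly_(l < D.+1) s1 ^+ l.

(* [d/ds + w^2 d/dw], with [w] the outer and [s] the inner variable. *)
Definition moebius_deriv (p : {poly {poly R}}) : {poly {poly R}} :=
  map_poly (@deriv R) p + 'X * ('X * p^`()).
Local Notation Ds := moebius_deriv.

Lemma moebius_derivM p q : Ds (p * q) = Ds p * q + p * Ds q.
Proof.
rewrite /Ds derivM map_derivM; ring.
Qed.

Lemma map_derivC (c : {poly R}) : map_poly (@deriv R) c%:P = (c^`())%:P.
Proof. by rewrite map_polyC. Qed.

Lemma map_derivX : map_poly (@deriv R) 'X = 0.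
Proof.
apply/polyP => k; rewrite coef_map_id0 ?deriv0 // coefX coef0.
by case: eqP; rewrite ?derivC ?deriv0 // -[1]/(1%:P) derivC.
Qed.

Lemma moebius_derivB : zmod_morphism Ds.
Proof.
move=> p q.
have mapB : map_poly (@deriv R) (p - q) = map_poly (@deriv R) p - map_poly (@deriv R) q.
  by apply/polyP => i; rewrite coefB !coef_map_id0 ?deriv0 // coefB derivB.
by rewrite /Ds derivB !mulrBr mapB; ring.
Qed.

Lemma moebius_derivD p q : Ds (p + q) = Ds p + Ds q.
Proof.
have Ds0 : Ds 0 = 0 by have := moebius_derivB 0 0; rewrite !subrr.
have DsN a : Ds (- a) = - Ds a by rewrite -sub0r moebius_derivB Ds0 sub0r.
by rewrite -{1}[q]opprK moebius_derivB DsN opprK.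
Qed.

Lemma moebius_derivC (c : {poly R}) : Ds c%:P = (c^`())%:P.
Proof. by rewrite /Ds map_derivC derivC !mulr0 addr0. Qed.

Lemma moebius_deriv_var : Ds 'X = 'X * 'X.
Proof. by rewrite /Ds map_derivX derivX mulr1 add0r. Qed.

Lemma deriv_one : (1 : {poly R})^`() = 0.
Proof. by rewrite -[1]/(1%:P) derivC. Qed.

Lemma moebius_deriv1 : Ds 1 = 0.
Proof. by rewrite -[X in Ds X]/(1%:P) moebius_derivC deriv_one. Qed.

Lemma deriv_s1 : s1^`() = -1.
Proof. by rewrite /s1 derivB derivX deriv_one sub0r. Qed.

Lemma moebius_deriv_tw : Ds tw = 'X * tw.
Proof.
rewrite /tw moebius_derivB moebius_deriv1 moebius_derivM moebius_derivC.
by rewrite moebius_deriv_var deriv_s1 polyCN polyC1; ring.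
Qed.

Lemma moebius_deriv_X1 : Ds X1 = 'X * X1.
Proof.
rewrite /X1 moebius_derivD moebius_derivM moebius_deriv_var moebius_derivC.
by rewrite derivC polyC0 mul0r add0r moebius_deriv_tw; ring.
Qed.

Lemma moebius_deriv_B1 : Ds B1 = 'X * B1.
Proof.
rewrite /B1 moebius_derivD moebius_deriv1 moebius_derivM moebius_derivC.
by rewrite moebius_deriv_var derivX polyC1; ring.
Qed.

Lemma moebius_deriv_G1 :
  Ds G1 = - ('X * G1) + (D.+1%:R * s1 ^+ D)%:P * 'X^(D.+1).
Proof.
apply/polyP => k; rewrite !coefD coef_map_id0 ?deriv0 // coefN coefCM coefXn !coefXM.
case: k => [|k].
  by rewrite coef_poly /= expr0 deriv_one mulr0n; ring.
have dS j : (s1 ^+ j.+1)^`() = - (s1 ^+ j *+ j.+1).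
  by rewrite deriv_exp deriv_s1 mulN1r mulNrn.
rewrite /= eqSS; case: k => [|k].
  rewrite !coef_poly ltnS /=; case: (posnP D) => [->|Dpos].
    by rewrite /= deriv0 expr0 mulr1n; ring.
  by rewrite dS expr0 (ltn_eqF Dpos) mulr0n; ring.
rewrite /= coef_deriv !coef_poly !ltnS.
case: (ltngtP k.+1 D) => kD.
- by rewrite dS mulr0n !mulrS; ring.
- by rewrite deriv0 mul0rn mulr0n; ring.
- by rewrite -kD deriv0 mulr1n -mulr_natl; ring.
Qed.

Lemma moebius_derivXn p n : Ds p = 'X * p -> Ds (p ^+ n) = n%:R * ('X * p ^+ n).
Proof.
move=> Dp; elim: n => [|n IH]; first by rewrite moebius_deriv1 mul0r.
by rewrite exprS moebius_derivM IH Dp -natr1; ring.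
Qed.

(** With w outer and s inner, (w + y (1 - (1 - s) w)) ^ m * (1 + s w) ^ m / (1 - (1 - s) w) ^ 3, the
    last factor truncated. It joins (y + (1 - y) w) ^ m / (1 - w) ^ 3 at s = 0 to (w + y) ^ m (1 +
    w) ^ m at s = 1. Each linear factor p satisfies Ds p = w p, so the total degree 2 m - 3 is the
    weight that [ward_up] demands. *)
Let Phi := X1 ^+ m * B1 ^+ m * G1 ^+ 3.

Lemma moebius_deriv_Phi : exists Q, Ds Phi =
  (2 * m)%:R * ('X * Phi) - 3%:R * ('X * Phi) + Q * 'X^(D.+1).
Proof.
exists (X1 ^+ m * B1 ^+ m * (3%:R * G1 ^+ 2 * (D.+1%:R * s1 ^+ D)%:P)).
have DG3 : Ds (G1 ^+ 3) = 3%:R * G1 ^+ 2 * Ds G1.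
  by rewrite !exprS expr0 mulr1 !moebius_derivM; ring.
rewrite /Phi (moebius_derivM (X1 ^+ m * B1 ^+ m)) (moebius_derivM (X1 ^+ m)) (moebius_derivXn m moebius_deriv_X1) (moebius_derivXn m moebius_deriv_B1).
by rewrite DG3 moebius_deriv_G1 natrM; ring.
Qed.

Let phi (e : int) : {poly R} := if e is Posz d then Phi`_d else 0.

Lemma phi_neg (e : int) : e < 0 -> phi e = 0.
Proof. by case: e. Qed.

(** Coefficient e of [moebius_deriv_Phi]: the term w ^ 2 d/dw contributes (e - 1) * phi (e - 1), and
    (2 m - 3) - (e - 1) = 2 (m - 1) - e. *)
Lemma deriv_phi (e : int) : e <= D%:Z ->
  (phi e)^`() = - (e - m.-1%:Z *+ 2)%:~R * phi (e - 1).
Proof.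
have [Q eQ] := moebius_deriv_Phi.
case: e => [d|d] dD; last first.
  by rewrite phi_neg ?mulr0 ?deriv0 //; lia.
case: d dD => [|d] dD.
  have := congr1 (fun p : {poly {poly R}} => p`_0) eQ.
  rewrite coefD coef_map_id0 ?deriv0 // !coefD coefN coefMXn !mulr_natl !coefMn !coefXM /=.
  by rewrite !mul0rn subr0 !addr0 mulr0 => ->.
rewrite lez_nat in dD.
have phi1 : phi (Posz d.+1 - 1) = Phi`_d.
  by have -> : Posz d.+1 - 1 = Posz d by lia.
rewrite phi1 [phi _]/=.
have X2 : ('X * ('X * Phi^`()))`_d.+1 = Phi`_d *+ d.
  by rewrite !coefXM /=; case: (d) => [|k] //=; rewrite coef_deriv.
have := congr1 (fun p : {poly {poly R}} => p`_d.+1) eQ.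
rewrite coefD X2 coef_map_id0 ?deriv0 // !coefD coefN coefMXn ltnS dD addr0 !mulr_natl !coefMn !coefXM /=.
move=> /(canRL (addrK _)) ->; rewrite -![Phi`_d *+ _]mulr_natl rmorphB rmorphMn /= -!pmulrn.
have -> : (2 * m)%:R = 2 + m.-1%:R *+ 2 :> {poly R}.
  by rewrite -{1}(prednK m_gt0) mulnS natrD natrM mulr_natl.
by rewrite -natr1; ring.
Qed.

Lemma coef_cube_geometric (N d : nat) : (d <= N)%N ->
  ((\poly_(l < N.+1) (1 : R)) ^+ 3)`_d = 'C(d + 2, 2)%:R.
Proof.
move=> dN; set G := \poly_(l < N.+1) _.
have G0 k : (k <= N)%N -> G`_k = 1 by move=> kN; rewrite coef_poly ltnS kN.
have G2 k : (k <= N)%N -> (G ^+ 2)`_k = k.+1%:R.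
  move=> kN; rewrite expr2 coefM (eq_bigr (fun=> 1)) => [|i _].
    by rewrite sumr_const card_ord.
  have := ltn_ord i; rewrite ltnS => ik.
  by rewrite !G0 ?mulr1 // (leq_trans _ kN) // leq_subr.
have sumS k : (\sum_(i < k.+1) i.+1 = 'C(k + 2, 2))%N.
  elim: k => [|k IH]; first by rewrite big_ord1.
  by rewrite big_ord_recr IH /= addSn binS bin1 !addn2.
rewrite exprS mulrC coefM -sumS natr_sum; apply: eq_bigr => i _.
have := ltn_ord i; rewrite ltnS => id.
by rewrite G2 ?G0 ?mulr1 // (leq_trans _ dN) // leq_subr.
Qed.

Lemma map_Phi a : map_poly (horner_eval a) Phi =
  ('X + y%:P * (1 - (1 - a)%:P * 'X)) ^+ m * (1 + a%:P * 'X) ^+ m *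
  (\poly_(l < D.+1) (1 - a) ^+ l) ^+ 3.
Proof.
have -> : Phi = X1 ^+ m * B1 ^+ m * G1 ^+ 3 by [].
rewrite (rmorphM _ (X1 ^+ m * B1 ^+ m)) (rmorphM _ (X1 ^+ m)).
rewrite (rmorphXn _ m X1) (rmorphXn _ m B1) (rmorphXn _ 3 G1) /=.
have -> : map_poly (horner_eval a) X1 = 'X + y%:P * (1 - (1 - a)%:P * 'X).
  rewrite /X1 /tw /s1 rmorphD rmorphM rmorphB rmorphM rmorph1 /= !map_polyC map_polyX.
  by rewrite /= /horner_eval !hornerE.
have -> : map_poly (horner_eval a) B1 = 1 + a%:P * 'X.
  by rewrite /B1 rmorphD rmorphM rmorph1 /= map_polyC map_polyX /= /horner_eval !hornerE.
congr (_ * _ ^+ 3); apply/polyP => k; rewrite coef_map !coef_poly.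
case: ifP => _; last by rewrite /= /horner_eval horner0.
by rewrite /= /horner_eval horner_exp /s1 !hornerE.
Qed.

Lemma horner_phi a : horner_eval a \o phi = fun e : int =>
  if e is Posz d then (map_poly (horner_eval a) Phi)`_d else 0.
Proof.
apply/funext => -[d|d] /=; first by rewrite coef_map.
by rewrite /horner_eval horner0.
Qed.

(* [I] is constant in [s] by [ward_up]; its values at [s = 0] and [s = 1] are the two sides. *)
Lemma moebius_Lam :
  Lam m K (fun e : int => if e is Posz d then
     \sum_(j < d.+1) (y ^+ (m - j) * (1 - y) ^+ j) *+ ('C(m, j) * 'C(d - j + 2, 2)) else 0) =
  Lam m K (fun e : int => if e is Posz d then
     ((('X + y%:P) ^+ m * (1 + 'X) ^+ m) : {poly R})`_d else 0).
Proof.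
pose I := Lam m K phi.
have dI : I^`() = 0.
  rewrite (@Lam_derivation m _ (@deriv R) phi K) => [|p q|p q]; last 2 first.
  - exact: derivB.
  - exact: derivM.
  have phi0 (d : int) : d < - 0%:Z -> phi d = 0 by rewrite oppr0; apply: phi_neg.
  rewrite -[RHS]oppr0 -[X in _ = - X](ward_up phi0 K_large).
  rewrite -sumrN; apply: eq_bigr => g _; rewrite -mulrN -sumrN; congr (_ * _).
  apply: eq_bigr => i _; have [iD|iD] := leP (net (bx g) i) D%:Z.
    by rewrite deriv_phi // !mulNr mulrA.
  (* Beyond degree [D] the truncation of [G1] spoils the differential equation, but there the
     product vanishes because of another vertex. *)
  have [j ji] : exists2 j, j != i & net (bx g) j < 0.
    apply: contrapT => nex; have := total_net (bx g); rewrite (bigD1 i) //=.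
    have : 0 <= \sum_(j < m | j != i) net (bx g) j.
      apply: sumr_ge0 => j ji; rewrite leNgt; apply/negP => j0; apply: nex.
      by exists j.
    by move=> S0 e; move: iD; rewrite /D -e ltNge lerDl S0.
  by move=> j0; rewrite (bigD1 j) //= (phi_neg j0) !mul0r !mulr0 oppr0.
have IC : I = (I`_0)%:P.
  apply/polyP => -[|k]; rewrite coefC //=; apply: (char0 (k := k)).
  by rewrite -coef_deriv dI coef0.
have Ia a : Lam m K (horner_eval a \o phi) = I`_0.
  by rewrite -Lam_rmorph -/I /= /horner_eval IC hornerC coefC.
have Phi1 : map_poly (horner_eval 1) Phi = ('X + y%:P) ^+ m * (1 + 'X) ^+ m.
  rewrite map_Phi (_ : \poly_(l < D.+1) _ = 1).
    by rewrite expr1n mulr1 subrr polyC0 mul0r subr0 mulr1 polyC1 mul1r.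
  apply/polyP => k; rewrite coef_poly coef1 subrr expr0n.
  by case: k => //= k; case: ifP.
have Phi0 : map_poly (horner_eval 0) Phi =
    (y%:P + (1 - y)%:P * 'X) ^+ m * (\poly_(l < D.+1) 1) ^+ 3.
  rewrite map_Phi subr0 polyC0 polyC1 mul0r addr0 expr1n mulr1 mul1r polyCB polyC1.
  congr (_ ^+ m * _ ^+ 3); first by ring.
  by apply/polyP => k; rewrite !coef_poly expr1n.
have := Ia 0; rewrite -(Ia 1) !horner_phi Phi0 Phi1.
move=> <-; apply: eq_Lam => g.
have [[i i0]|net0] := net_sign (bx g).
  rewrite (bigD1 i) //= [RHS](bigD1 i) //=.
  by case: (net _ i) i0 => // d _; rewrite !mul0r.
apply: eq_bigr => i _; have := net_le i net0; have := net0 i.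
case: (net _ i) => // d _; rewrite lez_nat => dD.
rewrite coefM; apply: eq_bigr => j _.
have jd : (d - j <= D)%N by rewrite (leq_trans (leq_subr _ _)).
rewrite coef_cube_geometric // mulr_natr mulrnA; congr (_ *+ _).
have coefk k : (y%:P ^+ (m - k) * ((1 - y)%:P * 'X) ^+ k)`_j =
    y ^+ (m - k) * (1 - y) ^+ k * ((j : nat) == k)%:R.
  by rewrite exprMn mulrA -!polyC_exp -polyCM coefCM coefXn.
rewrite [in RHS]exprDn coef_sum; under [RHS]eq_bigr => k _ do rewrite coefMn coefk.
have [jm|mj] := leqP j m; last first.
  rewrite bin_small // mulr0n big1 // => k _.
  by rewrite gtn_eqF ?mulr0 ?mul0rn // (leq_trans _ mj).
rewrite (bigD1 (Ordinal (jm : (j < m.+1)%N))) //= big1 ?addr0 ?eqxx ?mulr1 // => k kj.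
rewrite (_ : (j : nat) == k = false) ?mulr0 ?mul0rn //.
by apply/negbTE; apply: contra kj => /eqP jk; apply/eqP/val_inj.
Qed.

End Moebius.


(** * From h to a flow sum with polynomial vertex series *)

Section Assembly.
Local Notation Lr := (laurent rat).
Implicit Types X Y : Lr.

Lemma inv_one_sub_y p : (1 - yvar) ^- p.+1 = lseries (fun b => 'C(b + p, p)%:R) :> Lr.
Proof.
have base : (1 - yvar)^-1 = lseries (fun=> 1) :> Lr.
  have := @lconst_sub_var_inv rat 1 (oner_neq0 _); rewrite rmorph1 => ->.
  by congr lseries; apply/funext => k; rewrite expr1n invr1.
elim: p => [|p IH].
  by rewrite expr1 base; congr lseries; apply/funext => b; rewrite addn0 bin0.
rewrite exprSr invfM base IH lseriesM; congr lseries; apply/funext => k.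
under eq_bigr => i _ do rewrite mulr1.
rewrite -natr_sum; congr (_%:R).
elim: k => [|k IHk]; first by rewrite big_ord1 !add0n !binn.
by rewrite big_ord_recr IHk /= [(k.+1 + p.+1)%N]addSn binS addSnnS.
Qed.

(** Transports coefficients of low degree between polynomial flow sums and flow sums in Q((y)). *)
Definition agree (T : nat) (p : {poly rat}) X :=
  lbound X 0 /\ forall i : nat, (i <= T)%N -> X i%:Z = p`_i.

Lemma agreeD T p q X Y : agree T p X -> agree T q Y -> agree T (p + q) (X + Y).
Proof.
move=> [X0 Xp] [Y0 Yq]; split=> [k k0|i iT]; first by rewrite lcoefD X0 // Y0 // addr0.
by rewrite lcoefD coefD Xp // Yq.
Qed.

Lemma agreeM T p q X Y : agree T p X -> agree T q Y -> agree T (p * q) (X * Y).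
Proof.
move=> [X0 Xp] [Y0 Yq]; split; first by rewrite -(addr0 0); apply: lmul_bound.
move=> i iT; have := lmulE X0 Y0 (leqnn i); rewrite addr0 add0r => ->.
rewrite !coefM; apply: eq_bigr => j _; have ji : (j <= i)%N by rewrite -ltnS.
rewrite !ltrunc_coef ?leq_subr // !add0r Xp ?Yq // ?(leq_trans _ iT) //.
by rewrite leq_subr.
Qed.

Lemma agree_nat T k : agree T k%:R k%:R.
Proof.
elim: k => [|k IH]; first by split=> [//|i _]; rewrite coef0.
rewrite -!natr1; apply: agreeD => //; split=> [j j0|i _].
  by rewrite lcoef1; case: j j0.
by rewrite lcoef1 coef1.
Qed.

Lemma agree_prod T (I : Type) (s : seq I) (p : I -> {poly rat}) (X : I -> Lr) :
  (forall i, agree T (p i) (X i)) -> agree T (\prod_(i <- s) p i) (\prod_(i <- s) X i).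
Proof.
move=> pX; elim: s => [|i s IH]; first by rewrite !big_nil; apply: (agree_nat T 1).
by rewrite !big_cons; apply: agreeM.
Qed.

Lemma agree_Lam m T K (phi : int -> {poly rat}) (psi : int -> Lr) :
  (forall g : {ffun pairs m -> 'I_K.+1},
     agree T (\prod_i phi (net (bx g) i)) (\prod_i psi (net (bx g) i))) ->
  agree T (Lam m K phi) (Lam m K psi).
Proof.
move=> pp; rewrite /Lam; elim: (index_enum _) => [|g s IH].
  by rewrite !big_nil; apply: (agree_nat T 0).
by rewrite !big_cons; apply: agreeD => //; apply: agreeM => //; apply: agree_nat.
Qed.

Lemma trinomial_revision (s e : nat) :
  ('C(s + 2, e + 2) * 'C(e + 2, 2) = 'C(s + 2, 2) * 'C(s, e))%N.
Proof.
rewrite !addn2.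
have e1 := mul_bin_diag s.+2 e.+1; have e2 := mul_bin_diag s.+1 e.
have b2 k : (2 * 'C(k.+2, 2) = k.+2 * k.+1)%N by rewrite -mul_bin_diag bin1.
by have := b2 s; have := b2 e; rewrite /= in e1 e2; nia.
Qed.

(* Vandermonde's convolution, after [trinomial_revision]. *)
Lemma taylor_binomial (m d b : nat) :
  ('C(d + b, b) * (if m <= d + b then 'C(d + b - m + 2, 2) else 0) =
   \sum_(j < d.+1) 'C(m, j) * ('C(d - j + 2, 2) *
     (if m - j <= b then 'C(b - (m - j) + (2 + (d - j)), 2 + (d - j)) else 0)))%N.
Proof.
have [mdb|mdb] := leqP m (d + b); last first.
  rewrite muln0 big1 // => j _; rewrite ifF ?muln0 //.
  by have := ltn_ord j; lia.
set s := (d + b - m)%N.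
transitivity (\sum_(j < d.+1) 'C(s + 2, 2) * ('C(m, j) * 'C(s, d - j)))%N.
  rewrite -big_distrr /= binomial.Vandermonde (_ : m + s = d + b)%N; last by rewrite /s; lia.
  by rewrite -[X in (_ = _ * X)%N](@bin_sub (d + b) d) ?leq_addr // addKn mulnC.
apply: eq_bigr => j _; have := ltn_ord j; rewrite ltnS => jd.
have [jm|mj] := leqP j m; last by rewrite (bin_small mj) !mul0n muln0.
rewrite mulnCA; congr (_ * _)%N; have [mjb|mjb] := leqP (m - j) b.
  rewrite (_ : b - (m - j) + (2 + (d - j)) = s + 2)%N; last by rewrite /s; lia.
  by rewrite -trinomial_revision mulnC [(2 + _)%N]addnC.
by rewrite muln0 (bin_small (m := d - j)) ?muln0 // /s; lia.
Qed.

Definition shifted_binomial (m s : nat) : nat :=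
  if (m <= s)%N then 'C(s - m + 2, 2) else 0.

(* Coefficient of [u ^ e] in [(u + y) ^ m / (1 - u - y) ^ 3]. *)
Definition residue_series (m : nat) (e : int) : Lr :=
  if e is Posz d then lseries (fun b => ('C(d + b, b) * shifted_binomial m (d + b))%:R) else 0.

Lemma lcoef_natM (c : nat) X k : (c%:R * X) k = c%:R * X k.
Proof.
rewrite !mulr_natl; elim: c => [|c IH]; first by rewrite !mulr0n.
by rewrite !mulrS lcoefD IH.
Qed.

Lemma lcoef_sum (I : Type) (s : seq I) (F : I -> Lr) k :
  (\sum_(i <- s) F i) k = \sum_(i <- s) F i k.
Proof. by elim: s => [|i s IH]; rewrite ?big_nil // !big_cons lcoefD IH. Qed.

Lemma one_sub_y_neq0 : 1 - yvar != 0 :> Lr.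
Proof.
apply/eqP => e; have := inv_one_sub_y 0; rewrite e expr1 invr0.
by move=> /laurentP/(_ 0) /eqP /=; rewrite eq_sym oner_eq0.
Qed.

(** The substitution u = (1 - y) v turns (u + y) ^ m / (1 - u - y) ^ 3 into (1 - y) ^ -3 * (y + (1 -
    y) v) ^ m / (1 - v) ^ 3. *)
Lemma residue_seriesE m d :
  residue_series m d%:Z * (1 - yvar) ^+ (d + 3) =
  \sum_(j < d.+1) (yvar ^+ (m - j) * (1 - yvar) ^+ j) *+ ('C(m, j) * 'C(d - j + 2, 2)).
Proof.
have -> : residue_series m d%:Z = \sum_(j < d.+1)
    ('C(m, j) * 'C(d - j + 2, 2))%:R * (yvar ^+ (m - j) * (1 - yvar) ^- (2 + (d - j)).+1).
  apply/laurentP => k; rewrite lcoef_sum.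
  under eq_bigr => j _ do rewrite lcoef_natM inv_one_sub_y exprnP lcoef_varzM.
  case: k => [b|b]; last first.
    by rewrite big1 // => j _; rewrite (lseries_bound) ?mulr0 //; lia.
  rewrite /residue_series lseriesE taylor_binomial natr_sum; apply: eq_bigr => j _.
  rewrite mulnA natrM; congr (_ * _); case: leqP => mjb.
    by rewrite (_ : b%:Z - (m - j)%N%:Z = (b - (m - j))%N%:Z) //; lia.
  by rewrite lseries_bound //; lia.
rewrite mulr_suml; apply: eq_bigr => j _; have := ltn_ord j; rewrite ltnS => jd.
rewrite -[in RHS]mulr_natl -!mulrA; congr (_ * (_ * _)).
rewrite (_ : d + 3 = j + (2 + (d - j)).+1)%N; last by lia.
by rewrite exprD mulrCA mulVf ?mulr1 // expf_neq0 // one_sub_y_neq0.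
Qed.



(** A vertex absorbs (1 - y) ^ (net + 3); since the [net] values always add up to m (m - 1), the
    same power serves all flows. *)
Lemma Lam_residue_series m K :
  Lam m K (residue_series m) * (1 - yvar) ^+ (m * m.-1 + 3 * m) =
  Lam m K (fun d => if d is Posz d then \sum_(j < d.+1)
    (yvar ^+ (m - j) * (1 - yvar) ^+ j) *+ ('C(m, j) * 'C(d - j + 2, 2)) else 0).
Proof.
rewrite /Lam mulr_suml; apply: eq_bigr => g _; rewrite -mulrA; congr (_ * _).
have [[i i0]|net0] := net_sign (bx g).
  rewrite (bigD1 i) //= [RHS](bigD1 i) //=.
  by case: (net _ i) i0 => // d _; rewrite !mul0r.
have netE i : net (bx g) i = `|net (bx g) i|%N by rewrite gez0_abs.
have -> : (m * m.-1 + 3 * m = \sum_(i < m) (`|net (bx g) i|%N + 3))%N.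
  rewrite big_split /= sum_nat_const card_ord [(m * 3)%N]mulnC; congr (_ + _)%N.
  apply: (can_inj absz_nat); rewrite -(total_net (bx g)) (big_morph Posz PoszD (erefl _)).
  by apply: eq_bigr => i _.
rewrite expr_sum -big_split; apply: eq_bigr => i _ /=.
by rewrite [in LHS](netE i) residue_seriesE (netE i).
Qed.

Lemma agree_fun T p q X : agree T p X -> agree T q X -> forall i, (i <= T)%N -> p`_i = q`_i.
Proof. by move=> [_ pX] [_ qX] i iT; rewrite -pX // -qX. Qed.

(** The bound by [m * m + t] keeps the degrees that occur, at most m (m - 1) + t, clear of the
    cutoff in [trc]; [Kmin m t.+1] is what translation up to degree [t] requires. *)
Lemma coef_Lam_shifted m L t s : (m * m + t <= L)%N -> (Kmin m t.+1 <= L)%N -> (s <= t)%N ->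
  (Lam m L (shifted_series m L))`_s = Lam m L (residue_series m) s%:Z.
Proof.
move=> tL KL st; pose xi d : rat := (trc L (d%:Z - m%:Z))%:R.
have xi0 d : (L + m < d)%N -> xi d = 0.
  move=> dL; rewrite /xi /trc (_ : d%:Z - m%:Z = (d - m)%N%:Z); last by lia.
  by case: leqP => //; lia.
pose lift (p : {poly rat}) := lseries (fun k => p`_k).
have liftP T p : agree T p (lift p) by split=> // k; apply: lseries_bound.
have -> : (Lam m L (shifted_series m L))`_s = (Lam m L (geometric_shift t xi))`_s.
  apply: (@agree_fun t _ _ (Lam m L (lift \o geometric_shift t xi))) => //; last first.
    by apply: agree_Lam => g; apply: agree_prod => i; apply: liftP.
  apply: agree_Lam => g; apply: agree_prod => i; split=> [k|k kt]; first exact: lseries_bound.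
  rewrite /= /shifted_series coef_sum coef_poly ltnS kt.
  have kL : (k < L.+1)%N by lia.
  rewrite (bigD1 (Ordinal kL)) //= coefZ coefXn eqxx mulr1 big1 ?addr0 => [|j jk]; last first.
    rewrite coefZ coefXn (_ : (k == j) = false) ?mulr0 //.
    by apply: contraNF jk => /eqP kj; apply/eqP/val_inj.
  rewrite /xi; case: (_ + _) => // d.
  by rewrite /trc; case E: (Negz d - m%:Z) => [l|l] //; lia.
rewrite (translate_Lam xi0 KL st).
suff [_ <- //] : agree t (Lam m L (taylor (L + m) xi)) (Lam m L (residue_series m)).
apply: agree_Lam => g.
have [[i i0]|net0] := net_sign (bx g).
  rewrite (bigD1 i) //= [X in agree _ _ X](bigD1 i) //=.
  by case: (net _ i) i0 => // d _; rewrite !mul0r; apply: (agree_nat t 0).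
apply: agree_prod => i; have := net_le i net0; have := net0 i.
case: (net _ i) => // d _; rewrite lez_nat => dD; split=> [k|b bt]; first exact: lseries_bound.
rewrite (coef_taylor xi0) lseriesE natrM; congr (_ * _); rewrite /xi /shifted_binomial.
have [mdb|mdb] := leqP m (d + b).
  rewrite (_ : (d + b)%N%:Z - m%:Z = (d + b - m)%N%:Z); last by lia.
  by rewrite /trc ifT ?addn2 //; have := leq_mul (leqnn m) (leq_pred m); lia.
by rewrite /trc; case E: ((d + b)%N%:Z - m%:Z) => [l|l] //; lia.
Qed.

(** The factor j + 1 comes from (1 - x_n) ^ -2. The truncation [L] depends on [t], and [Lam_widen]
    replaces it by a [K] that does not. *)
Lemma h_residue_series m K (t : nat) : (Kmin m 0 <= K)%N ->
  h m.+2 t = \sum_(j < t.+1) (j.+1)%:R * Lam m K (residue_series m) (t - j)%N%:Z.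
Proof.
move=> K0; have [o hE] := h_expansion (erefl m.+2).
pose L := maxn (maxn (o t) (Kmin m t.+1)) (maxn K (m * m + t)).
have [oL KL1 KL2 tL] : [/\ o t <= L, Kmin m t.+1 <= L, K <= L & m * m + t <= L]%N.
  by rewrite /L !leq_max !leqnn ?orbT.
rewrite (hE t L oL) (big_ord_widen L.+1 (fun j : nat => (j.+1)%:R * Lam m K (residue_series m) (t - j)%N%:Z)); last by lia.
rewrite [RHS]big_mkcond; apply: eq_bigr => j _; rewrite /coef_pos ltnS.
case: leqP => [jt|]; last by rewrite mulr0.
rewrite (coef_Lam_shifted tL KL1) ?leq_subr // -(@Lam_widen m _ _ K L) ?K0 //.
by case.
Qed.

Lemma hstar_Lam m K : (0 < m)%N -> (Kmin m 1 <= K)%N ->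
  hstar m.+2 = Lam m K (fun e : int => if e is Posz d then
     ((('X + yvar%:P) ^+ m * (1 + 'X) ^+ m) : {poly Lr})`_d else 0).
Proof.
move=> m0 K1; rewrite -moebius_Lam //; last first.
  move=> X k /eqP; rewrite -mulr_natl => /eqP e; apply/laurentP => j.
  have /laurentP/(_ j) := e; rewrite lcoef_natM => /eqP.
  by rewrite mulf_eq0 pnatr_eq0 => /eqP.
have K0 : (Kmin m 0 <= K)%N by move: K1; rewrite /Kmin; nia.
rewrite -Lam_residue_series; set X := Lam m K (residue_series m).
have X0 : lbound X 0.
  suff [] : agree 0 (Lam m K (fun e => (residue_series m e 0)%:P)) X by [].
  apply: agree_Lam => g; apply: agree_prod => i; split=> [k|k].
    by case: (net _ i) => d //; apply: lseries_bound.
  by rewrite leqn0 => /eqP ->; rewrite coefC.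
have hX : lseries (h m.+2) = (1 - yvar) ^- 2 * X.
  have -> : X = lseries (fun k => X k%:Z).
    by apply/laurentP; case=> // k; rewrite X0.
  rewrite inv_one_sub_y lseriesM; congr lseries; apply/funext => k.
  by rewrite (h_residue_series k K0); apply: eq_bigr => j _; rewrite bin1 addn1.
(* The exponent (n - 1) ^ 2 + 1 splits into 2, from (1 - x_n) ^ -2, and the exponent of the
   rescaling. *)
rewrite /hstar hX /= (_ : (m.+1 ^ 2).+1 = 2 + (m * m.-1 + 3 * m))%N; last first.
  by case: m m0 {K1 K0 X X0 hX} => //= ? _; nia.
by rewrite exprD mulrACA mulfV ?mul1r 1?mulrC // expf_neq0 ?one_sub_y_neq0.
Qed.

End Assembly.

(** * The gamma expansion *)

Lemma ordN_double k : ordN k.*2 = (k * k.+1)%N.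
Proof.
rewrite /ordN (_ : (k.*2.+1 ^ 2 = 1 + (k * k.+1) * 4)%N); last by nia.
by rewrite divnMDl // addn0 || rewrite addnC divnMDl // addn0.
Qed.

Lemma ordN_doubleS k : ordN k.*2.+1 = (k.+1 * k.+1)%N.
Proof. by rewrite /ordN (_ : (k.*2.+2 ^ 2 = (k.+1 * k.+1) * 4)%N) ?mulnK //; nia. Qed.

Lemma halfe_double k : halfe k.*2 = (k * k)%N.
Proof. by rewrite /halfe (_ : (k.*2 ^ 2 = (k * k) * 4)%N) ?mulnK //; nia. Qed.

Lemma halfe_doubleS k : halfe k.*2.+1 = (k * k.+1)%N.
Proof.
rewrite /halfe (_ : (k.*2.+1 ^ 2 = (k * k.+1) * 4 + 1)%N); last by nia.
by rewrite divnMDl // addn0.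
Qed.

Lemma ordN_halfe m : (2 * (ordN m + halfe m) = m * m.+1)%N.
Proof.
rewrite -(odd_double_half m); case: (odd m); rewrite ?add0n ?add1n.
  by rewrite ordN_doubleS halfe_doubleS; nia.
by rewrite ordN_double halfe_double; nia.
Qed.

Lemma ordN_half m : ordN m = ((m - m./2) * (m./2).+1)%N.
Proof.
rewrite -{1}(odd_double_half m); case: (odd m) (odd_double_half m) => /=; rewrite ?add0n ?add1n => mE.
  by rewrite ordN_doubleS; congr (_ * _)%N; lia.
by rewrite ordN_double; congr (_ * _)%N; lia.
Qed.

(** The sum is that of the least a_i possible at the zero flow; see [gamma_gt0]. *)
Lemma sum_subn_double m : (\sum_(i < m) (m - i.*2.+2) + m = ordN m)%N.
Proof.
have [k km] := ubnP m; elim: k m km => // k IH [|[|m]] km; first by rewrite big_ord0.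
  by rewrite big_ord1.
rewrite big_ord_recl big_ord_recr /= /bump.
rewrite (eq_bigr (fun i : 'I_m => (m - i.*2.+2)%N)); last by move=> i _; rewrite /bump; lia.
have := IH m (ltnW km); rewrite -(odd_double_half m); case: (odd m); rewrite ?add0n ?add1n -?doubleS.
  rewrite !ordN_doubleS; move: (\sum_(_ < _) _)%N => s. nia.
rewrite !ordN_double; move: (\sum_(_ < _) _)%N => s; nia.
Qed.

(** Discrete intermediate values: coordinates are raised one unit at a time. *)
Lemma sum_between (m S : nat) (lo hi : 'I_m -> nat) : (forall i, (lo i <= hi i)%N) ->
  (\sum_i lo i <= S <= \sum_i hi i)%N ->
  exists2 a : 'I_m -> nat, forall i, (lo i <= a i <= hi i)%N & (\sum_i a i = S)%N.
Proof.
move=> lohi /andP[loS]; elim: S loS => [|S IH].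
  rewrite leqn0 => /eqP lo0 _; exists lo => [i|]; last by [].
  by rewrite leqnn lohi.
rewrite leq_eqVlt => /orP[/eqP loS _|loS Shi].
  by exists lo => // i; rewrite leqnn lohi.
have [a alh aS] := IH loS (ltnW Shi).
have [i ai] : exists i, (a i < hi i)%N.
  apply/existsP; apply: contraLR Shi; rewrite negb_exists => /forallP ge_a.
  by rewrite -leqNgt -aS leq_sum // => i _; rewrite leqNgt ge_a.
exists (fun j => (a j + (j == i))%N) => [j|].
  by have := alh j; case: eqP => [->|_]; lia.
rewrite big_split /= aS -addn1; congr (_ + _)%N.
by rewrite (bigD1 i) //= eqxx big1 // => j /negPf ->.
Qed.

Section Gamma.
Variable m : nat.

Definition trinomial (a c : nat) : nat := ('C(m, a) * 'C(m - a, c))%N.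

Lemma trinomialE a c : (a + c <= m)%N ->
  trinomial a c = (m`! %/ (a`! * (m - a - c)`! * c`!))%N.
Proof.
move=> acm; have am : (a <= m)%N by lia.
have cm : (c <= m - a)%N by lia.
apply/esym/eqP; rewrite -(eqn_pmul2r (m := a`! * (m - a - c)`! * c`!)) ?muln_gt0 ?fact_gt0 //.
rewrite /trinomial -(bin_fact am) -(bin_fact cm).
set x := 'C(_, _); set z := 'C(_, _).
rewrite (_ : x * (a`! * (z * (c`! * (m - a - c)`!))) = (x * z) * (a`! * (m - a - c)`! * c`!))%N; last by nia.
by rewrite mulnK // !muln_gt0 !fact_gt0.
Qed.

Section Coef.
Variables (R : comNzRingType) (y : R).

Definition binomial_coef (d : int) : R :=
  if d is Posz d' then ((('X + y%:P) ^+ m * (1 + 'X) ^+ m) : {poly R})`_d' else 0.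

Definition ac_ok (d : int) (ac : 'I_m.+1 * 'I_m.+1) : bool :=
  (ac.1 + ac.2 <= m)%N && ((2 * ac.1 + (m - ac.1 - ac.2))%N%:Z == d).

(** Of the m factors, [ac.1] contribute w ^ 2, [ac.2] contribute y, and the remaining ones (1 + y)
    w. *)
Lemma binomial_coefE d : binomial_coef d =
  \sum_(ac | ac_ok d ac) (trinomial ac.1 ac.2)%:R * ((1 + y) ^+ (m - ac.1 - ac.2) * y ^+ ac.2).
Proof.
case: d => [d|d]; last by rewrite big1 // => -[a c] /andP[_ /eqP].
rewrite /= -exprMn (_ : ('X + y%:P) * (1 + 'X) = ((1 + y)%:P * 'X + y%:P) + 'X ^+ 2); last first.
  by rewrite rmorphD rmorph1; ring.
rewrite exprDn coef_sum; under [LHS]eq_bigr => a _.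
  rewrite coefMn -exprM coefMXn exprDn coef_sum; over.
pose G (a c : 'I_m.+1) : R := if ac_ok d (a, c) then
  (trinomial a c)%:R * ((1 + y) ^+ (m - a - c) * y ^+ c) else 0.
rewrite [RHS]big_mkcond (eq_bigr (fun ac => G ac.1 ac.2)); last by case.
rewrite -(pair_bigA _ G) /=.
apply: eq_bigr => a _.
have cE : (m - a < m.+1)%N by rewrite ltnS leq_subr.
rewrite [LHS](_ : _ = \sum_(c < (m - a).+1) if (2 * a + (m - a - c))%N == d then
    (trinomial a c)%:R * ((1 + y) ^+ (m - a - c) * y ^+ c) else 0); last first.
  case: ltnP => [da|ad]; first by rewrite mul0rn big1 // => c _; rewrite ifF //; lia.
  rewrite -sumrMnl; apply: eq_bigr => c _.
  rewrite exprMn -!polyC_exp mulrAC -polyCM coefMn coefCM coefXn.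
  have -> : (d - 2 * a == m - a - c)%N = (2 * a + (m - a - c) == d)%N by apply/eqP/eqP; lia.
  rewrite /trinomial mulr_natl mulnC mulrnA; case: eqP => _.
    by rewrite mulr1n mulr1 -!mulrnA; congr (_ *+ _); rewrite mulnC.
  by rewrite mulr0n mulr0 !mul0rn.
rewrite (big_ord_widen m.+1 (fun c => if (2 * a + (m - a - c))%N == d then
    (trinomial a c)%:R * ((1 + y) ^+ (m - a - c) * y ^+ c) else 0)) //.
rewrite big_mkcond; apply: eq_bigr => c _; rewrite /G /ac_ok /= eqz_nat.
have am := ltn_ord a; rewrite (_ : (c < (m - a).+1)%N = (a + c <= m)%N); last by lia.
by case: leqP.
Qed.

End Coef.

Section Choices.
Variable K : nat.
Local Notation choices := ({ffun pairs m -> 'I_K.+1} * {ffun 'I_m -> 'I_m.+1 * 'I_m.+1})%type.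
Implicit Types u : choices.

Definition admissible u : bool := [forall i, ac_ok (net (bx u.1) i) (u.2 i)].

Definition csum u : nat := \sum_i (u.2 i).2.

Definition choice_weight u : nat :=
  (wt (bx u.1) * \prod_i trinomial (u.2 i).1 (u.2 i).2)%N.

Lemma Lam_binomial (R : comNzRingType) (y : R) : Lam m K (binomial_coef y) =
  \sum_(u | admissible u) (choice_weight u)%:R *
    ((1 + y) ^+ (\sum_i (m - (u.2 i).1 - (u.2 i).2)) * y ^+ csum u).
Proof.
rewrite /Lam; under eq_bigr => g _.
  under eq_bigr => i _ do rewrite binomial_coefE.
  rewrite bigA_distr_big_dep mulr_sumr; over.
rewrite pair_big_dep /=; apply: eq_big => [u|u _].
  by rewrite /admissible; apply/familyP/forallP.
by rewrite big_split /= big_split /= !prodrXr -natr_prod natrM -!mulrA.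
Qed.

(** Write b + 2 c = 2 (a + b + c) - (2 a + b) at each vertex; the total is 2 m ^ 2 - m (m - 1). With
    [ordN_halfe] this gives the exponent 2 e - 2 j of 1 + y. *)
Lemma sum_b u : admissible u ->
  (\sum_i (m - (u.2 i).1 - (u.2 i).2) + 2 * csum u = m * m.+1)%N.
Proof.
move=> /forallP ok; rewrite /csum.
set sb := (\sum_i (m - _ - _))%N; set sc := (\sum_i _)%N.
pose sa := (\sum_i (u.2 i).1 : nat)%N.
have e1 : (sa + sb + sc = m * m)%N.
  rewrite /sa /sb /sc -!big_split /= -[RHS](card_ord (m * m)) card_ord -[X in (X * _)%N](card_ord m) -sum_nat_const.
  by apply: eq_bigr => i _; have /andP[] := ok i; lia.
have e2 : (2 * sa + sb = m * m.-1)%N.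
  apply: (can_inj absz_nat); rewrite -(total_net (bx u.1)) /sa /sb big_distrr -big_split /=.
  rewrite (big_morph Posz PoszD (erefl _)); apply: eq_bigr => i _.
  by have /andP[_ /eqP <-] := ok i.
by case: m e1 e2 => [|m'] /=; nia.
Qed.

(** Look at the last w = m - m./2 vertices. There c_i >= m - net_i, and flow across the cut only
    enters this set, so the [net] values in it total at most w (w - 1), as for the zero flow. Hence
    the c_i sum to at least w (m - w + 1) = N. *)
Lemma csum_ge u : admissible u -> (ordN m <= csum u)%N.
Proof.
move=> /forallP ok; rewrite ordN_half -lez_nat; set s := m./2.
have sm : (s <= m)%N by rewrite /s; lia.
pose c (i : 'I_m) : int := (s <= i)%N%:R.
have cnet : \sum_i c i * net (bx u.1) i <= \sum_i c i * lam i.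
  have := sum_net (bx u.1) c; under [LHS]eq_bigr => i _ do rewrite intz.
  under [X in _ = X + _]eq_bigr => i _ do rewrite intz.
  move=> ->; rewrite gerDl sumr_le0 // => p _; rewrite mulr_ge0_le0 ?ler0n //.
  by have := src_lt_tgt p; rewrite /c; case: leqP; case: leqP => //; lia.
have clam : \sum_i c i * lam i = ((m - s) * (m - s).-1)%N%:Z.
  rewrite -(sum_lam (m - s)) (reindex_inj rev_ord_inj) /= [RHS](reindex_inj rev_ord_inj) /=.
  rewrite [RHS](eq_bigr (fun i : 'I_(m - s) => i%:Z *+ 2)); last first.
    by move=> i _; rewrite /lam /=; have := ltn_ord i; lia.
  rewrite (big_ord_widen m (fun i => i%:Z *+ 2)) ?leq_subr // [RHS]big_mkcond.
  apply: eq_bigr => i _; have im := ltn_ord i; rewrite /c /lam /=.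
  by case: ifP; case: leqP; lia.
have csum_c : \sum_i c i * (m%:Z - net (bx u.1) i) <= (csum u)%:Z.
  rewrite /csum (big_morph Posz PoszD (erefl _)); apply: ler_sum => i _.
  have /andP[acm /eqP <-] := ok i; rewrite /c; case: leqP => _; rewrite ?mul0r // mul1r.
  by lia.
have cm : \sum_i c i = (m - s)%N%:Z.
  rewrite (reindex_inj rev_ord_inj) /= -[in RHS](card_ord (m - s)) -sum1_card.
  rewrite (big_ord_widen m (fun=> 1%N)) ?leq_subr // (big_morph Posz PoszD (erefl _)).
  rewrite [RHS]big_mkcond; apply: eq_bigr => i _; have im := ltn_ord i; rewrite /c /=.
  by case: ifP; case: leqP; lia.
apply: le_trans csum_c; under eq_bigr => i _ do rewrite mulrBr.
rewrite sumrB -mulr_suml cm; move: cnet; rewrite clam.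
have : m%:Z = (m - s)%N%:Z + s%:Z by lia.
move: (\sum_i _) (m - s)%N m%:Z => x w M ->.
by case: w => [|w] /=; rewrite ?mul0n ?mul0r ?PoszM; [lia|nia].
Qed.

Definition encode u : gamma_array m :=
  (\matrix_(p, r) if insub (p, r) is Some q then bx u.1 q else 0%N,
   [ffun i => (u.2 i).1 : nat], [ffun i => (m - (u.2 i).1 - (u.2 i).2)%N],
   [ffun i => (u.2 i).2 : nat]).

Lemma encode_mx u q : (encode u).1.1.1 (src q) (tgt q) = bx u.1 q.
Proof.
rewrite /= mxE; case: q => -[p r] pr /=.
by rewrite insubT; congr (bx _ _); apply: val_inj.
Qed.

Lemma encode_inj : injective encode.
Proof.
move=> u v e; rewrite (surjective_pairing u) (surjective_pairing v); congr pair.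
  by apply/ffunP => q; apply: val_inj; have := encode_mx u q; rewrite e encode_mx.
apply/ffunP => i; rewrite (surjective_pairing (u.2 i)) (surjective_pairing (v.2 i)).
have ea := congr1 (fun w : gamma_array m => w.1.1.2 i) e.
have ec := congr1 (fun w : gamma_array m => w.2 i) e.
by rewrite /= !ffunE in ea ec; congr pair; apply: val_inj.
Qed.

Lemma net_matrix (F : 'M[nat]_m) (f : pairs m -> nat) (i : 'I_m) :
  (forall q, F (src q) (tgt q) = f q) ->
  2 * (m%:Z - i.+1%:Z) + \sum_(r < m | (i < r)%N) (F i r)%:Z
    - \sum_(p < m | (p < i)%N) (F p i)%:Z = net f i.
Proof.
move=> Ff; rewrite /net /excess -(big_src _ i (fun r => (F i r)%:Z)) -(big_tgt _ i (fun p => (F p i)%:Z)).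
rewrite addrA; congr (_ + _ - _).
- by rewrite /lam; have := ltn_ord i; lia.
- by apply: eq_bigr => q /eqP <-; rewrite Ff.
- by apply: eq_bigr => q /eqP <-; rewrite Ff.
Qed.

Hypothesis K_large : (Kmin m 0 <= K)%N.

Lemma gamma_indexP j w : gamma_index m j w <->
  exists2 u, admissible u && (csum u == ordN m + j)%N & w = encode u.
Proof.
split=> [|[u /andP[/forallP ok /eqP cs] ->]]; last first.
  split=> [p r rp|i|i|].
  - by rewrite mxE insubF //= ltnNge rp.
  - by rewrite !ffunE; have /andP[] := ok i; lia.
  - rewrite (@net_matrix _ (bx u.1)) => [|q]; last by rewrite -encode_mx.
    by rewrite !ffunE; have /andP[_ /eqP <-] := ok i.
  - by rewrite -cs; apply: eq_bigr => i _; rewrite ffunE.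
case: w => -[[F a] b] c [F0 abc dE cs].
pose f q := F (src q) (tgt q).
have netf i : net f i = (2 * a i + b i)%N%:Z by rewrite dE (@net_matrix F f).
have fK q : (f q < K.+1)%N.
  rewrite ltnS; apply: leq_trans K_large; rewrite /Kmin.
  by apply: leqW; apply: net_bound => i; rewrite netf.
have am i : (a i < m.+1)%N by have := abc i; lia.
have cm i : (c i < m.+1)%N by have := abc i; lia.
pose u : choices := ([ffun q => Ordinal (fK q)], [ffun i => (Ordinal (am i), Ordinal (cm i))]).
have bxu : bx u.1 = f by apply/funext => q; rewrite /bx ffunE.
exists u.
  apply/andP; split; last by rewrite /csum -cs; apply/eqP; apply: eq_bigr => i _; rewrite ffunE.
  apply/forallP => i; rewrite bxu netf ffunE /ac_ok /=; have := abc i.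
  by move=> abci; apply/andP; split; [lia|apply/eqP; lia].
congr (_, _, _, _).
- apply/matrixP => p r; rewrite mxE; case: insubP => [q _ qE|].
    by rewrite -/(f q) in qE *; rewrite bxu /f /src /tgt qE.
  by rewrite -leqNgt => /F0.
- by apply/ffunP => i; rewrite !ffunE.
- by apply/ffunP => i; rewrite !ffunE /=; have := abc i; lia.
- by apply/ffunP => i; rewrite !ffunE.
Qed.

Let index_seq j : seq (gamma_array m) :=
  [seq encode u | u <- enum {: choices} & admissible u && (csum u == ordN m + j)%N].

Let mem_index_seq j w : gamma_index m j w <-> w \in index_seq j.
Proof.
rewrite gamma_indexP; split=> [[u ok ->]|/mapP[u uin ->]].
  by apply: map_f; rewrite mem_filter ok mem_enum.
by exists u => //; move: uin; rewrite mem_filter => /andP[].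
Qed.

Lemma finite_gamma_index j : finite_set (gamma_index m j).
Proof.
apply/finite_seqP; exists (index_seq j); apply/funext => w; apply/propext => /=.
exact: mem_index_seq.
Qed.

Lemma gamma_weight_encode u : admissible u -> gamma_weight (encode u) = choice_weight u.
Proof.
move=> /forallP ok; rewrite /gamma_weight /encode /choice_weight; congr (_ * _)%N.
  rewrite -(big_pairs _ (fun p r => _ + 1)%N); apply: eq_bigr => q _.
  by rewrite -encode_mx addn1.
apply: eq_bigr => i _; rewrite !ffunE trinomialE //.
by have /andP[] := ok i.
Qed.

Lemma gammaE j : gamma m j =
  \sum_(u | admissible u && (csum u == ordN m + j)%N) choice_weight u.
Proof.
rewrite /gamma (@fsbigE _ _ _ _ _ (index_seq j)); last 3 first.
- by rewrite (map_inj_uniq encode_inj) filter_uniq // enum_uniq.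
- by move=> w /= /mem_index_seq.
- by move=> w /mem_index_seq ->.
rewrite big_map big_filter_cond big_enum_cond /=.
apply: eq_big => [u|u /andP[/andP[+ _] _]].
  case: (boolP (admissible u && _)) => //= ok; apply/mem_set/gamma_indexP.
  by exists u.
exact: gamma_weight_encode.
Qed.

Lemma Lam_gamma (R : comNzRingType) (y : R) : Lam m K (binomial_coef y) =
  y ^+ ordN m * \sum_(0 <= j < (halfe m).+1)
    (gamma m j)%:R * y ^+ j * (1 + y) ^+ (2 * halfe m - 2 * j).
Proof.
rewrite Lam_binomial mulr_sumr big_mkord.
have cs_lt u : admissible u -> (csum u - ordN m < (halfe m).+1)%N.
  by move=> /[dup] /csum_ge cs /sum_b; have := ordN_halfe m; lia.
rewrite (partition_big (fun u => inord (csum u - ordN m) : 'I_(halfe m).+1) xpredT) //=.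
apply: eq_bigr => j _; rewrite gammaE natr_sum !mulr_suml mulr_sumr.
apply: eq_big => [u|u /andP[ok /eqP jE]].
  case: (boolP (admissible u)) => //= ok.
  have cs := csum_ge ok; apply/eqP/eqP => [<-|csE].
    by rewrite inordK ?subnKC // cs_lt.
  by apply: val_inj; rewrite /= inordK ?cs_lt // csE addKn.
have csE : csum u = (ordN m + j)%N.
  by rewrite -jE inordK ?cs_lt // subnKC // csum_ge.
rewrite (_ : \sum_i _ = 2 * halfe m - 2 * j)%N; last first.
  by have := sum_b ok; have := ordN_halfe m; rewrite csE; move: (\sum_i _)%N => b; lia.
by rewrite csE exprD; ring.
Qed.

Lemma gamma_gt0 j : (j <= halfe m)%N -> (0 < gamma m j)%N.
Proof.
(* A term with zero flow is exhibited. For i counted from 0, a_i determines b_i = 2 (m - 1 - i) - 2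
   a_i and c_i = a_i + 2 i + 2 - m; the bounds [lo] and [hi] express c_i >= 0 and b_i >= 0. The c_i
   then sum to m plus the sum of the a_i. *)
move=> je; pose lo (i : 'I_m) := (m - i.*2.+2)%N; pose hi (i : 'I_m) := (m.-1 - i)%N.
have sum_hi : (2 * \sum_i hi i = m * m.-1)%N.
  apply: (can_inj absz_nat); rewrite -sum_lam PoszM (big_morph Posz PoszD (erefl _)) mulr_sumr.
  by apply: eq_bigr => i _; rewrite /lam /hi; lia.
have sum_lo := sum_subn_double m.
have [i||a a_lohi aS] := @sum_between m (ordN m + j - m) lo hi.
- by rewrite /lo /hi; have := ltn_ord i; lia.
- rewrite -/(\sum_i lo i)%N in sum_lo; move: sum_lo sum_hi (ordN_halfe m).
  by rewrite /lo; move: (\sum_i _)%N (\sum_i hi i)%N => x z; case: m je => [|k] /=; nia.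
have am i : (a i < m.+1)%N by have := a_lohi i; rewrite /lo /hi; have := ltn_ord i; lia.
have cm i : (a i - lo i + (i.*2.+2 - m) < m.+1)%N.
  by have := a_lohi i; rewrite /lo /hi; have := ltn_ord i; lia.
pose u : choices := ([ffun=> ord0], [ffun i => (Ordinal (am i),
   inord (a i + i.*2.+2 - m))]).
have cE i : inord (n' := m) (a i + i.*2.+2 - m) = (a i + i.*2.+2 - m)%N :> nat.
  by rewrite inordK //; have := a_lohi i; rewrite /lo /hi; have := ltn_ord i; lia.
have ok i : ac_ok (net (bx u.1) i) (u.2 i).
  have netu : net (bx u.1) i = lam i.
    rewrite /net /excess !big1 ?subr0 ?addr0 // => q _; rewrite /bx ffunE //.
  rewrite netu /ac_ok ffunE /= cE; have := a_lohi i; rewrite /lo /hi /lam.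
  by have := ltn_ord i => im h; apply/andP; split; [lia|apply/eqP; lia].
have u_ok : admissible u by apply/forallP.
rewrite gammaE (bigD1 u) /=; last first.
  rewrite u_ok /=; apply/eqP; have := sum_b u_ok.
  have : (\sum_i (m - (u.2 i).1 - (u.2 i).2) + 2 * \sum_i a i = m * m.-1)%N.
    rewrite -sum_hi !big_distrr -big_split; apply: eq_bigr => i _ /=.
    by rewrite ffunE /= cE; have := a_lohi i; rewrite /lo /hi; have := ltn_ord i; lia.
  rewrite aS; move: (\sum_i _)%N (\sum_i _)%N sum_lo => b x.
  by case: m je => [|k] /=; nia.
rewrite addn_gt0 /choice_weight /wt muln_gt0 !prodn_gt0 // => i.
by have /andP[acm _] := ok i; rewrite /trinomial muln_gt0 !bin_gt0; lia.
Qed.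
End Choices.

End Gamma.

(** * Polynomials without zeros in a half-plane *)

Section HalfPlane.
Variable R : archiRcfType.
Local Notation C := R[i]%C.
Local Notation toC := (real_complex R).
Implicit Types (z r c : C) (p : {poly C}) (s : seq C) (b : R).

Lemma Im_sum (I : Type) (s : seq I) (F : I -> C) :
  complex.Im (\sum_(i <- s) F i) = \sum_(i <- s) complex.Im (F i).
Proof. by apply: (big_morph (@complex.Im R)) => // -[a b] [c d]. Qed.

Lemma Im_inv_lt0 z : 0 < complex.Im z -> complex.Im z^-1 < 0.
Proof.
case: z => a b /= b0; rewrite /= oppr_lt0 divr_gt0 //.
by rewrite ltr_wpDl ?sqr_ge0 // exprn_gt0.
Qed.

(* [z ^ 2 / (z - r) = z + z * r / (z - r)], and the last term has imaginary part
   [(|z| ^ 2 * Im r - |r| ^ 2 * Im z) / |z - r| ^ 2]. *)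
Lemma Im_sqr_div z r : complex.Im r <= 0 -> 0 <= complex.Im z ->
  complex.Im r < complex.Im z ->
  complex.Im (z * (z / (z - r))) <= complex.Im z /\
  (complex.Im z = 0 -> z != 0 -> complex.Im (z * (z / (z - r))) < 0).
Proof.
case: z => x y; case: r => u v /= v0 y0 vy.
set n2 := (x - u) ^+ 2 + (y - v) ^+ 2.
have n20 : 0 < n2 by rewrite ltr_wpDl ?sqr_ge0 // exprn_gt0 // subr_gt0.
set t := (X in _ -> X < 0); set t' := (X in X <= y); have -> : t' = t by [].
have : t = y + ((x ^+ 2 + y ^+ 2) * v - (u ^+ 2 + v ^+ 2) * y) / n2.
  rewrite /t /n2; field; exact: lt0r_neq0.
clearbody t; clearbody n2; move=> ->.
split.
  rewrite gerDl mulr_le0_ge0 ?invr_ge0 ?(ltW n20) // subr_le0.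
  by apply: (@le_trans _ _ 0); [rewrite mulr_ge0_le0|rewrite mulr_ge0] => //; rewrite addr_ge0 ?sqr_ge0.
move=> y00; rewrite y00 eq_complex /= eqxx andbT => x0.
rewrite add0r mulr0 subr0 expr0n addr0 pmulr_llt0 ?invr_gt0 //.
by rewrite pmulr_rlt0 ?exprn_even_gt0 // -y00.
Qed.

Definition below s z := {in s, forall r, complex.Im r <= 0 /\ complex.Im r < complex.Im z}.

Lemma Im_sum_inv s z : below s z -> 
  complex.Im (\sum_(r <- s) (z - r)^-1) <= 0 ?= iff (s == [::]).
Proof.
have lt0 r : complex.Im r < complex.Im z -> complex.Im (z - r)^-1 < 0.
  by move=> rz; apply: Im_inv_lt0; move: rz; case: z r => [x y] [u v] /=; rewrite subr_gt0.
rewrite Im_sum; case: s => [|r s] sz; first by rewrite big_nil; split; rewrite ?eqxx.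
rewrite big_cons; have [|_ /lt0 r0] := sz r; first exact: mem_head.
have s0 : \sum_(r <- s) complex.Im (z - r)^-1 <= 0.
  rewrite big_seq sumr_le0 // => q qs; apply/ltW/lt0.
  by have [|//] := sz q; rewrite inE qs orbT.
have lt : complex.Im (z - r)^-1 + \sum_(r <- s) complex.Im (z - r)^-1 < 0.
  by rewrite -[ltRHS]addr0 ltr_leD.
by split; [exact: ltW|rewrite lt_eqF].
Qed.

(** Against b: after multiplication by z, [Im_sqr_div] bounds the imaginary part by size s * Im z <
    b * Im z, and makes it negative for real z. Against - b: after division by z the left side has
    negative imaginary part, while that of - b / z is nonnegative. *)
Lemma sum_div_neq s z b : below s z -> 0 <= complex.Im z -> (size s)%:R < b ->
  \sum_(r <- s) z / (z - r) != b%:C%C /\ \sum_(r <- s) z / (z - r) != - b%:C%C.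
Proof.
move=> sz z0 sb; have b0 : 0 < b by apply: le_lt_trans sb; rewrite ler0n.
have bC0 : b%:C%C != 0 :> C by rewrite eq_complex /= eqxx andbT lt0r_neq0.
have [->|zn0] := eqVneq z 0.
  rewrite big1 => [|r _]; last by rewrite mul0r.
  by rewrite eq_sym bC0 eq_sym oppr_eq0.
have [->|sn0] := eqVneq s [::].
  by rewrite big_nil eq_sym bC0 eq_sym oppr_eq0.
split; apply/eqP => e.
  have : complex.Im (\sum_(r <- s) z * (z / (z - r))) = b * complex.Im z.
    by rewrite -mulr_sumr e; case: z {sz z0 zn0 e} => x y /=; ring.
  rewrite Im_sum => Im_e.
  have [y0|yn0] := eqVneq (complex.Im z) 0.
    move: Im_e; rewrite y0 mulr0; case: s sn0 sz {sb e} => // r s _ sz; rewrite big_cons.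
    have lt0 q : q \in r :: s -> complex.Im (z * (z / (z - q))) < 0.
      by move=> qs; have [q0 qz] := sz q qs; have [_ ->] := Im_sqr_div q0 z0 qz.
    apply/eqP; rewrite lt_eqF // -[ltRHS]addr0 ltr_leD ?lt0 ?mem_head //.
    by rewrite big_seq sumr_le0 // => q qs; rewrite ltW // lt0 // inE qs orbT.
  have : \sum_(r <- s) complex.Im (z * (z / (z - r))) <= (size s)%:R * complex.Im z.
    rewrite mulr_natl (_ : complex.Im z *+ size s = \sum_(r <- s) complex.Im z); last first.
      by rewrite big_const_seq count_predT iter_addr_0.
    rewrite big_seq [leRHS]big_seq ler_sum // => q qs; have [q0 qz] := sz q qs.
    by have [] := Im_sqr_div q0 z0 qz.
  by rewrite Im_e ler_pM2r ?lt_neqAle 1?eq_sym ?yn0 // leNgt sb.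
have : complex.Im (\sum_(r <- s) (z - r)^-1) = complex.Im (- (b%:C%C / z)).
  by rewrite -mulNr -e mulr_suml; congr complex.Im; apply: eq_bigr => r _; rewrite mulrAC mulfV ?mul1r.
have := Im_sum_inv sz; rewrite (negPf sn0) => /leifP => lt0 eq; move: lt0; rewrite eq.
apply/negP; rewrite -leNgt; case: z z0 {zn0 sz e eq} => x y /= y0.
rewrite mul0r addr0 mulrN opprK mulr_ge0 ?(ltW b0) // divr_ge0 ?addr_ge0 ?sqr_ge0 //.
Qed.

Lemma horner_deriv_roots s z : z \notin s ->
  (\prod_(r <- s) ('X - r%:P))^`().[z] =
  (\prod_(r <- s) ('X - r%:P)).[z] * \sum_(r <- s) (z - r)^-1.
Proof.
elim: s => [|r s IH]; first by rewrite !big_nil mulr0 -[1]/(1%:P) derivC horner0.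
rewrite inE negb_or => /andP[zr /IH e]; rewrite !big_cons derivM derivXsubC mul1r.
rewrite hornerD !hornerM e hornerXsubC mulrDr mulrAC mulfV ?mul1r ?subr_eq0 //.
by rewrite mulrA.
Qed.

(** The Euler operator: theta p / p is the sum of the z / (z - r) studied in [sum_div_neq]. *)
Definition theta p : {poly C} := 'X * p^`().

Lemma coef_theta p j : (theta p)`_j = j%:R * p`_j.
Proof. by rewrite coefXM coef_deriv; case: j => [|j]; rewrite ?mul0r // mulr_natl. Qed.

Lemma theta_neq0 p z b : p != 0 -> (size p)%:R <= b -> 0 <= complex.Im z ->
  (forall r, root p r -> complex.Im r <= 0 /\ complex.Im r < complex.Im z) ->
  (b%:C%C *: p - theta p).[z] != 0 /\ (b%:C%C *: p + theta p).[z] != 0.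
Proof.
move=> p0 pb z0 pz; have [s ps] := closed_field_poly_normal p.
have c0 : lead_coef p != 0 by rewrite lead_coef_eq0.
have sz : below s z.
  move=> r rs; apply: pz; rewrite ps rootZ // root_prod_XsubC //.
have zs : z \notin s by apply/negP => /sz [_]; rewrite ltxx.
have ss : (size s)%:R < b.
  by apply: lt_le_trans pb; rewrite ps size_scale // size_prod_XsubC ltr_nat.
have [n1 n2] := sum_div_neq sz z0 ss.
have q0 : (\prod_(r <- s) ('X - r%:P)).[z] != 0.
  by rewrite -rootE root_prod_XsubC.
have thE : (theta p).[z] = p.[z] * \sum_(r <- s) z / (z - r).
  rewrite -mulr_sumr /theta hornerM hornerX ps derivZ !hornerZ horner_deriv_roots //.
  by ring.
have pz0 : p.[z] != 0 by rewrite ps hornerZ mulf_neq0.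
rewrite hornerD hornerN hornerD hornerZ thE ![_%:C%C * _]mulrC -mulrBr -mulrDr !mulf_neq0 //.
  by rewrite addrC -[X in _ + X]opprK subr_eq0.
by rewrite subr_eq0 eq_sym.
Qed.

(** Both versions are needed: the closed one allows evaluation at 0 and puts the roots strictly
    below the axis, the open one survives limits. *)
Definition open_stable p := forall z, 0 < complex.Im z -> p.[z] != 0.
Definition closed_stable p := forall z, 0 <= complex.Im z -> p.[z] != 0.

Lemma open_stable_neq0 p : open_stable p -> p != 0.
Proof. by move=> /(_ (Complex 0 1)) h; apply: contraTneq (h ltr01) => ->; rewrite horner0 eqxx. Qed.

Lemma closed_open p : closed_stable p -> open_stable p.
Proof. by move=> ps z /ltW /ps. Qed.

Lemma open_root p r : open_stable p -> root p r -> complex.Im r <= 0.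
Proof. by move=> ps; apply: contraTT; rewrite -ltNge => /ps; rewrite rootE. Qed.

Lemma closed_root p r : closed_stable p -> root p r -> complex.Im r < 0.
Proof. by move=> ps; apply: contraTT; rewrite -leNgt => /ps; rewrite rootE. Qed.

Lemma closed_below p z r : closed_stable p -> 0 <= complex.Im z -> root p r ->
  complex.Im r <= 0 /\ complex.Im r < complex.Im z.
Proof.
by move=> ps z0 /(closed_root ps) r0; split; [exact: ltW|exact: lt_le_trans z0].
Qed.

Lemma open_below p z r : open_stable p -> 0 < complex.Im z -> root p r ->
  complex.Im r <= 0 /\ complex.Im r < complex.Im z.
Proof. by move=> ps z0 /(open_root ps) r0; split; [|exact: le_lt_trans z0]. Qed.

(* Gauss-Lucas: [p' / p] is the sum of the [1 / (z - r)], which have negative imaginary part. *)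
Lemma deriv_neq0 p z : (1 < size p)%N ->
  (forall r, root p r -> complex.Im r <= 0 /\ complex.Im r < complex.Im z) -> p^`().[z] != 0.
Proof.
move=> p1 pz; have [s psE] := closed_field_poly_normal p.
have c0 : lead_coef p != 0 by rewrite lead_coef_eq0 -size_poly_gt0 ltnW.
have sz : below s z by move=> r rs; apply: pz; rewrite psE rootZ // root_prod_XsubC.
have zs : z \notin s by apply/negP => /sz [_]; rewrite ltxx.
have sn0 : s == [::] = false.
  by case: s psE {sz zs} p1 => // ->; rewrite big_nil size_scale // size_poly1.
rewrite psE derivZ hornerZ horner_deriv_roots // !mulf_neq0 //.
  by rewrite -rootE root_prod_XsubC.
have := Im_sum_inv sz; rewrite sn0 => /leifP; apply: contraTneq => ->.
by rewrite ltxx.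
Qed.

Lemma closed_deriv p : closed_stable p -> (1 < size p)%N -> closed_stable p^`().
Proof. by move=> ps p1 z z0; apply: deriv_neq0 => // r; apply: closed_below. Qed.

Lemma open_deriv p : open_stable p -> (1 < size p)%N -> open_stable p^`().
Proof. by move=> ps p1 z z0; apply: deriv_neq0 => // r; apply: open_below. Qed.

(** For B = b ^ 2 this is (1 - theta / b) (1 + theta / b), two factors to which [theta_neq0]
    applies. *)
Definition dilate (B : R) p : {poly C} := \poly_(j < size p) ((1 - (j ^ 2)%:R / B)%:C%C * p`_j).

Lemma coef_dilate B p j : (dilate B p)`_j = (1 - (j ^ 2)%:R / B)%:C%C * p`_j.
Proof. by rewrite coef_poly; case: ltnP => // pj; rewrite nth_default // mulr0. Qed.

Lemma dilateE b p : b != 0 -> dilate (b ^+ 2) p =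
  (b ^- 2)%:C%C *: (b%:C%C *: (b%:C%C *: p + theta p) - theta (b%:C%C *: p + theta p)).
Proof.
move=> b0; apply/polyP => j.
rewrite coef_dilate coefZ coefB coefZ coef_theta !coefD !coefZ coef_theta.
have -> : (1 - (j ^ 2)%:R / b ^+ 2)%:C%C = (b ^- 2)%:C%C * (b%:C%C ^+ 2 - j%:R ^+ 2) :> C.
  rewrite -(rmorph_nat toC) -!(rmorphXn toC).
  rewrite -(rmorphB toC) -(rmorphM toC).
  by congr (_%:C)%C; rewrite natrX; field.
by ring.
Qed.

Lemma size_theta_add p b : b != 0 -> (size (b%:C%C *: p + theta p)%R <= size p)%N.
Proof.
move=> b0; apply/leq_sizeP => j pj; rewrite coefD coefZ coef_theta nth_default //.
by rewrite !mulr0 addr0.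
Qed.

Lemma dilate_neq0 p b z : p != 0 -> b%:C%C *: p + theta p != 0 ->
  (size p)%:R <= b -> 0 < b -> 0 <= complex.Im z ->
  (forall r, root (b%:C%C *: p + theta p) r -> complex.Im r <= 0 /\ complex.Im r < complex.Im z) ->
  (dilate (b ^+ 2) p).[z] != 0.
Proof.
move=> p0 q0 pb b0 z0 qz; have bn0 := lt0r_neq0 b0.
rewrite dilateE // hornerZ mulf_neq0 //.
  by rewrite eq_complex /= eqxx andbT invr_eq0 expf_neq0.
have qb : (size (b%:C%C *: p + theta p))%:R <= b.
  by apply: le_trans pb; rewrite ler_nat size_theta_add.
by have [] := theta_neq0 q0 qb z0 qz.
Qed.

Lemma closed_dilate p b : closed_stable p -> (size p)%:R <= b -> 0 < b ->
  closed_stable (dilate (b ^+ 2) p).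
Proof.
move=> ps pb b0; have p0 := open_stable_neq0 (closed_open ps).
have qs : closed_stable (b%:C%C *: p + theta p).
  by move=> z z0; have [r /(closed_below ps z0)|] := theta_neq0 p0 pb z0.
move=> z z0; apply: dilate_neq0 => // [|r]; last exact: closed_below.
exact/open_stable_neq0/closed_open.
Qed.

Lemma open_dilate p b : open_stable p -> (size p)%:R <= b -> 0 < b ->
  open_stable (dilate (b ^+ 2) p).
Proof.
move=> ps pb b0; have p0 := open_stable_neq0 ps.
have qs : open_stable (b%:C%C *: p + theta p).
  by move=> z z0; have [r /(open_below ps z0)|] := theta_neq0 p0 pb (ltW z0).
move=> z z0; apply: dilate_neq0 => // [||r]; [exact: open_stable_neq0|exact: ltW|].
exact: open_below.
Qed.

End HalfPlane.

(** * Limits of stable polynomials and Gaussian multipliers *)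

Section Limits.
Variable R : archiRcfType.
Local Notation C := R[i]%C.
Local Notation normc := (@Normc.normc R).
Implicit Types (z r c : C) (p : {poly C}).

Lemma normc_sum (I : Type) (s : seq I) (F : I -> C) :
  normc (\sum_(i <- s) F i) <= \sum_(i <- s) normc (F i).
Proof.
elim: s => [|i s IH]; first by rewrite !big_nil Normc.normc0.
by rewrite !big_cons (le_trans (le_normcD _ _)) // lerD2l.
Qed.

Lemma normc_ge0 z : 0 <= normc z.
Proof. by case: z => a b; apply: sqrtr_ge0. Qed.

Lemma normcX z k : normc (z ^+ k) = normc z ^+ k.
Proof. by elim: k => [|k IH]; rewrite ?Normc.normc1 // !exprS Normc.normcM IH. Qed.

Lemma normcR (x : R) : normc x%:C%C = `|x|.
Proof. by rewrite /= expr0n addr0 sqrtr_sqr. Qed.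

Lemma normc_gt0 z : (0 < normc z) = (z != 0).
Proof.
rewrite lt_neqAle normc_ge0 andbT eq_sym; congr negb.
by apply/eqP/eqP => [/Normc.eq0_normc|->] //; rewrite Normc.normc0.
Qed.

Lemma Im_le_normc z : complex.Im z <= normc z.
Proof.
case: z => a b /=; apply: le_trans (ler_norm b) _.
by rewrite -sqrtr_sqr ler_wsqrtr // lerDr sqr_ge0.
Qed.

(** Every root r has Im r <= 0, so the norm of z - r is at least Im z. *)
Lemma open_stable_bound p z : open_stable p -> 0 < complex.Im z ->
  normc (lead_coef p) * complex.Im z ^+ (size p).-1 <= normc p.[z].
Proof.
move=> ps z0; have [s psE] := closed_field_poly_normal p.
have c0 : lead_coef p != 0 by rewrite lead_coef_eq0 open_stable_neq0.
have s_le : forall r, r \in s -> complex.Im r <= 0.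
  by move=> r rs; apply: (open_root ps); rewrite psE rootZ // root_prod_XsubC.
rewrite {2 3}psE size_scale // size_prod_XsubC hornerZ Normc.normcM ler_wpM2l ?normc_ge0 //=.
elim: s s_le {psE} => [|r s IH] s_le; first by rewrite big_nil hornerC Normc.normc1 expr0.
rewrite big_cons hornerM hornerXsubC Normc.normcM exprS ler_pM ?exprn_ge0 ?(ltW z0) //.
  apply: le_trans (Im_le_normc _); have := s_le r (mem_head _ _).
  by case: z {z0 IH} => x y; case: r {s_le} => u v /=; rewrite lerBrDr gerDl.
by apply: IH => q qs; apply: s_le; rewrite inE qs orbT.
Qed.

(** Hurwitz's theorem for coefficientwise limits of bounded degree: leading coefficients stay away
    from 0, so [open_stable_bound] keeps the values at z away from 0 uniformly. *)
Lemma open_stable_limit p : p != 0 ->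
  (forall d : R, 0 < d -> exists p', [/\ (size p' <= size p)%N,
     forall j, normc (p'`_j - p`_j) <= d & open_stable p']) -> open_stable p.
Proof.
move=> p0 lim z z0; apply/eqP => pz.
set y := complex.Im z in z0 *; set L := normc (lead_coef p).
have L0 : 0 < L by rewrite normc_gt0 lead_coef_eq0.
set S := \sum_(j < size p) normc z ^+ j.
have S0 : 0 <= S by apply: sumr_ge0 => j _; rewrite exprn_ge0 // normc_ge0.
set t := y ^+ (size p).-1; have t0 : 0 < t by rewrite exprn_gt0.
have St : 0 < S + t by rewrite ltr_wpDl.
(* Chosen so that d <= L / 2, which preserves the degree, and d * S < L / 2 * t, which contradicts
   the lower bound at z. *)
pose d := L / 2 * (t / (S + t)); have d0 : 0 < d by rewrite !mulr_gt0 ?invr_gt0.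
have dL : d <= L / 2.
  by rewrite ger_pMr ?divr_gt0 // ler_pdivrMr // mul1r lerDr.
have [p' [sz cf st]] := lim d d0.
have Lp' : L / 2 <= normc (p'`_(size p).-1).
  have := le_normcD (p'`_(size p).-1) (- (p'`_(size p).-1 - p`_(size p).-1)).
  rewrite normcN opprB subrKC -[p`_ _]/(lead_coef p) -/L; have := cf (size p).-1; lra.
have szE : size p' = size p.
  apply/eqP; rewrite eqn_leq sz /= leqNgt; apply/negP => lt.
  move: Lp'; rewrite nth_default ?Normc.normc0; first by lra.
  by rewrite -ltnS prednK // (leq_trans _ lt).
have low := open_stable_bound st z0.
have up : normc p'.[z] <= d * S.
  have -> : p'.[z] = \sum_(j < size p) (p'`_j - p`_j) * z ^+ j.
    rewrite -[LHS]subr0 -[X in _ - X]pz [in LHS](@horner_coef_wide _ (size p)) //.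
    by rewrite horner_coef -sumrB; apply: eq_bigr => j _; rewrite mulrBl.
  apply: le_trans (normc_sum _ _) _; rewrite mulr_sumr; apply: ler_sum => j _.
  by rewrite Normc.normcM normcX ler_wpM2r ?exprn_ge0 ?normc_ge0.
have : L / 2 * t <= d * S.
  apply: le_trans up; apply: le_trans low; rewrite szE -/y -/t ler_wpM2r ?(ltW t0) //.
  by rewrite lead_coefE szE.
apply/negP; rewrite -ltNge /d -!mulrA ltr_pM2l // ltr_pM2l ?invr_gt0 // gtr_pMr //.
by rewrite mulrC ltr_pdivrMr // mul1r ltrDl.
Qed.

Lemma exp_le_second_order (x : R) k : 0 <= x <= 1 ->
  (1 - x) ^+ k <= 1 - k%:R * x + k%:R ^+ 2 * x ^+ 2.
Proof.
move=> /andP[x0 x1]; elim: k => [|k IH]; first by rewrite expr0; lra.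
have k0 : 0 <= k%:R :> R by rewrite ler0n.
rewrite exprS; apply: le_trans (ler_wpM2l _ IH) _; first by rewrite subr_ge0.
rewrite -natr1 -subr_ge0.
rewrite (_ : _ - _ = k%:R * x ^+ 2 + x ^+ 2 + k%:R ^+ 2 * x ^+ 3); last by ring.
by rewrite !addr_ge0 ?mulr_ge0 ?exprn_ge0.
Qed.

Lemma bernoulli (x : R) k : -1 <= x -> 1 + k%:R * x <= (1 + x) ^+ k.
Proof.
move=> x1; elim: k => [|k IH]; first by rewrite expr0 mul0r addr0.
have k0 : 0 <= k%:R :> R by rewrite ler0n.
rewrite exprS; apply: le_trans (ler_wpM2l _ IH); last by lra.
by rewrite -natr1; nra.
Qed.

Lemma expB_le (u w : R) k : 0 <= u <= 1 -> 0 <= w <= 1 ->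
  `|u ^+ k - w ^+ k| <= k%:R * `|u - w|.
Proof.
move=> /andP[u0 u1] /andP[w0 w1]; elim: k => [|k IH]; first by rewrite subrr normr0 mul0r.
rewrite !exprS (_ : _ - _ = u * (u ^+ k - w ^+ k) + (u - w) * w ^+ k); last by ring.
apply: le_trans (ler_normD _ _) _; rewrite !normrM -natr1 mulrDl mul1r lerD //.
  apply: le_trans IH; rewrite ger0_norm // -[leRHS]mul1r ler_wpM2r //.
by rewrite ler_piMr // ger0_norm ?exprn_ge0 // exprn_ile1.
Qed.

(** Exponents are powers of 2 because only square roots have to be extracted. *)
Lemma exists_root2 (q : R) s : 0 < q < 1 ->
  exists2 x : R, 0 < x < 1 & (1 - x) ^+ (2 ^ s) = q.
Proof.
move=> q01; elim: s => [|s [x /andP[x0 x1] xq]].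
  by exists (1 - q); [lra|rewrite expr1; ring].
exists (1 - Num.sqrt (1 - x)).
  rewrite subr_gt0 gtrBl sqrtr_gt0 subr_gt0 x1 andbT.
  by rewrite -[ltRHS]sqrtr1 ltr_sqrt //; lra.
by rewrite opprB addrC subrK expnS exprM sqr_sqrtr // subr_ge0 ltW.
Qed.

(** Take (1 - x) ^ r = q and b ^ -2 = x. Then 1 - j ^ 2 x and (1 - x) ^ (j ^ 2) differ by O(x ^ 2),
    so their r-th powers differ by O(r x ^ 2), which is O(1 / r) because r x stays bounded. *)
Lemma gauss_approx (q d : R) (n : nat) : 0 < q < 1 -> 0 < d ->
  exists (r : nat) (b : R), [/\ n%:R <= b, 0 < b &
    forall j, (j < n)%N -> `|(1 - (j ^ 2)%:R / b ^+ 2) ^+ r - q ^+ (j ^ 2)| <= d].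
Proof.
move=> q01 d0; have /andP[q0 q1] := q01.
(* This bounds r x: Bernoulli's inequality gives (1 + r x) (1 - x) ^ r <= 1. *)
pose c := q^-1 - 1; have c0 : 0 < c by rewrite subr_gt0 invf_gt1.
pose N : R := n%:R; have N0 : 0 <= N by rewrite ler0n.
pose s := Num.bound (c * N ^+ 2 + N ^+ 4 * c ^+ 2 / d).
have big0 : 0 <= c * N ^+ 2 + N ^+ 4 * c ^+ 2 / d.
  by rewrite addr_ge0 ?mulr_ge0 ?invr_ge0 ?exprn_ge0 ?(ltW c0) ?(ltW d0).
have sP : c * N ^+ 2 + N ^+ 4 * c ^+ 2 / d <= (2 ^ s)%:R.
  apply: (@le_trans _ _ s%:R); last by rewrite ler_nat ltnW // ltn_expl.
  by apply: ltW; have := archi_boundP big0; rewrite /s.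
have [x x01 xq] := exists_root2 s q01; have /andP[x0 x1] := x01.
set r := (2 ^ s)%N in sP xq *.
have r0 : 0 < r%:R :> R by rewrite ltr0n expn_gt0.
have rx : r%:R * x <= c.
  have : (1 + r%:R * x) * q <= 1.
    rewrite -xq; apply: le_trans (ler_wpM2r _ (bernoulli r _)) _; [|lra|].
      by rewrite exprn_ge0 //; lra.
    by rewrite -exprMn exprn_ile1 //; nra.
  by rewrite -ler_pdivlMr // div1r /c; lra.
have part1 : c * N ^+ 2 <= r%:R.
  by apply: le_trans sP; rewrite lerDl ?mulr_ge0 ?invr_ge0 ?exprn_ge0 ?(ltW c0) ?(ltW d0).
have part2 : N ^+ 4 * c ^+ 2 <= d * r%:R.
  rewrite [d * _]mulrC -ler_pdivrMr //; apply: le_trans sP.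
  by rewrite lerDr mulr_ge0 ?exprn_ge0 ?(ltW c0).
have Nx : N ^+ 2 * x <= 1.
  rewrite -(ler_pM2l r0) mulr1 mulrCA; apply: le_trans part1.
  by rewrite [c * _]mulrC ler_wpM2l ?exprn_ge0.
exists r, (Num.sqrt x^-1); have sx : Num.sqrt x^-1 ^+ 2 = x^-1 by rewrite sqr_sqrtr // invr_ge0 ltW.
split.
- rewrite -[leLHS](ger0_norm N0) -sqrtr_sqr ler_wsqrtr //.
  by rewrite -[leRHS]mul1r ler_pdivlMr.
- by rewrite sqrtr_gt0 invr_gt0.
move=> j jn; rewrite sx invrK -xq -exprM mulnC exprM.
set k := (j ^ 2)%N; have kN : k%:R <= N ^+ 2 by rewrite /N -natrX ler_nat leq_exp2r // ltnW.
have k0 : 0 <= k%:R :> R by rewrite ler0n.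
have kx : k%:R * x <= 1 by apply: le_trans Nx; rewrite ler_wpM2r // ltW.
have w01 : 0 <= (1 - x) ^+ k <= 1 by rewrite exprn_ge0 ?exprn_ile1 //; lra.
apply: le_trans (expB_le r _ w01) _.
  by rewrite subr_ge0 kx gerBl mulr_ge0 // ltW.
have e1 : `|1 - k%:R * x - (1 - x) ^+ k| <= N ^+ 4 * x ^+ 2.
  rewrite distrC ger0_norm; last first.
    by rewrite subr_ge0; have := @bernoulli (- x) k; rewrite mulrN; apply; lra.
  have := @exp_le_second_order x k; rewrite (ltW x0) (ltW x1) => /(_ isT).
  have : k%:R ^+ 2 * x ^+ 2 <= N ^+ 4 * x ^+ 2.
    have -> : N ^+ 4 = (N ^+ 2) ^+ 2 by rewrite -exprM.
    rewrite ler_wpM2r ?exprn_ge0 ?(ltW x0) //.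
    by rewrite ler_pXn2r ?nnegrE ?exprn_ge0.
  by lra.
apply: le_trans (ler_wpM2l (ltW r0) e1) _; rewrite -(ler_pM2l r0).
apply: (@le_trans _ _ (N ^+ 4 * c ^+ 2)); last by rewrite [r%:R * d]mulrC.
have -> : r%:R * (r%:R * (N ^+ 4 * x ^+ 2)) = N ^+ 4 * (r%:R * x) ^+ 2.
  by move: (N) (r%:R : R) => N' r'; ring.
by rewrite ler_wpM2l ?exprn_ge0 // ler_pXn2r ?nnegrE ?mulr_ge0 ?(ltW c0) ?(ltW x0) ?(ltW r0).
Qed.

Definition gauss (q : R) p : {poly C} := \poly_(j < size p) ((q ^+ (j ^ 2))%:C%C * p`_j).

Lemma coef_gauss q p j : (gauss q p)`_j = (q ^+ (j ^ 2))%:C%C * p`_j.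
Proof. by rewrite coef_poly; case: ltnP => // pj; rewrite nth_default // mulr0. Qed.

Lemma coef_iter_dilate B p k j :
  (iter k (dilate B) p)`_j = ((1 - (j ^ 2)%:R / B) ^+ k)%:C%C * p`_j.
Proof.
elim: k => [|k IH]; first by rewrite expr0 mul1r.
by rewrite iterS coef_dilate IH exprS mulrA -rmorphM.
Qed.

Lemma size_iter_dilate B p k : (size (iter k (dilate B) p) <= size p)%N.
Proof.
by apply/leq_sizeP => j pj; rewrite coef_iter_dilate nth_default // mulr0.
Qed.

Lemma open_gauss q p : 0 < q < 1 -> open_stable p -> open_stable (gauss q p).
Proof.
move=> q01 ps; have p0 := open_stable_neq0 ps.
have szg : size (gauss q p) = size p.
  apply: size_poly_eq; rewrite mulf_neq0 ?lead_coef_eq0 //.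
  by rewrite eq_complex /= eqxx andbT expf_neq0 // lt0r_neq0 //; case/andP: q01.
apply: open_stable_limit; first by rewrite -size_poly_gt0 szg size_poly_gt0.
move=> d d0; pose S := 1 + \sum_(j < size p) normc p`_j.
have S0 : 0 < S by rewrite ltr_wpDr // sumr_ge0 // => j _; apply: normc_ge0.
have [r [b [nb b0 ab]]] := gauss_approx (size p) q01 (divr_gt0 d0 S0).
exists (iter r (dilate (b ^+ 2)) p); split.
- by rewrite szg size_iter_dilate.
- move=> j; rewrite coef_iter_dilate coef_gauss -mulrBl -rmorphB Normc.normcM.
  have [jp|jp] := ltnP j (size p); last by rewrite nth_default // Normc.normc0 mulr0 ltW.
  rewrite [normc _%:C%C]normcR; apply: le_trans (ler_wpM2r (normc_ge0 _) (ab j jp)) _.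
  rewrite mulrAC ler_pdivrMr // ler_pM2l // /S (bigD1 (Ordinal jp)) //=.
  by rewrite addrCA lerDl addr_ge0 // sumr_ge0 // => i _; apply: normc_ge0.
elim: r {ab} => [|r IH]; first exact: ps.
rewrite iterS; apply: open_dilate => //.
by apply: le_trans nb; rewrite ler_nat size_iter_dilate.
Qed.

End Limits.

(** * Stable flows *)

Section Configurations.
Variables (m M : nat).
Local Notation cfg := {ffun 'I_m -> {ffun 'I_M -> bool}}.
Implicit Types (S : cfg) (i j : 'I_m) (k : 'I_M) (f : pairs m -> nat).

(** A configuration selects, at each vertex [i], the factors of \prod_k (w + z_k) that contribute
    z_k instead of w: [rsum] is the number of those at [i], and [csize] the resulting exponent of
    z_k. *)
Definition rsum S i : nat := \sum_k S i k.
Definition csize S k : nat := \sum_i S i k.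
(** Eigenvalue of \sum_k (z_k d/dz_k) ^ 2 on the monomial of [S]. *)
Definition omega S : nat := \sum_k csize S k ^ 2.
Definition inter i j S : nat := \sum_k (S i k && S j k).

Definition fits f S : bool := [forall i, (rsum S i)%:Z + net f i == M%:Z].

(** Exchanges the choices made for z_k at two vertices, which leaves the monomial unchanged. *)
Definition swp i j k S : cfg := [ffun a => [ffun b => S (if b == k then tperm i j a else a) b]].

Lemma swpK i j k : involutive (swp i j k).
Proof.
move=> S; apply/ffunP => a; apply/ffunP => b; rewrite !ffunE.
by case: (b == k); rewrite ?tpermK.
Qed.

Lemma csize_swp i j k S : csize (swp i j k S) = csize S.
Proof.
apply/funext => b; rewrite /csize; under eq_bigr => a _ do rewrite !ffunE.
by case: (b == k) => //; rewrite [RHS](reindex_inj (@perm_inj _ (tperm i j))).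
Qed.

Lemma rsum_swp i j k S a : (rsum (swp i j k S) a + S a k = rsum S a + S (tperm i j a) k)%N.
Proof.
rewrite /rsum [X in (X + _ = _)%N](bigD1 k) //= [X in (_ = X + _)%N](bigD1 k) //= !ffunE eqxx.
rewrite (eq_bigr (fun b => S a b : nat)) => [|b /negPf bk]; last by rewrite !ffunE bk.
by rewrite addnC addnA addnAC.
Qed.

Lemma rsum_inter i j S : (\sum_k (S i k && ~~ S j k) + inter i j S = rsum S i)%N.
Proof.
by rewrite /inter /rsum -big_split; apply: eq_bigr => k _; case: (S i k) (S j k) => [] [].
Qed.

Lemma interC i j S : inter i j S = inter j i S.
Proof. by apply: eq_bigr => k _; rewrite andbC. Qed.

Lemma rsum_le S i : (rsum S i <= M)%N.
Proof.
rewrite -[leqRHS](card_ord M) -sum1_card; apply: leq_sum => k _.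
exact: leq_b1.
Qed.

Lemma sqr_sum_bool (b : 'I_m -> bool) :
  ((\sum_i b i) ^ 2 = \sum_i b i + 2 * \sum_p (b (src p) && b (tgt p)))%N.
Proof.
rewrite (big_pairs _ (fun i j => nat_of_bool (b i && b j))).
have -> : ((\sum_i b i) ^ 2 = \sum_i \sum_j (b i && b j))%N.
  rewrite -mulnn big_distrlr; apply: eq_bigr => i _; apply: eq_bigr => j _.
  by case: (b i) (b j) => [] [].
pose F (i j : 'I_m) : nat := b i && b j.
transitivity (\sum_(i < m) (b i + (\sum_(j < m | (i < j)%N) F i j + \sum_(j < m | (j < i)%N) F i j)))%N.
  apply: eq_bigr => i _; rewrite (bigD1 i) //= andbb; congr (_ + _)%N.
  rewrite (bigID (fun j : 'I_m => (i < j)%N)) /=; congr (_ + _)%N; apply: eq_bigl => j.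
    by case: ltngtP (eqVneq j i) => [ij|ij|ij] [e|e] //=; try (by rewrite e ltnn in ij); rewrite ?andbF.
  rewrite -leqNgt leq_eqVlt; case: (eqVneq j i) => [->|ji] /=; first by rewrite ltnn.
  by rewrite (_ : (j : nat) == i = false) //; apply/negbTE.
rewrite big_split /= mul2n -addnn big_split /=; congr (_ + (_ + _))%N.
rewrite (exchange_big_dep xpredT) //=; apply: eq_bigr => i _; apply: eq_bigr => j _.
by rewrite /F andbC.
Qed.

Lemma omegaE S : (omega S = \sum_i rsum S i + 2 * \sum_p inter (src p) (tgt p) S)%N.
Proof.
rewrite /omega; under eq_bigr => k _ do rewrite sqr_sum_bool.
rewrite big_split /= -big_distrr /= exchange_big; congr (_ + 2 * _)%N.
exact: exchange_big.
Qed.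

Section Valuation.
Variables (V : comNzRingType) (chi : cfg -> V).
Hypothesis chi_swp : forall i j k S, chi (swp i j k S) = chi S.

Definition evx f : V := \sum_(S | fits f S) chi S.
Definition evi i j f : V := \sum_(S | fits f S) (inter i j S)%:R * chi S.

(* Double counting of the pairs [(S, k)] with [k] in row [src p] of [S] but not in row [tgt p]. *)
Lemma move_count f f' p : 
  (forall a, net f' a = net f a + (a == src p)%:R - (a == tgt p)%:R) ->
  \sum_(S | fits f S) \sum_(k | S (src p) k && ~~ S (tgt p) k) chi S =
  \sum_(S | fits f' S) \sum_(k | S (tgt p) k && ~~ S (src p) k) chi S.
Proof.
move=> netf; rewrite (exchange_big_dep xpredT) //= [RHS](exchange_big_dep xpredT) //=.
apply: eq_bigr => k _; rewrite [RHS](reindex_inj (inv_inj (swpK (src p) (tgt p) k))).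
apply: eq_big => [S|S _]; last by rewrite chi_swp.
rewrite !ffunE eqxx tpermL tpermR; case: (boolP (S (src p) k && ~~ S (tgt p) k)); rewrite ?andbF ?andbT //.
move=> /andP[Sp Sn]; apply: eq_forallb => a; rewrite netf.
have := rsum_swp (src p) (tgt p) k S a; case: tpermP => [->|->|/eqP/negPf -> /eqP/negPf ->].
- by rewrite Sp (negPf Sn) eqxx src_neq_tgt /= => h; apply/eqP/eqP; lia.
- by rewrite Sp (negPf Sn) eqxx [tgt p == src p]eq_sym src_neq_tgt /= => h; apply/eqP/eqP; lia.
- by move=> h; apply/eqP/eqP; lia.
Qed.

(** By [rsum_inter], a row of a fitting configuration has M - net - inter entries outside the other
    row; [move_count] thus becomes a recursion for [evi] along the pair. *)
Lemma move_step f f' p :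
  (forall a, net f' a = net f a + (a == src p)%:R - (a == tgt p)%:R) ->
  (M%:Z - net f (src p))%:~R * evx f - evi (src p) (tgt p) f =
  (M%:Z - net f' (tgt p))%:~R * evx f' - evi (src p) (tgt p) f'.
Proof.
move=> netf.
have count i j f0 : (M%:Z - net f0 i)%:~R * evx f0 - evi i j f0 =
    \sum_(S | fits f0 S) \sum_(k | S i k && ~~ S j k) chi S.
  rewrite mulr_sumr -sumrB; apply: eq_bigr => S /forallP/(_ i)/eqP fS.
  rewrite -mulrBl sumr_const -[RHS]mulr_natl; congr (_ * _).
  rewrite (_ : M%:Z - net f0 i = (rsum S i)%:Z); last by lia.
  rewrite -(rsum_inter i j) -pmulrn natrD addrK -sum1_card [in RHS]big_mkcond; congr (_%:R).
have := move_count netf; rewrite -!count => ->; congr (_ - _).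
by apply: eq_bigr => S _; rewrite interC.
Qed.

End Valuation.

Section Box.
Variables (K : nat) (V : comNzRingType).
Hypothesis K_large : (Kmin m 0 <= K)%N.
Local Notation box := {ffun pairs m -> 'I_K.+1}.
Implicit Types (g : box) (F : box -> V).

Lemma fits_out g p S : (K <= g p)%N -> fits (bx g) S = false.
Proof.
move=> Kg; have [i neti] := net_out_of_box (f := bx g) K_large Kg.
by apply/negbTE/negP => /forallP/(_ i); have := rsum_le S i; lia.
Qed.

Definition valx (chi : cfg -> V) F : V := \sum_g F g * evx chi (bx g).

(* The action on flows of the Euler-type operator [\sum_k (z_k d/dz_k) ^ 2]; see [valx_Theta]. *)
Definition Theta F g : V :=
  (\sum_(i < m) (1 + 2 * (m.-1 - i)%N%:Z) * (M%:Z - net (bx g) i))%:~R * F g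
  - 2%:R * \sum_p (net (bx g) (src p) - net (bx g) (tgt p))%:~R * \sum_(v : 'I_K.+1 | (v < g p)%N) F (upd g p v).

(** The transpose of a sum over larger flows is a sum over smaller ones, by the involution
    exchanging the old and the new value on [p]. *)
Lemma sum_upd_swap p (F X : box -> V) :
  \sum_(g : box) \sum_(v : 'I_K.+1 | (g p < v)%N) F g * X (upd g p v) =
  \sum_(g : box) \sum_(v : 'I_K.+1 | (v < g p)%N) F (upd g p v) * X g.
Proof.
rewrite !pair_big_dep /=; pose h (gv : box * 'I_K.+1) := (upd gv.1 p gv.2, gv.1 p).
have hK : involutive h.
  by move=> [g v]; rewrite /h /= upd_upd updE upd_id.
rewrite [RHS](reindex_inj (inv_inj hK)) /h /=.
by apply: eq_big => -[g v] /=; rewrite ?updE // upd_upd upd_id.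
Qed.

Variable chi : cfg -> V.
Hypothesis chi_swp : forall i j k S, chi (swp i j k S) = chi S.

(** Iterate [move_step] from [g p] up to the edge of the box, where no configuration fits. *)
Lemma eviE g p : evi chi (src p) (tgt p) (bx g) =
  (M%:Z - net (bx g) (src p))%:~R * evx chi (bx g) +
  \sum_(v : 'I_K.+1 | (g p < v)%N)
     (net (bx (upd g p v)) (tgt p) - net (bx (upd g p v)) (src p))%:~R * evx chi (bx (upd g p v)).
Proof.
have [d] := ubnP (K - g p); elim: d g => // d IH g dg.
have [Kg|gK] := leqP K (g p).
  rewrite /evi /evx !big_pred0 => [|S|S|v]; rewrite ?(fits_out _ Kg) ?mulr0 ?addr0 //.
  by apply/negbTE; rewrite -leqNgt (leq_trans _ Kg) // -ltnS.
pose w : 'I_K.+1 := inord (g p).+1; have wE : w = (g p).+1 :> nat by rewrite inordK.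
pose g' := upd g p w; have g'p : g' p = w by rewrite updE.
have netg' a : net (bx g') a = net (bx g) a + (a == src p)%:R - (a == tgt p)%:R.
  rewrite net_upd wE (_ : _ - _ = 1); last by lia.
  by rewrite mul1r addrA ![_ == a]eq_sym.
have := move_step chi_swp netg'; rewrite (IH g'); last by rewrite g'p wE; lia.
move=> e; rewrite (bigD1 w) ?wE //= -/g'.
rewrite (eq_bigl (fun v : 'I_K.+1 => (g' p < v)%N)) => [|v]; last first.
  by rewrite g'p wE -(inj_eq val_inj) /= wE; apply/andP/idP => [[]|]; lia.
rewrite (eq_bigr (fun v => (net (bx (upd g' p v)) (tgt p) - net (bx (upd g' p v)) (src p))%:~R * evx chi (bx (upd g' p v)))) => [|v _]; last first.
  by rewrite /g' upd_upd.
move: e; move: (\sum_(v | _) _) => s; rewrite !rmorphB /= => e.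
by apply/eqP; rewrite -subr_eq0; move/eqP: e; rewrite -subr_eq0 => /eqP e; apply/eqP; rewrite -[RHS]oppr0 -e; ring.
Qed.

(** By [omegaE], omega consists of row sums, which the flow fixes, and intersection numbers. [eviE]
    expresses the latter through larger flows, and [sum_upd_swap] moves the result onto [F]. *)
Lemma valx_Theta F : valx (fun S => (omega S)%:R * chi S) F = valx chi (Theta F).
Proof.
have evo g : evx (fun S => (omega S)%:R * chi S) (bx g) =
    (\sum_(i < m) (1 + 2 * (m.-1 - i)%N%:Z) * (M%:Z - net (bx g) i))%:~R * evx chi (bx g) -
    2%:R * \sum_p \sum_(v : 'I_K.+1 | (g p < v)%N)
      (net (bx (upd g p v)) (src p) - net (bx (upd g p v)) (tgt p))%:~R * evx chi (bx (upd g p v)).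
  transitivity ((\sum_i (M%:Z - net (bx g) i))%:~R * evx chi (bx g) +
      2%:R * \sum_p evi chi (src p) (tgt p) (bx g)).
    rewrite [in RHS]exchange_big /= mulr_sumr mulr_sumr -big_split /=; apply: eq_bigr => S fS.
    rewrite omegaE natrD natrM mulrDl; congr (_ * _ + _).
      rewrite natr_sum rmorph_sum; apply: eq_bigr => i _.
      by have /forallP/(_ i)/eqP <- := fS; rewrite addrK.
    by rewrite -mulrA natr_sum mulr_suml.
  have -> : \sum_(i < m) (1 + 2 * (m.-1 - i)%N%:Z) * (M%:Z - net (bx g) i) =
      \sum_i (M%:Z - net (bx g) i) + 2 * \sum_p (M%:Z - net (bx g) (src p)).
    have -> : \sum_p (M%:Z - net (bx g) (src p)) = \sum_(i < m) (m.-1 - i)%N%:Z * (M%:Z - net (bx g) i).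
      rewrite (partition_big (@src m) xpredT) //=; apply: eq_bigr => i _.
      rewrite (eq_bigr (fun=> M%:Z - net (bx g) i)) => [|p /eqP ->] //.
      by rewrite sumr_const card_src -mulr_natl natz.
    by rewrite mulr_sumr -big_split; apply: eq_bigr => i _; rewrite /= mulrDl mul1r mulrA.
  under [X in _ + 2%:R * X = _]eq_bigr => p _ do rewrite eviE.
  rewrite [X in _ + 2%:R * X = _]big_split /= -mulr_suml -rmorph_sum.
  set s1 := \sum_p \sum_(v | _) _; set s2 := \sum_p \sum_(v | _) _.
  have -> : s1 = - s2.
    rewrite -sumrN; apply: eq_bigr => p _; rewrite -sumrN; apply: eq_bigr => v _.
    by rewrite -mulNr -rmorphN opprB.
  by rewrite rmorphD rmorphM /=; ring.
rewrite /valx; under eq_bigr => g _ do rewrite evo mulrBr.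
under [RHS]eq_bigr => g _ do rewrite /Theta mulrBl.
rewrite !sumrB; congr (_ - _); first by apply: eq_bigr => g _; rewrite mulrCA mulrA.
under eq_bigr => g _ do rewrite mulrCA.
under [RHS]eq_bigr => g _ do rewrite -mulrA.
rewrite -!mulr_sumr; congr (_ * _).
under eq_bigr => g _ do rewrite mulr_sumr.
under [RHS]eq_bigr => g _ do rewrite mulr_suml.
rewrite exchange_big [RHS]exchange_big; apply: eq_bigr => p _ /=.
under eq_bigr => g _ do rewrite mulr_sumr.
rewrite (sum_upd_swap p F (fun g => (net (bx g) (src p) - net (bx g) (tgt p))%:~R * evx chi (bx g))).
by apply: eq_bigr => g _; rewrite -mulr_suml mulrCA mulrA.
Qed.

End Box.

End Configurations.

Section Monomials.
Variables (m M : nat) (V : comNzRingType) (z : 'I_M -> V).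
Local Notation cfg := {ffun 'I_m -> {ffun 'I_M -> bool}}.

Definition mon (S : cfg) : V := \prod_k z k ^+ csize S k.

Definition ecoef (d : int) : V :=
  if d is Posz d' then (\prod_k ('X + (z k)%:P))`_d' else 0.

Lemma ecoefE d : ecoef d =
  \sum_(T : {ffun 'I_M -> bool} | (\sum_k T k)%N%:Z + d == M%:Z) \prod_k z k ^+ T k.
Proof.
have negM (T : {ffun 'I_M -> bool}) : (\sum_k T k + \sum_k ~~ T k = M)%N.
  rewrite -[RHS](card_ord M) -sum1_card -big_split; apply: eq_bigr => k _.
  by case: (T k).
case: d => [d|d]; last first.
  rewrite big_pred0 // => T; apply/negbTE/eqP; have := negM T.
  by move: (\sum_k T k)%N => a; lia.
rewrite /= (eq_bigr (fun k => \sum_(b : bool) if b then (z k)%:P else 'X)); last first.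
  by move=> k _; rewrite big_bool addrC.
rewrite bigA_distr_bigA coef_sum [RHS]big_mkcond; apply: eq_bigr => T _.
rewrite (eq_bigr (fun k => (z k ^+ T k)%:P * 'X^(~~ T k))); last first.
  by move=> k _; case: (T k); rewrite ?expr1 ?expr0 ?mulr1 ?mul1r.
rewrite big_split /= prodrXr -rmorph_prod coefCM coefXn; have := negM T.
move: (\sum_k T k)%N (\sum_k ~~ T k)%N => a b ab.
case: eqP => [->|dn]; first by rewrite mulr1 ifT //; apply/eqP; lia.
by rewrite mulr0 ifF //; apply/negbTE/eqP; lia.
Qed.

Lemma evx_mon f : evx mon f = \prod_i ecoef (net f i).
Proof.
under [RHS]eq_bigr => i _ do rewrite ecoefE.
rewrite bigA_distr_big_dep /evx; apply: eq_big => [S|S _].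
  by rewrite /fits; apply/forallP/familyP.
rewrite exchange_big; apply: eq_bigr => k _ /=.
by rewrite -expr_sum.
Qed.

Lemma mon_swp i j k S : mon (swp i j k S) = mon S.
Proof. by rewrite /mon csize_swp. Qed.

End Monomials.

Section FlowOperators.
Variables (m M K : nat) (V : comNzRingType).
Hypothesis K_large : (Kmin m 0 <= K)%N.
Local Notation cfg := {ffun 'I_m -> {ffun 'I_M -> bool}}.
Local Notation box := {ffun pairs m -> 'I_K.+1}.
Implicit Types (F : box -> V) (chi : cfg -> V).

Definition swp_invariant chi := forall i j k S, chi (swp i j k S) = chi S.

Lemma omega_swp (i j : 'I_m) (k : 'I_M) S : omega (swp i j k S) = omega S.
Proof. by rewrite /omega csize_swp. Qed.

Lemma eq_valx chi chi' F : chi =1 chi' -> valx chi F = valx chi' F.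
Proof. by move=> e; apply: eq_bigr => g _; congr (_ * _); apply: eq_bigr. Qed.

Lemma valx_sum chi (I : finType) (c : I -> V) (F : I -> box -> V) :
  valx chi (fun g => \sum_i c i * F i g) = \sum_i c i * valx chi (F i).
Proof.
rewrite /valx; under eq_bigr => g _ do rewrite mulr_suml.
rewrite exchange_big; apply: eq_bigr => i _; rewrite mulr_sumr.
by apply: eq_bigr => g _; rewrite mulrA.
Qed.

Lemma valx_sum_chi (I : finType) (c : I -> V) (chi : I -> cfg -> V) F :
  valx (fun S => \sum_i c i * chi i S) F = \sum_i c i * valx (chi i) F.
Proof.
rewrite /valx; under [RHS]eq_bigr => i _ do rewrite mulr_sumr.
rewrite exchange_big; apply: eq_bigr => g _.
rewrite /evx exchange_big /= mulr_sumr; apply: eq_bigr => i _.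
by rewrite -mulr_sumr mulrCA.
Qed.

(** The falling factorial Theta (Theta - 1) ... (Theta - l + 1) applied to [F]. *)
Fixpoint ff (l : nat) F : box -> V :=
  if l is l'.+1 then fun g => Theta M (ff l' F) g - l'%:R * ff l' F g else F.

Lemma valx_ff l chi F : swp_invariant chi ->
  valx chi (ff l F) = valx (fun S => (omega S ^_ l)%:R * chi S) F.
Proof.
elim: l chi => [|l IH] chi chis; first by apply: eq_valx => S; rewrite mul1r.
transitivity (valx chi (Theta M (ff l F)) - l%:R * valx chi (ff l F)).
  rewrite /valx mulr_sumr -sumrB; apply: eq_bigr => g _.
  by rewrite mulrBl mulrA.
rewrite -valx_Theta // !IH //; last by move=> i j k S; rewrite omega_swp chis.
rewrite /valx mulr_sumr -sumrB; apply: eq_bigr => g _.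
rewrite mulrCA -mulrBr; congr (_ * _); rewrite mulr_sumr -sumrB; apply: eq_bigr => S _.
rewrite ffactnSr natrM; have [lS|Sl] := leqP l (omega S).
  by rewrite natrB //; ring.
by rewrite ffact_small // !mul0r mulr0 subrr.
Qed.

(** Lets the binomial series in [heat_op] stop at a degree that serves all configurations. *)
Lemma omega_le (S : cfg) : (omega S <= M * m ^ 2)%N.
Proof.
rewrite -[X in (X * _)%N](card_ord M) -sum_nat_const; apply: leq_sum => k _.
rewrite leq_exp2r // -[leqRHS](card_ord m) -sum1_card; apply: leq_sum => i _.
exact: leq_b1.
Qed.

End FlowOperators.

(** * Operators on flows that preserve nonvanishing *)

Section StableFlows.
Variables (R : archiRcfType) (m M K : nat).
Hypothesis K_large : (Kmin m 0 <= K)%N.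
Local Notation C := R[i]%C.
Local Notation toC := (real_complex R).
Local Notation cfg := {ffun 'I_m -> {ffun 'I_M -> bool}}.
Local Notation box := {ffun pairs m -> 'I_K.+1}.
Implicit Types (F : box -> C) (z : 'I_M -> C).

Definition upper z := forall k, 0 < complex.Im (z k).

Definition stable_flow F := forall z, upper z -> valx (mon z) F != 0.

Definition diag_op (eps : R) F : box -> C :=
  fun g => (\prod_i (1 - eps * (net (bx g) i)%:~R ^+ 2))%:C%C * F g.

(* [(1 - eps) ^ Theta], by the binomial series. *)
Definition heat_op (eps : R) F : box -> C :=
  fun g => \sum_(l < (M * m ^ 2).+1) ((- eps) ^+ l / l`!%:R)%:C%C * ff M l F g.

Lemma size_linear_prod z : size (\prod_k ('X + (z k)%:P)) = M.+1.
Proof.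
rewrite (eq_bigr (fun k => 'X - (- z k)%:P)) => [|k _]; last by rewrite polyCN opprK.
by rewrite size_prod_XsubC /index_enum -enumT size_enum_ord.
Qed.

Lemma closed_linear_prod z : upper z -> closed_stable (\prod_k ('X + (z k)%:P)).
Proof.
move=> zu x x0; rewrite horner_prod; apply/prodf_neq0 => k _.
rewrite hornerD hornerX hornerC; apply/eqP => /(congr1 (@complex.Im R)).
by have := zu k; case: x x0 => a b; case: (z k) => c d /= *; lra.
Qed.

(** Up to d! the coefficient is the d-th derivative at 0, and derivatives remain without zeros in
    the closed half-plane. *)
Lemma ecoef_neq0 z (d : nat) : upper z -> (d <= M)%N -> ecoef z d != 0.
Proof.
move=> zu dM; rewrite /ecoef; set E := \prod_k _.
have Es := closed_linear_prod zu.
have EM : E`_M = 1.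
  rewrite -[M in E`_M]/(M.+1.-1) -(size_linear_prod z) -lead_coefE.
  rewrite lead_coef_prod big1 // => k _; rewrite -[(z k)%:P]opprK -polyCN.
  exact: lead_coefXsubC.
have Esz d' : (d' <= M)%N -> (M - d' < size E^`(d'))%N.
  move=> dM'; rewrite ltnNge; apply/negP => /(nth_default 0)/eqP.
  by rewrite coef_derivn subnKC // EM pnatr_eq0 eqn0Ngt ffact_gt0 dM'.
have Ed : closed_stable E^`(d).
  elim: d dM => [|d IH] dM; first by rewrite derivn0.
  rewrite derivnS; apply: closed_deriv; first exact: IH (ltnW dM).
  by apply: leq_trans (Esz d (ltnW dM)); lia.
have := Ed 0 (lexx _); rewrite horner_coef0 coef_derivn addn0 ffactnn.
by apply: contraNneq => ->; rewrite mul0rn.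
Qed.

(* On monomials [heat_op] is [\prod_k q ^ (j_k ^ 2)], applied here one variable at a time. *)
Lemma stable_heat (eps : R) F : 0 < eps < 1 -> stable_flow F -> stable_flow (heat_op eps F).
Proof.
move=> eps01 Fs z zu; pose q : R := 1 - eps; have q01 : 0 < q < 1 by rewrite /q; lra.
rewrite valx_sum (eq_bigr (fun l : 'I_(M * m ^ 2).+1 => ((- eps) ^+ l / l`!%:R)%:C%C *
  valx (fun S => (omega S ^_ l)%:R * mon z S) F)); last first.
  by move=> l _; rewrite (valx_ff K_large) // => i j k S; apply: mon_swp.
(* In [mix r] the multiplier has been applied to the first [r] variables. *)
pose mix (r : nat) (z' : 'I_M -> C) (S : cfg) : C :=
  \prod_(k < M) ((if (k < r)%N then q ^+ (csize S k ^ 2) else 1)%:C%C * z' k ^+ csize S k).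
have mix_stable r : (r <= M)%N -> forall z', upper z' -> valx (mix r z') F != 0.
  elim: r => [|r IH] rM z' zu'.
    rewrite (@eq_valx _ _ _ _ _ (mon z')) ?Fs // => S.
    by apply: eq_bigr => k _; rewrite mul1r.
  pose k0 := Ordinal rM; pose z1 x k := if k == k0 then x else z' k.
  pose rest (S : cfg) : C := \prod_(k < M | k != k0)
    ((if (k < r)%N then q ^+ (csize S k ^ 2) else 1)%:C%C * z' k ^+ csize S k).
  pose p : {poly C} := \sum_(g : box) F g *: \sum_(S : cfg | fits (bx g) S) rest S *: 'X^(csize S k0).
  have pE x : p.[x] = valx (mix r (z1 x)) F.
    rewrite horner_sum; apply: eq_bigr => g _; rewrite hornerZ horner_sum; congr (_ * _).
    apply: eq_bigr => S _; rewrite hornerZ hornerXn /mix (bigD1 k0) //= ltnn mul1r mulrC.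
    rewrite /z1 eqxx; congr (_ * _); apply: eq_bigr => k /negPf kk0.
    by rewrite kk0.
  have ps : open_stable p.
    move=> x x0; rewrite pE IH ?(ltnW rM) // => k; rewrite /z1.
    by case: eqP.
  have := open_gauss q01 ps (zu' k0); suff -> : (gauss q p).[z' k0] = valx (mix r.+1 z') F by [].
  have -> : gauss q p = \sum_(g : box) F g *: \sum_(S : cfg | fits (bx g) S)
      rest S *: ((q ^+ (csize S k0 ^ 2))%:C%C *: 'X^(csize S k0)).
    apply/polyP => j; rewrite coef_gauss !coef_sum mulr_sumr; apply: eq_bigr => g _.
    rewrite !coefZ !coef_sum mulrCA; congr (_ * _); rewrite mulr_sumr; apply: eq_bigr => S _.
    by rewrite !coefZ coefXn mulrCA; congr (_ * _); case: eqP => [->|]; rewrite ?mulr0.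
  rewrite horner_sum; apply: eq_bigr => g _; rewrite hornerZ horner_sum; congr (_ * _).
  apply: eq_bigr => S _; rewrite !hornerZ hornerXn /mix [RHS](bigD1 k0) //= ltnSn mulrC.
  congr (_ * _); apply: eq_bigr => k kk0; rewrite ltnS [(k <= r)%N]leq_eqVlt.
  by rewrite (_ : (k : nat) == r = false) //; apply/negbTE.
have := mix_stable M (leqnn M) z zu; suff -> : valx (mix M z) F = \sum_(l < (M * m ^ 2).+1)
    ((- eps) ^+ l / l`!%:R)%:C%C * valx (fun S => (omega S ^_ l)%:R * mon z S) F by [].
rewrite -valx_sum_chi; apply: eq_valx => S.
rewrite /mix big_split /= -/(mon z S) (eq_bigr (fun k => (q ^+ (csize S k ^ 2))%:C%C)); last first.
  by move=> k _; rewrite ltn_ord.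
under [RHS]eq_bigr => l _ do rewrite mulrA.
rewrite -mulr_suml; congr (_ * _).
rewrite -(rmorph_prod toC) prodrXr -/(omega S) /q exprDn.
rewrite (big_ord_widen (M * m ^ 2).+1 (fun i => 1 ^+ (omega S - i) * (- eps) ^+ i *+ 'C(omega S, i))); last first.
  by rewrite ltnS omega_le.
rewrite [in LHS]big_mkcond (rmorph_sum toC); apply: eq_bigr => l _.
rewrite -(rmorph_nat toC) -(rmorphM toC); congr (_%:C)%C.
rewrite -bin_ffact natrM mulrA mulrAC divfK ?pnatr_eq0 -?lt0n ?fact_gt0 //.
rewrite ltnS; case: leqP => [lo|ol]; first by rewrite expr1n mul1r mulr_natr.
by rewrite bin_small // mulr0.
Qed.

(* The diagonal operator replaces the [z_k] by minus the roots of the dilated [\prod_k ('X + z_k)]. *)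
Lemma stable_diag b F : M.+1%:R <= b -> stable_flow F -> stable_flow (diag_op (b ^- 2) F).
Proof.
move=> Mb Fs z zu; have b0 : 0 < b by apply: lt_le_trans Mb; rewrite ltr0n.
pose E := \prod_k ('X + (z k)%:P) : {poly C}; pose E' := dilate (b ^+ 2) E.
have E's : closed_stable E'.
  by apply: closed_dilate => //; [exact: closed_linear_prod|rewrite size_linear_prod].
have Msmall : 1 - (M ^ 2)%:R / b ^+ 2 != 0.
  rewrite subr_eq0 eq_sym lt_eqF // ltr_pdivrMr ?exprn_gt0 // mul1r natrX.
  by rewrite ltr_pXn2r ?nnegrE ?ler0n ?(ltW b0) //; apply: lt_le_trans Mb; rewrite ltr_nat.
have szE' : size E' = M.+1.
  rewrite -(size_linear_prod z); apply: size_poly_eq.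
  rewrite size_linear_prod /= mulf_neq0 //; first by rewrite eq_complex /= eqxx andbT.
  rewrite -[M in E`_M]/(M.+1.-1) -(size_linear_prod z) -lead_coefE lead_coef_eq0.
  by apply/open_stable_neq0/closed_open/closed_linear_prod.
have [s sE] := closed_field_poly_normal E'.
have c0 : lead_coef E' != 0 by rewrite lead_coef_eq0 -size_poly_gt0 szE'.
have ss : size s = M.
  by have := szE'; rewrite sE size_scale // size_prod_XsubC => -[].
pose z' (k : 'I_M) := - s`_k.
have zu' : upper z'.
  move=> k; have sk : s`_k \in s by rewrite mem_nth // ss.
  have : complex.Im s`_k < 0.
    by apply: (closed_root E's); rewrite sE rootZ // root_prod_XsubC.
  by rewrite /z'; case: (s`_k) => u v /=; rewrite oppr_gt0.
have E'z' : E' = lead_coef E' *: \prod_k ('X + (z' k)%:P).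
  rewrite {1}sE (big_nth 0) big_mkord ss; congr (_ *: _); apply: eq_bigr => k _.
  by rewrite /z' polyCN.
have valE : valx (mon z) (diag_op (b ^- 2) F) = lead_coef E' ^+ m * valx (mon z') F.
  rewrite /valx mulr_sumr; apply: eq_bigr => g _.
  rewrite /diag_op [F g * _]mulrC [RHS]mulrA mulrAC; congr (_ * _).
  rewrite !evx_mon (rmorph_prod toC) -big_split /=.
  rewrite -[X in lead_coef E' ^+ X](card_ord m) -prodr_const -big_split; apply: eq_bigr => i _ /=.
  case: (net (bx g) i) => d; last by rewrite /ecoef !mulr0.
  rewrite /ecoef -[RHS]coefZ -E'z' coef_dilate -/E; congr (_%:C%C * _).
  by rewrite -pmulrn -natrX [b ^- 2 * _]mulrC.
by rewrite valE mulf_neq0 ?expf_neq0 ?Fs.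
Qed.

(** The value is the product of the [ecoef z (lam i)], and [2 * m <= M] keeps the indices [lam i]
    within the degree. *)
Lemma stable_delta : (2 * m <= M)%N -> stable_flow (fun g => (g == [ffun=> ord0])%:R).
Proof.
move=> mM z zu; rewrite /valx (bigD1 [ffun=> ord0]) //= eqxx mul1r big1 ?addr0; last first.
  by move=> g /negPf ->; rewrite mul0r.
rewrite evx_mon; apply/prodf_neq0 => i _.
have -> : net (bx ([ffun=> ord0] : box)) i = (2 * (m.-1 - i))%N.
  by rewrite /net /excess !big1 => [|p _|p _]; rewrite /bx ?ffunE //= /lam; lia.
by apply: ecoef_neq0 => //; have := ltn_ord i; lia.
Qed.

End StableFlows.

(** * First-order expansions at 0 *)

Section FirstOrder.
Variable R : realFieldType.
Implicit Types (x y : R -> R) (a b : R).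

Definition first_order x a b :=
  exists C, forall e, 0 <= e <= 1 -> `|x e - (a + b * e)| <= C * e ^+ 2.

Lemma first_order_eq x y a b : x =1 y -> first_order x a b -> first_order y a b.
Proof. by move=> xy [C h]; exists C => e /h; rewrite xy. Qed.

Lemma first_order_const a : first_order (fun=> a) a 0.
Proof. by exists 0 => e _; rewrite mul0r addr0 subrr normr0 mul0r. Qed.

Lemma first_orderD x y a b a' b' : first_order x a b -> first_order y a' b' ->
  first_order (fun e => x e + y e) (a + a') (b + b').
Proof.
move=> [C hx] [D hy]; exists (C + D) => e e01; rewrite [leRHS]mulrDl.
have -> : x e + y e - (a + a' + (b + b') * e) = (x e - (a + b * e)) + (y e - (a' + b' * e)) by ring.
exact: le_trans (ler_normD _ _) (lerD (hx e e01) (hy e e01)).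
Qed.

Lemma first_orderM x y a b a' b' : first_order x a b -> first_order y a' b' ->
  first_order (fun e => x e * y e) (a * a') (a * b' + b * a').
Proof.
move=> [C hx] [D hy]; exists (`|b * b'| + C * (`|a'| + `|b'| + D) + D * (`|a| + `|b|)) => e e01.
have /andP[e0 e1] := e01; have e20 : 0 <= e ^+ 2 by rewrite sqr_ge0.
have e21 : e ^+ 2 <= 1 by rewrite exprn_ile1.
set r := x e - (a + b * e); set s := y e - (a' + b' * e).
have -> : x e * y e - (a * a' + (a * b' + b * a') * e) =
    b * b' * e ^+ 2 + r * (a' + b' * e + s) + s * (a + b * e) by rewrite /r /s; ring.
have hr := hx e e01; have hs := hy e e01; rewrite -/r in hr; rewrite -/s in hs.
have lin c d : `|c + d * e| <= `|c| + `|d|.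
  by apply: le_trans (ler_normD _ _) _; rewrite lerD2l normrM ler_piMr // ger0_norm.
have D0 : 0 <= D.
  by have := hy 1; rewrite expr1n mulr1 ler01 lexx => /(_ isT); apply: le_trans.
have sD : `|s| <= D by apply: le_trans hs _; rewrite ler_piMr.
rewrite [leRHS]mulrDl [X in _ <= X + _]mulrDl.
apply: le_trans (ler_normD _ _) _; apply: lerD; last first.
  by rewrite normrM mulrAC ler_pM.
apply: le_trans (ler_normD _ _) _; rewrite lerD //.
  by rewrite normrM (ger0_norm e20).
rewrite normrM [leRHS]mulrAC ler_pM //.
by apply: le_trans (ler_normD _ _) _; rewrite lerD.
Qed.

Lemma first_order_sum (I : Type) (s : seq I) (x : I -> R -> R) (a b : I -> R) :
  (forall i, first_order (x i) (a i) (b i)) ->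
  first_order (fun e => \sum_(i <- s) x i e) (\sum_(i <- s) a i) (\sum_(i <- s) b i).
Proof.
move=> h; elim: s => [|i s IH].
  by rewrite !big_nil; apply: first_order_eq (first_order_const 0) => e; rewrite big_nil.
rewrite !big_cons; apply: first_order_eq (first_orderD (h i) IH) => e.
by rewrite big_cons.
Qed.

Lemma first_order_prod1 (I : Type) (s : seq I) (c : I -> R) :
  first_order (fun e => \prod_(i <- s) (1 - e * c i)) 1 (- \sum_(i <- s) c i).
Proof.
elim: s => [|i s IH].
  rewrite big_nil oppr0; apply: first_order_eq (first_order_const 1) => e.
  by rewrite big_nil.
have h : first_order (fun e => 1 - e * c i) 1 (- c i).
  exists 0 => e _; rewrite mul0r (_ : _ - _ = 0) ?normr0 //; ring.
have := first_orderM h IH; rewrite !mulr1 mul1r big_cons opprD [- _ - _]addrC.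
by apply: first_order_eq => e; rewrite big_cons.
Qed.

Lemma first_order_pow (l : nat) c :
  first_order (fun e => (- e) ^+ l * c) (c *+ (l == 0)%N) (- c *+ (l == 1)%N).
Proof.
case: l => [|[|l]].
- rewrite mulr1n mulr0n; apply: first_order_eq (first_order_const c) => e.
  by rewrite expr0 mul1r.
- exists 0 => e _; rewrite mulr0n mulr1n mul0r (_ : _ - _ = 0) ?normr0 //; ring.
exists `|c| => e /andP[e0 e1]; rewrite !mulr0n mul0r addr0 subr0 normrM normrX normrN.
rewrite (ger0_norm e0) mulrC ler_wpM2l // -addn2 exprD ler_piMl ?sqr_ge0 //.
by rewrite exprn_ile1.
Qed.

End FirstOrder.

(** * The generator of the evolution *)

Section FlowLimit.
Variables (m M K : nat) (R : archiRcfType).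
Local Notation box := {ffun pairs m -> 'I_K.+1}.
Implicit Types (F G : box -> R) (g : box).

Definition slope g p : R := (net (bx g) (src p) - net (bx g) (tgt p))%:~R.
Definition energy g : R := \sum_p (g p)%:R * slope g p.
Definition below_sum F g : R := \sum_p slope g p * \sum_(v : 'I_K.+1 | (v < g p)%N) F (upd g p v).
(* [Theta] plus the diagonal operator [\sum_i net_i ^ 2], minus the constant [kappa]. *)
Definition hh F g : R := energy g * F g - 2 * below_sum F g.
Definition kappa : R := (\sum_(i < m) (1 + lam i) * M%:Z - (m * m.-1)%N%:Z)%:~R.

Definition diag_real (eps : R) F : box -> R :=
  fun g => (\prod_i (1 - eps * (net (bx g) i)%:~R ^+ 2)) * F g.

Definition heat_real (eps : R) F : box -> R :=
  fun g => \sum_(l < (M * m ^ 2).+1) ((- eps) ^+ l / l`!%:R) * ff M l F g.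

Definition step eps F := heat_real eps (diag_real eps F).

(** The generator is triangular: [below_sum] involves smaller flows only, and the diagonal entries
    are [kappa] + [energy]. *)
Lemma ThetaE F g : Theta M F g + (\sum_i (net (bx g) i)%:~R ^+ 2) * F g = kappa * F g + hh F g.
Proof.
rewrite /Theta /hh -/(below_sum F g) addrAC addrA; congr (_ - _); rewrite -!mulrDl; congr (_ * _).
have -> : energy g = (\sum_i net (bx g) i * (net (bx g) i - lam i))%:~R.
  rewrite rmorph_sum /energy; under [RHS]eq_bigr => i _.
    rewrite rmorphM /= (_ : net (bx g) i - lam i = excess (bx g) i); last by rewrite /net addrC addKr.
    over.
  rewrite (sum_excess (bx g) (fun i => (net (bx g) i)%:~R)); apply: eq_bigr => p _.
  by rewrite /slope rmorphB.
rewrite (_ : \sum_i _ ^+ 2 = (\sum_i net (bx g) i ^+ 2)%:~R); last first.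
  by rewrite rmorph_sum; apply: eq_bigr => i _; rewrite rmorphXn.
rewrite /kappa -!rmorphD; congr (_%:~R).
rewrite -(total_net (bx g)) -sumrB -!big_split; apply: eq_bigr => i _ /=.
by rewrite /lam -mulr_natl; ring.
Qed.

(** Stationarity holds pair by pair, because 2 * \sum_(v < k) (v + 1) = k (k + 1). *)
Lemma hh_wt g : hh (fun g => (wt (bx g))%:R) g = 0.
Proof.
rewrite /hh /energy /below_sum mulr_suml mulr_sumr -sumrB big1 // => p _.
set s := \sum_(v | _) _.
suff e : 2 * s = (g p)%:R * (wt (bx g))%:R.
  have -> : (g p)%:R * slope g p * (wt (bx g))%:R - 2 * (slope g p * s) =
      slope g p * ((g p)%:R * (wt (bx g))%:R - 2 * s) by ring.
  by rewrite e subrr mulr0.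
rewrite /s => {s}.
have gp0 : (g p).+1%:R != 0 :> R by rewrite pnatr_eq0.
apply: (mulIf gp0); rewrite -mulrA mulr_suml.
under eq_bigr => v _ do rewrite -natrM wt_upd.
rewrite -natr_sum -!natrM; congr (_%:R).
rewrite -big_distrr /= mulnCA [RHS]mulnAC [RHS]mulnC; congr (_ * _)%N.
rewrite -(big_ord_widen K.+1 (fun v => v.+1)) ?(ltnW (ltn_ord _)) //.
elim: (nat_of_ord (g p)) => [|k IH]; first by rewrite big_ord0.
by rewrite big_ord_recr /= mulnDr IH; nia.
Qed.

(** The energy is \sum_p g p * (lam (src p) - lam (tgt p)) plus the sum of the squared excesses, and
    [lam] drops by at least 2 along each pair. *)
Lemma energy_ge g : 2 * (\sum_p g p)%N%:R <= energy g.
Proof.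
rewrite /energy.
have e : \sum_p (g p)%:Z * (net (bx g) (src p) - net (bx g) (tgt p)) =
    \sum_p (g p)%:Z * (lam (src p) - lam (tgt p)) + \sum_i excess (bx g) i ^+ 2.
  have := sum_excess (bx g) (fun i => excess (bx g) i); under [LHS]eq_bigr => i _ do rewrite intz -expr2.
  move=> ->; rewrite -big_split; apply: eq_bigr => p _.
  by rewrite /= natz -[nat_of_ord (g p)]/(bx g p) /net; ring.
have -> : \sum_p (g p)%:R * slope g p = (\sum_p (g p)%:Z * (net (bx g) (src p) - net (bx g) (tgt p)))%:~R.
  by rewrite rmorph_sum; apply: eq_bigr => p _; rewrite rmorphM.
rewrite -(natrM _ 2) (_ : (2 * _)%N%:R = (2 * (\sum_p g p))%N%:Z%:~R) // ler_int e.
rewrite PoszM (big_morph Posz PoszD (erefl _)) mulr_sumr -[leLHS]addr0 lerD //; last first.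
  by apply: sumr_ge0 => i _; apply: sqr_ge0.
apply: ler_sum => p _; rewrite mulrC ler_wpM2l //.
by have := src_lt_tgt p; have := ltn_ord (tgt p); rewrite /lam; lia.
Qed.

End FlowLimit.

Lemma exp_small (R : archiRcfType) (r h : R) : 0 < r < 1 -> 0 < h -> exists k : nat, r ^+ k <= h.
Proof.
move=> /andP[r0 r1] h0; pose x := r^-1 - 1; have x0 : 0 < x by rewrite subr_gt0 invf_gt1.
have b0 : 0 <= (h * x)^-1 by rewrite invr_ge0 mulr_ge0 // ltW.
exists (Num.bound (h * x)^-1); set k := Num.bound _.
have hk : (h * x)^-1 <= k%:R by apply/ltW; have := archi_boundP b0; rewrite /k.
have rk : 0 < r ^+ k by rewrite exprn_gt0.
have : 1 + k%:R * x <= (r ^+ k)^-1.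
  rewrite -exprVn (_ : r^-1 = 1 + x); last by rewrite /x subrKC.
  by apply: bernoulli; lra.
have : h^-1 <= k%:R * x by rewrite -ler_pdivrMr // -invfM.
move=> h1 h2; rewrite -[leLHS]invrK -[leRHS]invrK lef_pV2 ?posrE ?invr_gt0 //.
by lra.
Qed.

(** * Contraction of one step in a weighted norm *)

Section Contraction.
Variables (m M K : nat) (R : archiRcfType).
Hypothesis M_gt0 : (0 < M * m ^ 2)%N.
Local Notation box := {ffun pairs m -> 'I_K.+1}.
Local Notation kappa := (kappa m M R).
Local Notation step := (step M).
Implicit Types (F G : box -> R) (g : box) (e b : R).

Definition dirac (g' : box) : box -> R := fun g => (g == g')%:R.

Lemma sum_dirac F g : F g = \sum_g' F g' * dirac g' g.
Proof.
rewrite (bigD1 g) //= /dirac eqxx mulr1 big1 ?addr0 // => g' /negPf.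
by rewrite eq_sym => ->; rewrite mulr0.
Qed.

Lemma Theta_sum (I : finType) (c : I -> R) (F : I -> box -> R) g :
  Theta M (fun g => \sum_i c i * F i g) g = \sum_i c i * Theta M (F i) g.
Proof.
rewrite /Theta; under [RHS]eq_bigr => i _ do rewrite mulrBr.
rewrite sumrB [X in X - _ = _]mulr_sumr; congr (_ - _); first by apply: eq_bigr => i _; rewrite mulrCA.
under [RHS]eq_bigr => i _ do rewrite mulrCA mulr_sumr.
rewrite -mulr_sumr exchange_big; congr (_ * _); apply: eq_bigr => p _ /=.
rewrite exchange_big /= mulr_sumr; apply: eq_bigr => i _.
by rewrite -mulr_sumr mulrCA.
Qed.

Lemma eq_Theta F G : F =1 G -> Theta M F =1 Theta M G.
Proof. by move=> /funext ->. Qed.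

Lemma ff_sum l (I : finType) (c : I -> R) (F : I -> box -> R) g :
  ff M l (fun g => \sum_i c i * F i g) g = \sum_i c i * ff M l (F i) g.
Proof.
elim: l g => [|l IH] g //=.
rewrite (eq_Theta IH) Theta_sum IH mulr_sumr -sumrB; apply: eq_bigr => i _.
by ring.
Qed.

Lemma step_sum e (I : finType) (c : I -> R) (F : I -> box -> R) g :
  step e (fun g => \sum_i c i * F i g) g = \sum_i c i * step e (F i) g.
Proof.
rewrite /step /heat_real; under [RHS]eq_bigr => i _ do rewrite mulr_sumr.
rewrite exchange_big; apply: eq_bigr => l _ /=.
have -> : diag_real e (fun g => \sum_i c i * F i g) = fun g => \sum_i c i * diag_real e (F i) g.
  apply/funext => g0; rewrite /diag_real /= mulr_sumr; apply: eq_bigr => i _.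
  by rewrite mulrCA.
by rewrite ff_sum mulr_sumr; apply: eq_bigr => i _; rewrite mulrCA.
Qed.

Lemma stepE e F g : step e F g = \sum_g' F g' * step e (dirac g') g.
Proof.
rewrite -step_sum; congr (step e _ g).
by apply/funext => g0; apply: sum_dirac.
Qed.

Lemma stepD e F G g : step e (fun g => F g + G g) g = step e F g + step e G g.
Proof. by rewrite !(stepE e _ g) -big_split; apply: eq_bigr => g' _; rewrite mulrDl. Qed.

Lemma generatorE F g : kappa * F g + hh F g =
  \sum_g' F g' * (kappa * dirac g' g + hh (dirac g') g).
Proof.
under [RHS]eq_bigr => g' _ do rewrite -ThetaE mulrDr mulrCA.
rewrite big_split /= -mulr_sumr -sum_dirac -Theta_sum -ThetaE.
by rewrite -(funext (sum_dirac F)).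
Qed.

(** The heat factor contributes Theta and the diagonal factor the sum of the squares of [net];
    [ThetaE] adds them up. *)
Lemma step_first_order g g' : first_order (fun e => step e (dirac g') g)
  (dirac g' g) (- (kappa * dirac g' g + hh (dirac g') g)).
Proof.
pose c l := ff M l (dirac g') g / l`!%:R.
pose S (g : box) : R := \sum_i (net (bx g) i)%:~R ^+ 2.
have fo_heat : first_order (fun e => \sum_(l < (M * m ^ 2).+1) (- e) ^+ l * c l)
    (dirac g' g) (- Theta M (dirac g') g).
  have := first_order_sum (index_enum 'I_(M * m ^ 2).+1) (fun l => first_order_pow l (c l)).
  rewrite (bigD1 ord0) //= big1 ?addr0 => [|l l0]; last by rewrite -[(l : nat) == 0%N]/(l == ord0) (negPf l0) mulr0n.
  have lt1 : (1 < (M * m ^ 2).+1)%N by rewrite ltnS.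
  rewrite (bigD1 (Ordinal lt1)) //= [X in _ + X]big1 => [|l l1]; last first.
    by rewrite -[(l : nat) == 1%N]/(l == Ordinal lt1) (negPf l1) mulr0n.
  by rewrite !mulr1n addr0 /c fact0 !divr1 /= mul0r subr0.
have fo_diag := first_order_prod1 (index_enum 'I_m) (fun i => (net (bx g') i)%:~R ^+ 2 : R).
have := first_orderM fo_diag fo_heat; rewrite !mul1r -ThetaE -/(S g').
have -> : - Theta M (dirac g') g + - S g' * dirac g' g = - (Theta M (dirac g') g + S g * dirac g' g).
  have -> : S g * dirac g' g = S g' * dirac g' g.
    by rewrite /dirac; case: eqP => [->|] //; rewrite mulr0n !mulr0.
  by rewrite [RHS]opprD mulNr.
apply: first_order_eq => e; rewrite mulr_sumr; apply: eq_bigr => l _.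
have -> : diag_real e (dirac g') = fun g => \sum_(i < 1) (\prod_i (1 - e * (net (bx g') i)%:~R ^+ 2)) * dirac g' g.
  apply/funext => g0; rewrite big_ord1 /diag_real /dirac.
  by case: eqP => [->|] //; rewrite mulr0n !mulr0.
by rewrite ff_sum big_ord1 /c; ring.
Qed.

(** By linearity it suffices to expand the finitely many matrix entries of the step and to add up
    their constants. *)
Lemma step_approx : exists2 C, 0 <= C & forall e F b, 0 <= e <= 1 -> 
  (forall g, `|F g| <= b) ->
  forall g, `|step e F g - (F g - e * (kappa * F g + hh F g))| <= C * e ^+ 2 * b.
Proof.
pose c g g' := projT1 (cid (step_first_order g g')).
have cP g g' := projT2 (cid (step_first_order g g')).
pose C := \sum_(g : box) \sum_(g' : box) `|c g g'|.
exists C => [|e F b e01 Fb g]; first by do 2 (apply: sumr_ge0 => ? _).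
rewrite stepE generatorE (sum_dirac F g) mulr_sumr -sumrB -sumrB.
apply: le_trans (ler_norm_sum _ _ _) _.
apply: (@le_trans _ _ (\sum_g' `|c g g'| * e ^+ 2 * b)).
  apply: ler_sum => g' _.
  rewrite (_ : _ - _ = F g' * (step e (dirac g') g - (dirac g' g + - (kappa * dirac g' g + hh (dirac g') g) * e))); last by ring.
  rewrite normrM mulrC ler_pM //; apply: le_trans (cP g g' e e01) _.
  by rewrite ler_wpM2r ?sqr_ge0 // ler_norm.
rewrite -mulr_suml -mulr_suml; have b0 : 0 <= b by apply: le_trans (normr_ge0 _) (Fb g).
rewrite ler_wpM2r // ler_wpM2r ?sqr_ge0 // /C [leRHS](bigD1 g) //= lerDl.
by do 2 (apply: sumr_ge0 => ? _).
Qed.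

Local Notation g0 := ([ffun=> ord0] : box).

Lemma big_below0 (p : pairs m) (F : 'I_K.+1 -> R) : \sum_(v : 'I_K.+1 | (v < g0 p)%N) F v = 0.
Proof. by rewrite big_pred0 // => v; rewrite ffunE ltn0. Qed.

(** By triangularity no other flow feeds the zero flow, so the step acts there as a scalar; this
    makes the normalisation in [wt_limit] possible. *)
Lemma step_origin e F : step e F g0 = F g0 * step e (dirac g0) g0.
Proof.
have T0 G : Theta M G g0 = (\sum_(i < m) (1 + 2 * (m.-1 - i)%N%:Z) * (M%:Z - net (bx g0) i))%:~R * G g0.
  by rewrite /Theta [X in _ - 2%:R * X = _]big1 ?mulr0 ?subr0 // => p _; rewrite big_below0 mulr0.
have ff0 l G : ff M l G g0 = G g0 * ff M l (dirac g0) g0.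
  elim: l => [|l IH] /=; first by rewrite /dirac eqxx mulr1.
  by rewrite !T0 IH mulrBr mulrCA; congr (_ - _); rewrite mulrCA.
rewrite /step /heat_real mulr_sumr; apply: eq_bigr => l _.
have d1 : dirac g0 g0 = 1 by rewrite /dirac eqxx.
by rewrite ff0 [in RHS]ff0 /diag_real d1; ring.
Qed.

Lemma energy0 : energy R g0 = 0.
Proof. by rewrite /energy big1 // => p _; rewrite ffunE mul0r. Qed.

Lemma hh0 F : hh F g0 = 0.
Proof.
by rewrite /hh energy0 mul0r /below_sum big1 ?mulr0 ?subr0 // => p _; rewrite big_below0 mulr0.
Qed.

(** Base of a supremum norm weighted by total flow, taken so large that the part of [hh] below the
    diagonal has norm at most 1. *)
Definition slope_bound : R := 1 + \sum_(g : box) 2 * \sum_p `|slope R g p| * (g p)%:R.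
Definition weight g : R := slope_bound ^+ (\sum_p g p)%N.

Lemma slope_bound_ge1 : 1 <= slope_bound.
Proof. by rewrite lerDl; apply: sumr_ge0 => g _; rewrite mulr_ge0 //; apply: sumr_ge0 => p _; rewrite mulr_ge0. Qed.

Lemma weight_ge1 g : 1 <= weight g.
Proof. exact: exprn_ege1 slope_bound_ge1. Qed.

Lemma weight_upd g p (v : 'I_K.+1) : (v < g p)%N -> slope_bound * weight (upd g p v) <= weight g.
Proof.
move=> vg; rewrite /weight -exprS; apply: ler_weXn2l; first exact: slope_bound_ge1.
rewrite (bigD1 p) //= [leqRHS](bigD1 p) //= updE.
rewrite (eq_bigr (fun q => g q : nat)) => [|q /negPf qp]; last by rewrite ffunE qp.
by rewrite -addSn leq_add2r.
Qed.

Lemma below_sum_le F b g : 0 <= b -> (forall g, `|F g| <= b * weight g) ->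
  2 * `|below_sum F g| <= b * weight g.
Proof.
move=> b0 Fb; have B0 : 0 < slope_bound by apply: lt_le_trans slope_bound_ge1.
have -> : b * weight g = slope_bound * (b * weight g / slope_bound) by field; exact: lt0r_neq0.
set w := b * weight g / slope_bound; have w0 : 0 <= w.
  by rewrite !mulr_ge0 ?invr_ge0 ?(ltW B0) //; apply: le_trans (weight_ge1 g).
apply: (@le_trans _ _ ((2 * \sum_p `|slope R g p| * (g p)%:R) * w)); last first.
  rewrite ler_wpM2r // /slope_bound (bigD1 g) //= addrCA lerDl addr_ge0 //.
  by apply: sumr_ge0 => g' _; rewrite mulr_ge0 //; apply: sumr_ge0 => p _; rewrite mulr_ge0.
rewrite -mulrA ler_pM2l // mulr_suml; apply: le_trans (ler_norm_sum _ _ _) _.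
apply: ler_sum => p _; rewrite normrM -mulrA ler_wpM2l //.
apply: le_trans (ler_norm_sum _ _ _) _.
apply: (@le_trans _ _ (\sum_(v : 'I_K.+1 | (v < g p)%N) w)).
  apply: ler_sum => v vg; apply: le_trans (Fb _) _.
  by rewrite ler_pdivlMr // -mulrA ler_wpM2l // mulrC weight_upd.
rewrite sumr_const -[leLHS]mulr_natl ler_wpM2r // ler_nat -sum1_card.
by rewrite -(big_ord_widen K.+1 (fun=> 1%N)) ?sum1_card ?card_ord // ltnW.
Qed.

(** Off the zero flow the diagonal is at least kappa + 2 and the rest has norm at most 1, which
    leaves the rate kappa + 1. The condition [F g0 = 0] removes the one flow without this gap. *)
Lemma generator_contract e F b g : 0 <= e -> 0 <= b -> e * (kappa + energy R g) <= 1 ->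
  0 <= 1 - e * kappa - e -> F g0 = 0 -> (forall g, `|F g| <= b * weight g) ->
  `|F g - e * (kappa * F g + hh F g)| <= (1 - e * kappa - e) * (b * weight g).
Proof.
move=> e0 b0 eE ek F0 Fb; have W1 := weight_ge1 g.
have bW : 0 <= b * weight g by rewrite mulr_ge0 //; lra.
have [->|gn0] := eqVneq g g0.
  by rewrite hh0 F0 mulr0 addr0 mulr0 subr0 normr0 !mulr_ge0 //; apply: le_trans (weight_ge1 _).
have E2 : 2 <= energy R g.
  apply: le_trans (energy_ge _ g); rewrite ler_peMr // (ler_nat _ 1) lt0n.
  apply: contra gn0; rewrite sum_nat_eq0 => /forallP h; apply/eqP/ffunP => p.
  by rewrite ffunE; apply/val_inj/eqP; apply: (implyP (h p)).
rewrite /hh (_ : _ - _ = (1 - e * (kappa + energy R g)) * F g + e * (2 * below_sum F g)); last by ring.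
apply: le_trans (ler_normD _ _) _; rewrite !normrM (ger0_norm e0) (ger0_norm (_ : 0 <= 2)) //.
have h1 : `|1 - e * (kappa + energy R g)| * `|F g| <= (1 - e * (kappa + energy R g)) * (b * weight g).
  by rewrite ger0_norm ?subr_ge0 // ler_wpM2l ?subr_ge0.
have h2 : e * (2 * `|below_sum F g|) <= e * (b * weight g) by rewrite ler_wpM2l // below_sum_le.
apply: le_trans (lerD h1 h2) _; rewrite -mulrDl ler_wpM2r //.
by have := ler_wpM2l e0 E2; lra.
Qed.

End Contraction.

(** * Convergence of the evolution to the weight *)

Section FlowConvergence.
Variables (m M K : nat) (R : archiRcfType).
Hypothesis m_gt0 : (0 < m)%N.
Hypothesis mM : (2 * m <= M)%N.
Hypothesis K_large : (Kmin m 0 <= K)%N.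
Local Notation C := R[i]%C.
Local Notation toC := (real_complex R).
Local Notation box := {ffun pairs m -> 'I_K.+1}.
Local Notation g0 := ([ffun=> ord0] : box).
Local Notation kappa := (kappa m M R).
Local Notation step := (step M).
Local Notation weight := (@weight m K R).
Implicit Types (F G : box -> R) (g : box) (e b : R).

Definition cast F : box -> C := fun g => (F g)%:C%C.
Definition wt_real : box -> R := fun g => (wt (bx g))%:R.

Let M_gt0 : (0 < M * m ^ 2)%N.
Proof. by rewrite muln_gt0 expn_gt0 m_gt0 orbF; lia. Qed.

Lemma cast_Theta F g : Theta M (cast F) g = (Theta M F g)%:C%C.
Proof.
rewrite /Theta (rmorphB toC) !(rmorphM toC) (rmorph_int toC) (rmorph_nat toC).
congr (_ - _); rewrite (rmorph_sum toC); congr (_ * _).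
apply: eq_bigr => p _; rewrite (rmorphM toC) (rmorph_int toC).
by rewrite (rmorph_sum toC).
Qed.

Lemma cast_ff l F : ff M l (cast F) = cast (ff M l F).
Proof.
elim: l => //= l IH; apply/funext => g; rewrite IH cast_Theta.
rewrite /cast [RHS](rmorphB toC); congr (_ - _).
by rewrite (rmorphM toC) (rmorph_nat toC).
Qed.

Lemma cast_step e F : heat_op M e (diag_op e (cast F)) = cast (step e F).
Proof.
have -> : diag_op e (cast F) = cast (diag_real e F).
  by apply/funext => g; rewrite /diag_op /cast -(rmorphM toC).
apply/funext => g; rewrite /heat_op /cast (rmorph_sum toC); apply: eq_bigr => l _.
by rewrite cast_ff [RHS](rmorphM toC).
Qed.

Lemma stable_scale c F : c != 0 -> stable_flow M (cast F) -> stable_flow M (cast (fun g => F g / c)).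
Proof.
move=> c0 Fs z /Fs; apply: contra => /eqP e; apply/eqP.
have cC : (c^-1)%:C%C != 0 :> C by rewrite eq_complex /= eqxx andbT invr_eq0.
apply: (mulfI cC); rewrite mulr0 -[RHS]e /valx mulr_sumr; apply: eq_bigr => g _.
by rewrite mulrA /cast -(rmorphM toC) [c^-1 * _]mulrC.
Qed.

(* Iterates of the normalised step, started at the zero flow: the distance to [wt] contracts by
   [1 - e / 2] at each step, up to an error [O(e ^ 2)]. *)
Lemma wt_limit (d : R) : 0 < d -> exists2 F, forall g, `|F g - wt_real g| <= d & stable_flow M (cast F).
Proof.
move=> d0; have [D' D0 HD] := @step_approx m M K R M_gt0; move: (D' : R) D0 HD => D D0 HD.
pose Wm : R := \sum_g weight g; pose bw : R := \sum_(g : box) wt_real g.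
have W1 g : 1 <= weight g by apply: weight_ge1.
have W0 g : 0 <= weight g by apply: le_trans (W1 g).
have WWm g : weight g <= Wm by rewrite /Wm (bigD1 g) //= lerDl sumr_ge0.
have Wm1 : 1 <= Wm by apply: le_trans (W1 g0) (WWm g0).
have Wm0 : 0 < Wm := lt_le_trans ltr01 Wm1.
have Wm_ge0 := ltW Wm0.
have wt0 g : 0 <= wt_real g by rewrite ler0n.
have wtbw g : wt_real g <= bw by rewrite /bw (bigD1 g) //= lerDl sumr_ge0.
have bw0 : 0 <= bw by apply: le_trans (wt0 g0) (wtbw g0).
pose En : R := \sum_g `|energy R (g : box)|.
have EnE g : energy R g <= En.
  by apply: le_trans (ler_norm _) _; rewrite /En (bigD1 g) //= lerDl sumr_ge0.
have En0 : 0 <= En by apply: sumr_ge0.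
pose D1 : R := D * Wm; have D10 : 0 <= D1 by rewrite mulr_ge0 //; lra.
pose A : R := 4 * D1 + `|kappa| + En + 2.
pose Q : R := 16 * (D1 * bw * Wm) / d.
have Q0 : 0 <= Q by rewrite divr_ge0 ?(ltW d0) // !mulr_ge0 //; lra.
have kap := ler_norm kappa; have kap' := ler_norm (- kappa); rewrite normrN in kap'.
have kap0 : 0 <= `|kappa| by [].
(* With e = b ^ -2, the summand M + 1 is for [stable_diag], 2 A for e * A <= 1 / 2, and Q for the
   final accuracy [eD]. *)
pose b : R := M.+1%:R + 2 * A + Q + 1.
have M1 : 0 <= M.+1%:R :> R by rewrite ler0n.
have A2 : 2 <= A by rewrite /A; lra.
have b1 : 1 < b by rewrite /b; lra.
pose e : R := b ^- 2; have b0 : 0 < b by lra.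
have e0 : 0 < e by rewrite invr_gt0 exprn_gt0.
have eb : e <= b^-1 by rewrite /e lef_pV2 ?posrE ?exprn_gt0 // expr2 ler_peMr // ltW.
have le_e X Y : 0 <= X -> X <= b * Y -> e * X <= Y.
  move=> X0 XY; apply: le_trans (ler_wpM2r X0 eb) _.
  by rewrite ler_pdivrMl.
have eA : e * A <= 1 / 2 by apply: le_e; [lra|rewrite /b; lra].
have eD : 8 * (e * D1) * bw * Wm <= d / 2.
  have := @le_e (16 * (D1 * bw * Wm)) d; rewrite !mulr_ge0 //.
  move=> /(_ isT); have h : 16 * (D1 * bw * Wm) <= b * d.
    by rewrite -ler_pdivrMr // -/Q /b; lra.
  by move=> /(_ h); lra.
have e1 : e < 1 / 2 by have : e * 2 <= e * A by [rewrite ler_pM2l|]; lra.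
have e01 : 0 <= e <= 1 by lra.
pose y : R := e * D1; have y0 : 0 <= y by rewrite mulr_ge0 // ltW.
have De : D * e ^+ 2 <= y * e.
  have -> : y * e = D * e ^+ 2 * Wm by rewrite /y /D1; ring.
  by rewrite ler_peMr // mulr_ge0 // sqr_ge0.
pose x : R := e * kappa; pose ax : R := e * `|kappa|.
have ax0 : 0 <= ax by rewrite mulr_ge0 // ltW.
have xa : x <= ax by rewrite ler_pM2l.
have xa' : - x <= ax by rewrite -mulrN ler_pM2l.
have eEn : 0 <= e * En by rewrite mulr_ge0 // ltW.
have small : 4 * y + ax + e * En + 2 * e <= 1 / 2.
  by move: eA; rewrite /A /y /ax; lra.
(* The factor of the step at the zero flow, close to 1 - e * kappa; dividing by it keeps the value 1
   there. *)
pose t : R := step e (dirac R g0) g0.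
have ht : `|t - (1 - x)| <= y * e.
  have d1 g : `|dirac R g0 g| <= (1 : R).
    by rewrite /dirac; case: (_ == _); rewrite ?normr1 ?normr0.
  have := HD e (dirac R g0) 1 e01 d1 g0; rewrite hh0 addr0 {2 3}/dirac eqxx !mulr1 -/t -/x.
  by move=> h; apply: le_trans h De.
have ye0 : 0 <= y * e by rewrite mulr_ge0 // ltW.
have ye : y * e <= y by rewrite ler_piMr //; lra.
have [t1 t2] : 1 - x - y * e <= t /\ t <= 1 - x + y * e.
  by move: ht; rewrite ler_norml; lra.
have t_half : 1 / 2 <= t by move: t1 small xa ye y0 eEn e0; clear; lra.
have t0 : 0 < t by move: t_half; clear; lra.
(* The gap e of [generator_contract] is halved: the other half absorbs the second-order errors. *)
have key : 1 - x - e + y * e <= (1 - e / 2) * t.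
  apply: (@le_trans _ _ ((1 - e / 2) * (1 - x - y * e))); last by rewrite ler_wpM2l //; lra.
  have h1 : e * (4 * y + ax) <= e * (1 / 2) by rewrite ler_pM2l //; lra.
  have h2 : e * - x <= e * ax by rewrite ler_pM2l.
  have h3 : 0 <= e * (y * e) by rewrite mulr_ge0 // ltW.
  by lra.
have contract G B : 0 <= B -> G g0 = 0 -> (forall g, `|G g| <= B * weight g) ->
    forall g, `|step e G g / t| <= (1 - e / 2) * (B * weight g).
  move=> B0 Gg0 GB g; have BW : 0 <= B * weight g by rewrite mulr_ge0.
  rewrite normrM normfV (ger0_norm (ltW t0)) ler_pdivrMr // mulrAC.
  have h1 : `|G g - e * (kappa * G g + hh G g)| <= (1 - e * kappa - e) * (B * weight g).
    apply: generator_contract => //; [exact: ltW| |rewrite -/x; move: small xa y0 eEn e0; clear; lra].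
    rewrite mulrDr -/x; have : e * energy R g <= e * En by rewrite ler_pM2l.
    by move: small xa y0 e0; clear; lra.
  have GBm g' : `|G g'| <= B * Wm by apply: le_trans (GB g') _; rewrite ler_wpM2l.
  have h2 := HD e G _ e01 GBm g.
  have h3 : D * e ^+ 2 * (B * Wm) <= y * e * (B * weight g).
    rewrite (_ : D * e ^+ 2 * (B * Wm) = y * e * B); last by rewrite /y /D1; ring.
    by rewrite [leRHS]mulrA ler_peMr // mulr_ge0.
  have h4 := ler_normD (step e G g - (G g - e * (kappa * G g + hh G g))) (G g - e * (kappa * G g + hh G g)).
  rewrite subrK in h4.
  have h5 := ler_wpM2r BW key; rewrite -/x in h1.
  by move: h1 h2 h3 h4 h5; clear; lra.
have wt_step g : `|step e wt_real g / t - wt_real g| <= 4 * (y * e) * bw * weight g.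
  have wtb g' : `|wt_real g'| <= bw by rewrite ger0_norm.
  have := HD e wt_real bw e01 wtb g; rewrite hh_wt addr0 mulrA -/x => h1.
  have bwW : bw <= bw * weight g by rewrite ler_peMr.
  have h2 : D * e ^+ 2 * bw <= y * e * (bw * weight g).
    by apply: ler_pM => //; rewrite mulr_ge0 ?sqr_ge0.
  have h3 : `|(1 - x - t) * wt_real g| <= y * e * (bw * weight g).
    rewrite normrM distrC ler_pM // ger0_norm //; apply: le_trans (wtbw g) bwW.
  rewrite (_ : _ - _ = ((step e wt_real g - (wt_real g - x * wt_real g)) + (1 - x - t) * wt_real g) / t); last first.
    by field; exact: lt0r_neq0.
  rewrite normrM normfV (ger0_norm (ltW t0)) ler_pdivrMr //.
  apply: le_trans (ler_normD _ _) _.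
  have Z0 : 0 <= y * e * (bw * weight g) by rewrite mulr_ge0 // mulr_ge0.
  have : 4 * (y * e * (bw * weight g)) * (1 / 2) <= 4 * (y * e * (bw * weight g)) * t.
    by rewrite ler_wpM2l //; move: Z0; clear; lra.
  by move: h1 h2 h3 Z0; clear; lra.
pose Fn := fix Fn (k : nat) : box -> R := if k is k'.+1 then fun g => step e (Fn k') g / t else dirac R g0.
have Fn0 k : Fn k g0 = 1.
  elim: k => [|k IH] /=; first by rewrite /dirac eqxx.
  by rewrite step_origin IH mul1r -/t divff // lt0r_neq0.
have wtg0 : wt_real g0 = 1.
  by rewrite /wt_real /wt big1 // => p _; rewrite /bx ffunE.
pose rho : R := 1 - e / 2; have rho01 : 0 < rho < 1 by rewrite /rho; move: e0 e1; clear; lra.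
have Bpos k : 0 <= (1 + bw) * rho ^+ k + 8 * y * bw.
  apply: addr_ge0; last by rewrite mulr_ge0 // mulr_ge0.
  by apply: mulr_ge0; [exact: addr_ge0|apply: exprn_ge0; case/andP: rho01 => /ltW].
(* The constant 8 y bw is the fixed point of B -> (1 - e / 2) B + 4 y e bw, the recursion given by
   [contract] and [wt_step]. *)
have bound k g : `|Fn k g - wt_real g| <= ((1 + bw) * rho ^+ k + 8 * y * bw) * weight g.
  elim: k g => [|k IH] g.
    rewrite expr0 mulr1 /=; apply: le_trans (ler_normB _ _) _.
    rewrite (ger0_norm (wt0 g)); have d1 : `|dirac R g0 g| <= (1 : R).
      by rewrite /dirac; case: (_ == _); rewrite ?normr1 ?normr0.
    have h : 0 <= 8 * y * bw by rewrite mulr_ge0 // mulr_ge0.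
    have hw := wtbw g; apply: le_trans (_ : 1 + bw + 8 * y * bw <= _).
      by move: d1 hw h; clear; lra.
    by rewrite ler_peMr //; move: h bw0; clear; lra.
  pose G g := Fn k g - wt_real g.
  have FnE : Fn k = fun g => G g + wt_real g by apply/funext => g'; rewrite /G subrK.
  rewrite /= FnE stepD.
  have G0 : G g0 = 0 by rewrite /G Fn0 wtg0 subrr.
  have h1 := contract G _ (Bpos k) G0 IH g; have h2 := wt_step g.
  rewrite mulrDl -addrA; apply: le_trans (ler_normD _ _) _.
  apply: le_trans (lerD h1 h2) _; rewrite exprS le_eqVlt; apply/orP; left; apply/eqP.
  move: (rho ^+ k) => P; rewrite /rho.
  by move: (weight g) (y) (bw) (e) => W y1 b2 e2; field.
have bw1 : 0 < 1 + bw by rewrite ltr_pwDl.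
have h0 : 0 < d / (2 * (1 + bw) * Wm).
  by rewrite divr_gt0 // mulr_gt0 ?mulr_gt0.
have [k hk] := exp_small rho01 h0.
exists (Fn k) => [g|].
  apply: le_trans (bound k g) _.
  have h1 : (1 + bw) * rho ^+ k * Wm <= d / 2.
    have : rho ^+ k * (2 * (1 + bw) * Wm) <= d.
      by rewrite -ler_pdivlMr // mulr_gt0 ?mulr_gt0.
    by move: Wm0; clear; lra.
  by apply: le_trans (ler_wpM2l (Bpos k) (WWm g)) _; move: h1 eD; rewrite -/y; clear; lra.
elim: k {hk} => [|k IH] /=.
  rewrite (_ : cast _ = fun g => (g == g0)%:R); first exact: stable_delta.
  by apply/funext => g; rewrite /cast /dirac (rmorph_nat toC).
apply: stable_scale; first exact: lt0r_neq0.
rewrite -cast_step; apply: stable_heat => //; first by move: e0 e1; clear; lra.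
by apply: stable_diag => //; rewrite /b; move: A2 Q0; clear; lra.
Qed.

End FlowConvergence.

(** * Passage to the limit along complex lines *)

Section LineRestriction.
Variables (m M K : nat) (R : archiRcfType).
Hypothesis m_gt0 : (0 < m)%N.
Hypothesis mM : (2 * m <= M)%N.
Hypothesis K_large : (Kmin m 0 <= K)%N.
Local Notation C := R[i]%C.
Local Notation toC := (real_complex R).
Local Notation cfg := {ffun 'I_m -> {ffun 'I_M -> bool}}.
Local Notation box := {ffun pairs m -> 'I_K.+1}.
Local Notation normc := (@Normc.normc R).
Implicit Types (F : box -> R) (g : box) (S : cfg) (x y : 'I_M -> R).

Definition top_coef (a : nat) (p : {poly C}) (c : C) := (size p <= a.+1)%N /\ p`_a = c.

Lemma top_mul a b p q c d : top_coef a p c -> top_coef b q d -> top_coef (a + b) (p * q) (c * d).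
Proof.
move=> [sp <-] [sq <-]; split.
  by apply: leq_trans (size_polyMleq _ _) _; move: sp sq; move: (size p) (size q) => u v; lia.
have ab : (a < (a + b).+1)%N by rewrite ltnS leq_addr.
rewrite coefM (bigD1 (Ordinal ab)) //= addKn big1 ?addr0 // => i ia.
have : (i : nat) != a by apply: contra ia => /eqP h; apply/eqP/val_inj.
rewrite neq_ltn => /orP[lt|gt]; last by rewrite nth_default ?mul0r // (leq_trans sp).
by rewrite [q`__]nth_default ?mulr0 // (leq_trans sq) //; lia.
Qed.

Lemma top_prod (I : Type) (s : seq I) (a : I -> nat) (p : I -> {poly C}) (c : I -> C) :
  (forall i, top_coef (a i) (p i) (c i)) ->
  top_coef (\sum_(i <- s) a i) (\prod_(i <- s) p i) (\prod_(i <- s) c i).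
Proof.
move=> h; elim: s => [|i s IH]; last by rewrite !big_cons; apply: top_mul.
by rewrite !big_nil; split; rewrite ?size_poly1 // coef1.
Qed.

Lemma top_exp a p c k : top_coef a p c -> top_coef (k * a) (p ^+ k) (c ^+ k).
Proof.
move=> h; have := top_prod (index_enum 'I_k) (fun=> h).
by rewrite !prodr_const sum_nat_const card_ord.
Qed.

Lemma top_sum a (I : Type) (s : seq I) (P : pred I) (p : I -> {poly C}) (c : I -> C) :
  (forall i, P i -> top_coef a (p i) (c i)) ->
  top_coef a (\sum_(i <- s | P i) p i) (\sum_(i <- s | P i) c i).
Proof.
move=> h; apply: (big_ind2 (fun p c => top_coef a p c)) => // [|p1 c1 p2 c2 [s1 <-] [s2 <-]].
  by split; rewrite ?size_poly0 // coef0.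
split; last by rewrite coefD.
by apply: leq_trans (size_polyD _ _) _; rewrite geq_max s1 s2.
Qed.

(** Restriction to z_k = x_k + y_k w with x, y real. For y > 0 the upper half-plane is sent to
    points with all Im z_k > 0, so a limit in several variables reduces to [open_stable_limit]. *)
Definition line_term x y g : {poly C} :=
  \sum_(S : cfg | fits (bx g) S) \prod_k ((x k)%:C%C%:P + (y k)%:C%C *: 'X) ^+ csize S k.

Definition line x y F : {poly C} := \sum_g (F g)%:C%C *: line_term x y g.

Lemma horner_line x y F (w : C) :
  (line x y F).[w] = valx (mon (fun k => (x k)%:C%C + (y k)%:C%C * w)) (cast F).
Proof.
rewrite /line horner_sum; apply: eq_bigr => g _; rewrite hornerZ horner_sum; congr (_ * _).
apply: eq_bigr => S _; rewrite horner_prod; apply: eq_bigr => k _.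
by rewrite horner_exp hornerD hornerC hornerZ hornerX.
Qed.

Definition line_degree : nat := (m * M - m * m.-1)%N.

Lemma sum_csize g S : fits (bx g) S -> (\sum_k csize S k = line_degree)%N.
Proof.
move=> fS; have : (\sum_k csize S k)%N%:Z = (m * M)%N%:Z - (m * m.-1)%N%:Z.
  rewrite /csize exchange_big /= -(total_net (bx g)) (big_morph Posz PoszD (erefl _)).
  rewrite -[X in (X * M)%N](card_ord m) -sum_nat_const (big_morph Posz PoszD (erefl _)) -sumrB.
  apply: eq_bigr => i _; have /forallP/(_ i)/eqP := fS; rewrite /rsum => <-.
  by rewrite addrK.
by rewrite /line_degree; move: (\sum_k _)%N => s; lia.
Qed.

Lemma valx_homogeneous (w : C) (z : 'I_M -> C) (F : box -> C) :
  valx (mon (fun k => w * z k)) F = w ^+ line_degree * valx (mon z) F.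
Proof.
rewrite /valx mulr_sumr; apply: eq_bigr => g _; rewrite mulrCA; congr (_ * _).
rewrite /evx mulr_sumr; apply: eq_bigr => S fS; rewrite -(sum_csize fS) -prodrXr -big_split.
by apply: eq_bigr => k _; rewrite exprMn.
Qed.

Lemma top_line_term x y g : top_coef line_degree (line_term x y g)
  (\sum_(S : cfg | fits (bx g) S) \prod_k (y k)%:C%C ^+ csize S k).
Proof.
apply: top_sum => S fS.
have -> : line_degree = (\sum_k csize S k * 1)%N.
  by rewrite -(sum_csize fS); apply: eq_bigr => k _; rewrite muln1.
apply: top_prod => k; apply: top_exp; split.
  apply: leq_trans (size_polyD _ _) _; rewrite geq_max (leq_trans (size_polyC_leq1 _)) //=.
  by apply: leq_trans (size_scale_leq _ _) _; rewrite size_polyX.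
by rewrite coefD coefC coefZ coefX mulr1 add0r.
Qed.

Lemma top_line x y F : top_coef line_degree (line x y F)
  (\sum_g F g * \sum_(S : cfg | fits (bx g) S) \prod_k y k ^+ csize S k)%:C%C.
Proof.
rewrite (rmorph_sum toC); apply: top_sum => g _.
have [sz cf] := top_line_term x y g; split.
  exact: leq_trans (size_scale_leq _ _) sz.
rewrite coefZ cf (rmorphM toC) (rmorph_sum toC); congr (_ * _).
apply: eq_bigr => S _; rewrite (rmorph_prod toC); apply: eq_bigr => k _.
by rewrite (rmorphXn toC).
Qed.

(** All terms are nonnegative and one is positive. So the limit has full degree, as
    [open_stable_limit] needs in order to compare it with the approximants. *)
Lemma line_wt_neq0 x y : (forall k, 0 < y k) -> (line x y (@wt_real m K R))`_line_degree != 0.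
Proof.
move=> y0; have [_ ->] := top_line x y (@wt_real m K R).
rewrite eq_complex /= eqxx andbT lt0r_neq0 //.
have ge0 S : 0 <= \prod_k y k ^+ csize S k.
  by apply: prodr_ge0 => k _; apply/exprn_ge0/ltW.
have ge0' g : 0 <= \sum_(S : cfg | fits (bx g) S) \prod_k y k ^+ csize S k.
  by apply: sumr_ge0 => S _; apply: ge0.
pose g0 : box := [ffun=> ord0].
(* Row i has M - 2 (m - 1 - i) entries, as the zero flow demands. *)
pose S0 : cfg := [ffun i : 'I_m => [ffun k : 'I_M => (k < M - 2 * (m.-1 - i))%N]].
have fS0 : fits (bx g0) S0.
  apply/forallP => i; have -> : net (bx g0) i = (2 * (m.-1 - i))%N.
    by rewrite /net /excess !big1 => [|p _|p _]; rewrite /bx ?ffunE //= /lam; lia.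
  have im := ltn_ord i; have cM : (M - 2 * (m.-1 - i) <= M)%N by lia.
  have -> : rsum S0 i = (M - 2 * (m.-1 - i))%N.
    rewrite /rsum -[RHS](card_below cM) -sum1_card [RHS]big_mkcond; apply: eq_bigr => k _.
    by rewrite !ffunE unfold_in /=; case: (_ < _)%N.
  by apply/eqP; lia.
have t0 : 0 < (wt (bx g0))%:R * \sum_(S : cfg | fits (bx g0) S) \prod_k y k ^+ csize S k :> R.
  rewrite mulr_gt0 ?ltr0n ?prodn_gt0 // (bigD1 S0) //= ltr_pwDl //.
    by apply: prodr_gt0 => k _; apply: exprn_gt0.
  by apply: sumr_ge0 => S _; apply: ge0.
rewrite (bigD1 g0) //= ltr_pwDl // sumr_ge0 // => g _.
by rewrite mulr_ge0 // ler0n.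
Qed.

Lemma stable_wt : stable_flow M (cast (@wt_real m K R)).
Proof.
move=> z zu; pose x k := complex.Re (z k); pose y k := complex.Im (z k).
have y0 k : 0 < y k := zu k; pose p := line x y (@wt_real m K R).
have lead0 := line_wt_neq0 x y0; rewrite -/p in lead0.
have szp : size p = line_degree.+1.
  apply/eqP; rewrite eqn_leq; have [-> _] /= := top_line x y (@wt_real m K R).
  by rewrite ltnNge; apply: contra lead0 => h; rewrite nth_default.
have ps : open_stable p.
  apply: open_stable_limit => [|d d0]; first by rewrite -size_poly_gt0 szp.
  pose S := 1 + \sum_g \sum_(j < line_degree.+1) normc (line_term x y (g : box))`_j.
  have nn (c : C) : 0 <= normc c by apply: normc_ge0.
  have S0 : 0 < S by rewrite ltr_wpDr // sumr_ge0 // => g _; apply: sumr_ge0.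
  have [F Fd Fs] := @wt_limit m M K R m_gt0 mM K_large _ (divr_gt0 d0 S0).
  exists (line x y F); split.
  - by rewrite szp; have [] := top_line x y F.
  - move=> j; have -> : (line x y F)`_j - p`_j =
        \sum_g (F g - wt_real R g)%:C%C * (line_term x y g)`_j.
      rewrite /p /line !coef_sum -sumrB; apply: eq_bigr => g _.
      by rewrite !coefZ -mulrBl (rmorphB toC).
    apply: le_trans (normc_sum _ _) _.
    apply: (@le_trans _ _ (\sum_g d / S * normc (line_term x y (g : box))`_j)).
      apply: ler_sum => g _; rewrite Normc.normcM [normc _%:C%C]normcR ler_wpM2r //.
    rewrite -mulr_sumr mulrAC ler_pdivrMr // ler_pM2l // /S.
    apply: le_trans (_ : \sum_g \sum_(j < line_degree.+1) normc (line_term x y (g : box))`_j <= _); last by rewrite lerDr.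
    apply: ler_sum => g _; have [jd|jd] := ltnP j line_degree.+1.
      by rewrite (bigD1 (Ordinal jd)) //= lerDl sumr_ge0.
    have [sz _] := top_line_term x y g.
    by rewrite nth_default ?Normc.normc0 ?sumr_ge0 // (leq_trans sz).
  - move=> w w0; rewrite horner_line; apply: Fs => k.
    have := mulr_gt0 (y0 k) w0; case: w {w0} => a b /=.
    by rewrite mul0r addr0 add0r.
(* At w = i the line built from the real and imaginary parts of z passes through z. *)
have i0 : 0 < complex.Im (Complex 0 1 : C) by rewrite /= ltr01.
have := ps _ i0; rewrite horner_line; congr (valx (mon _) _ != 0).
apply/funext => k; rewrite /x /y; case: (z k) => a b; apply/eqP.
by rewrite eq_complex /= !mul0r !mulr0 !mulr1 !subr0 !addr0 !add0r !eqxx.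
Qed.

End LineRestriction.

(** * Newton's inequalities *)

Section Newton.
Variable R : archiRcfType.
Local Notation C := R[i]%C.
Local Notation toC := (map_poly (real_complex R)).
Implicit Types (p : {poly R}) (z : C).

Definition real_stable p := open_stable (toC p).

Lemma horner_conj p z : (toC p).[(z^*)%C] = ((toC p).[z]^*)%C.
Proof.
rewrite -(horner_map (@conjc R)) /= -map_poly_comp; congr (_.[_]).
by apply: eq_map_poly => x; rewrite /= oppr0.
Qed.

Lemma real_stable_neq0 p z : real_stable p -> complex.Im z != 0 -> (toC p).[z] != 0.
Proof.
move=> ps; rewrite neq_lt => /orP[z0|z0]; last exact: ps.
rewrite -conjc_eq0 -horner_conj; apply: ps.
by case: z z0 => a b /=; rewrite oppr_gt0.
Qed.

Lemma real_stable_derivn p k : real_stable p -> (k < size p)%N -> real_stable p^`(k).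
Proof.
have lead n q : (size (q : {poly R}) = n.+1)%N -> forall k, (k <= n)%N -> (n - k < size q^`(k))%N.
  move=> sq j jn; have qn : q`_n != 0.
    by have := lead_coef_eq0 q; rewrite lead_coefE sq /= => ->; rewrite -size_poly_eq0 sq.
  rewrite ltnNge; apply/negP => /(nth_default 0)/eqP.
  by rewrite coef_derivn subnKC // mulrn_eq0 (negPf qn) orbF eqn0Ngt ffact_gt0 jn.
move=> ps; case sp: (size p) => [|n] //; rewrite ltnS.
elim: k => [|k IH] kn; first by rewrite derivn0.
rewrite derivnS /real_stable -deriv_map; apply: open_deriv; first exact: IH (ltnW kn).
rewrite size_map_poly; apply: leq_trans (lead n p sp k (ltnW kn)); lia.
Qed.

Definition reverse (n : nat) p : {poly R} := \poly_(i < n.+1) p`_(n - i).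

Lemma real_stable_reverse n p : (size p <= n.+1)%N -> real_stable p -> real_stable (reverse n p).
Proof.
move=> sp ps z z0; have zn0 : z != 0 by apply: contraTneq z0 => ->; rewrite ltxx.
have iz : complex.Im z^-1 != 0 by rewrite lt_eqF // Im_inv_lt0.
have := real_stable_neq0 ps iz; rewrite -(mulrI_eq0 _ (mulfI (expf_neq0 n zn0))).
congr (_ != 0); rewrite (@horner_coef_wide _ n.+1) ?size_map_poly //.
rewrite [RHS](@horner_coef_wide _ n.+1) ?size_map_poly ?size_poly //.
rewrite mulr_sumr (reindex_inj rev_ord_inj); apply: eq_bigr => i _ /=.
rewrite subSS !coef_map coef_poly ltn_ord /= mulrCA; congr (_ * _).
have iN : (i <= n)%N by rewrite -ltnS.
by rewrite exprVn -{1}(subnK iN) exprD mulrAC mulfV ?mul1r // expf_neq0.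
Qed.

(** With a negative discriminant, the quadratic formula would give a root in the upper
    half-plane. *)
Lemma real_stable_quadratic p : (size p <= 3)%N -> 0 < p`_2 -> real_stable p ->
  4 * p`_2 * p`_0 <= p`_1 ^+ 2.
Proof.
move=> sp a0 ps; rewrite leNgt; apply/negP => disc.
pose d := 4 * p`_2 * p`_0 - p`_1 ^+ 2; have d0 : 0 < d by rewrite subr_gt0.
pose z : C := Complex (- p`_1 / (2 * p`_2)) (Num.sqrt d / (2 * p`_2)).
have z0 : 0 < complex.Im z by rewrite /= divr_gt0 ?sqrtr_gt0 // mulr_gt0.
have := ps z z0; rewrite (@horner_coef_wide _ 3) ?size_map_poly //.
rewrite !big_ord_recl big_ord0 !coef_map /= => /eqP; apply.
have sd : Num.sqrt d * Num.sqrt d = d by rewrite -expr2 sqr_sqrtr // ltW.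
have an : p`_2 != 0 by rewrite lt0r_neq0.
apply/eqP; rewrite eq_complex /= /bump /= addr0 /z.
set s := Num.sqrt d in sd *.
have ss : s * s = 4 * p`_2 * p`_0 - p`_1 * p`_1 by rewrite sd /d expr2.
apply/andP; split; apply/eqP; rewrite ?expr0 ?expr1 ?expr2 /=; last by field.
suff : 4 * p`_2 * (p`_0 + - p`_1 ^+ 2 / (2 * p`_2) + (p`_1 ^+ 2 - s * s) / (4 * p`_2)) = 0.
  move=> /eqP; rewrite mulf_eq0 mulf_eq0 (negPf an) pnatr_eq0 /= => /eqP h.
  by rewrite -[RHS]h; field.
by rewrite ss; field.
Qed.

(** Newton's argument: k - 1 derivatives, reversal and n - k - 1 further derivatives preserve
    stability and leave a quadratic in the three coefficients, whose discriminant is nonnegative. *)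
Lemma newton p n k : (size p = n.+1)%N -> (0 < k < n)%N -> real_stable p -> (forall i, (i <= n)%N -> 0 < p`_i) ->
  (k.+1 * (n - k).+1)%:R * p`_k.-1 * p`_k.+1 <= (k * (n - k))%:R * p`_k ^+ 2.
Proof.
move=> sp /andP[k0 kn] ps ppos; case: k k0 kn => // k _ kn /=.
pose s := (n - k.+2)%N; pose q := reverse (n - k) p^`(k); pose t := q^`(s).
have sq : (size p^`(k) <= (n - k).+1)%N.
  apply/leq_sizeP => j jn; rewrite coef_derivn nth_default ?mul0rn // sp; lia.
have qE i : (i <= n - k)%N -> q`_i = p`_(n - i) *+ (n - i) ^_ k.
  by move=> ik; rewrite coef_poly ltnS ik coef_derivn; congr (p`_ _ *+ _ ^_ _); lia.
have qs : real_stable q.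
  by apply: real_stable_reverse => //; apply: real_stable_derivn => //; rewrite sp; lia.
have szq : (s < size q)%N.
  rewrite ltnNge; apply/negP => /leq_sizeP/(_ s (leqnn s)) /eqP; rewrite qE; last by rewrite /s; lia.
  have pns : p`_(n - s) != 0 by rewrite lt0r_neq0 // ppos // leq_subr.
  by rewrite mulrn_eq0 (negPf pns) orbF eqn0Ngt ffact_gt0 /s => /negP; apply; lia.
have ts : real_stable t by apply: real_stable_derivn.
have tE i : (i <= 2)%N -> t`_i = p`_(n - (s + i)) *+ ((n - (s + i)) ^_ k * (s + i) ^_ s).
  by move=> i2; rewrite coef_derivn qE ?mulrnA // /s; lia.
have := @real_stable_quadratic t _ _ ts.
rewrite !tE //; have -> : (n - (s + 0) = k.+2)%N by rewrite /s; lia.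
have -> : (n - (s + 1) = k.+1)%N by rewrite /s; lia.
have -> : (n - (s + 2) = k)%N by rewrite /s; lia.
have st : (size t <= 3)%N.
  apply/leq_sizeP => j jn; rewrite coef_derivn nth_default ?mul0rn //.
  by apply: leq_trans (size_poly _ _) _; rewrite /s; lia.
have pk : 0 < p`_k by apply: ppos; lia.
rewrite addn0 !ffactnn => /(_ st); rewrite pmulrn_lgt0 ?muln_gt0 ?ffact_gt0 ?leq_addr ?leqnn ?pk //; last first.
  by rewrite fact_gt0.
move=> /(_ isT).
have ff1 j : (j.+1 ^_ j = j.+1`!)%N.
  by have := @ffact_fact j.+1 j (leqnSn j); rewrite subSnn (_ : 1`! = 1)%N // muln1.
have ff2 j : (2 * j.+2 ^_ j = j.+2`!)%N.
  have := @ffact_fact j.+2 j; rewrite (_ : j.+2 - j = 2)%N; last by lia.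
  by rewrite (_ : 2`! = 2)%N // mulnC => -> //; lia.
have f1 := ff1 k; have f2 := ff2 k.
have f3 : ((s + 1) ^_ s = s.+1`!)%N by rewrite addn1.
have f4 : (2 * (s + 2) ^_ s = s.+2`!)%N by rewrite addn2.
move=> h'; have h : 4 * (p`_k * (k`! * (s + 2) ^_ s)%:R) * (p`_k.+2 * (k.+2 ^_ k * s`!)%:R) <=
    (p`_k.+1 * (k.+1`! * s.+1`!)%:R) ^+ 2.
  by rewrite !mulr_natr -f1 -f3.
clear h'.
have -> : (n - k.+1 = s.+1)%N by rewrite /s; lia.
pose F : R := k`!%:R * s`!%:R; have F0 : 0 < F by rewrite mulr_gt0 ?ltr0n ?fact_gt0.
rewrite -(ler_pM2r (exprn_gt0 2 F0)) -(@ler_pM2r _ (k.+1%:R * s.+1%:R)) ?mulr_gt0 ?ltr0n //.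
move: h; rewrite (_ : 4 * (p`_k * (k`! * (s + 2) ^_ s)%:R) * (p`_k.+2 * (k.+2 ^_ k * s`!)%:R) = p`_k * p`_k.+2 * (k`! * (2 * (s + 2) ^_ s))%:R * ((2 * k.+2 ^_ k) * s`!)%:R); last first.
  by rewrite !natrM; ring.
rewrite f2 f4 !factS !natrM => h; rewrite [leLHS](_ : _ = p`_k * p`_k.+2 * (k`!%:R * (s.+2%:R * (s.+1%:R * s`!%:R))) *
  (k.+2%:R * (k.+1%:R * k`!%:R) * s`!%:R)); last by rewrite /F; ring.
by apply: le_trans h _; rewrite le_eqVlt; apply/orP; left; apply/eqP; rewrite /F; ring.
Qed.

End Newton.

(** * The theorem *)

Lemma lcoef_intM (c : int) (X : laurent rat) k : (c%:~R * X) k = c%:~R * X k.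
Proof.
case: c => c; first by rewrite -!pmulrn lcoef_natM.
by rewrite NegzE !mulrNz !mulNr lcoefN -!pmulrn lcoef_natM.
Qed.

Lemma coef_one_addX (R : nzRingType) n i : ((1 + 'X : {poly R}) ^+ n)`_i = 'C(n, i)%:R.
Proof.
elim: n i => [|n IH] i; first by rewrite expr0 coef1; case: i.
rewrite exprS mulrDl mul1r coefD coefXM !IH; case: i => [|i] /=.
  by rewrite !bin0 addr0.
by rewrite binS natrD.
Qed.

Section Numerator.
Variable m : nat.
Local Notation N := (ordN m).
Local Notation e := (halfe m).

Definition numerator : {poly int} :=
  \sum_(j < e.+1) (gamma m j)%:Z *: ('X^j * (1 + 'X) ^+ (2 * e - 2 * j)).

Lemma horner_numerator (V : comNzRingType) (y : V) : (map_poly intr numerator).[y] =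
  \sum_(0 <= j < e.+1) (gamma m j)%:R * y ^+ j * (1 + y) ^+ (2 * e - 2 * j).
Proof.
rewrite big_mkord rmorph_sum horner_sum; apply: eq_bigr => j _ /=.
rewrite map_polyZ rmorphM rmorphXn rmorphXn rmorphD rmorph1 /= map_polyX.
by rewrite hornerZ hornerM !horner_exp hornerD hornerX hornerC mulrA.
Qed.

(** Coefficient of X ^ k in X ^ j * (1 + X) ^ (2 e - 2 j). *)
Definition row_coef (k j : nat) : nat := if (j <= k)%N then 'C(2 * e - 2 * j, k - j) else 0.

Lemma coef_numerator k : numerator`_k = (\sum_(j < e.+1) gamma m j * row_coef k j)%N%:Z.
Proof.
rewrite coef_sum (big_morph Posz PoszD (erefl _)); apply: eq_bigr => j _.
rewrite coefZ coefXnM PoszM coef_one_addX /row_coef; case: ltnP => //.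
by rewrite natz.
Qed.

Lemma size_numerator : (size numerator <= (2 * e).+1)%N.
Proof.
apply/leq_sizeP => k ek; rewrite coef_numerator big1 // => j _.
rewrite /row_coef; case: leqP => jk; rewrite ?muln0 // bin_small ?muln0 //.
by have := ltn_ord j; lia.
Qed.

Lemma row_coef_sym k j : (k <= 2 * e)%N -> (j <= e)%N -> row_coef k j = row_coef (2 * e - k) j.
Proof.
move=> ke je; rewrite /row_coef; case: leqP => jk; case: leqP => jk'.
- rewrite -[LHS]bin_sub; last by lia.
  by congr 'C(_, _); lia.
- by rewrite bin_small //; lia.
- by rewrite bin_small //; lia.
- by [].
Qed.

Lemma bin_lt n k : (2 * k + 1 < n)%N -> ('C(n, k) < 'C(n, k.+1))%N.
Proof.
move=> kn; have := mul_bin_left n k; have : (0 < 'C(n, k))%N by rewrite bin_gt0; lia.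
move: 'C(n, k) 'C(n, k.+1) => x y; nia.
Qed.

Lemma row_coef_lt k j : (k < e)%N -> (j <= k)%N -> (row_coef k j < row_coef k.+1 j)%N.
Proof.
move=> ke jk; rewrite /row_coef jk (leqW jk) subSn //.
by apply: bin_lt; lia.
Qed.

Lemma numerator_sym k : (k <= 2 * e)%N -> numerator`_k = numerator`_(2 * e - k).
Proof.
move=> ke; rewrite !coef_numerator; congr Posz; apply: eq_bigr => j _.
by rewrite (row_coef_sym ke) // -ltnS.
Qed.

Hypothesis m_gt0 : (0 < m)%N.
Let K := Kmin m 0.

Lemma numerator_gt0 k : (k <= 2 * e)%N -> 0 < numerator`_k.
Proof.
move=> ke; rewrite coef_numerator ltz_nat (bigD1 ord0) //= addn_gt0 muln_gt0.
by rewrite (@gamma_gt0 m K) //= /row_coef /= muln0 !subn0 bin_gt0 ke.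
Qed.

(** All rows are centred at e and do not decrease up to there; the row j = 0 increases strictly and
    has the positive factor [gamma m 0]. *)
Lemma numerator_lt k : (k < e)%N -> numerator`_k < numerator`_k.+1.
Proof.
move=> ke; rewrite !coef_numerator ltz_nat (bigD1 ord0) //= [ltnRHS](bigD1 ord0) //=.
rewrite -addSn leq_add ?ltn_pmul2l ?(@gamma_gt0 m K) ?row_coef_lt //.
apply: leq_sum => j _; rewrite leq_mul2l; apply/orP; right.
have [jk|kj] := leqP j k; first by rewrite ltnW ?row_coef_lt.
by rewrite {1}/row_coef ifN // -ltnNge.
Qed.

Lemma size_numeratorE : size numerator = (2 * e).+1.
Proof.
apply/eqP; rewrite eqn_leq size_numerator ltnNge; apply/negP => h.
by have := numerator_gt0 (leqnn (2 * e)); rewrite nth_default ?ltxx.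
Qed.

Section Roots.
Variable R : archiRcfType.
Local Notation C := R[i]%C.
Local Notation toC := (real_complex R).

Lemma valx_binomial (y : C) :
  valx (mon (fun k : 'I_(m + m) => if (k < m)%N then y else 1)) (cast (@wt_real m K R)) =
  Lam m K (binomial_coef m y).
Proof.
have E : \prod_(k < m + m) ('X + (if (k < m)%N then y else 1)%:P) =
    ('X + y%:P) ^+ m * (1 + 'X) ^+ m.
  rewrite big_split_ord /=; congr (_ * _).
    rewrite (eq_bigr (fun=> 'X + y%:P)) => [|k _]; last by rewrite ltn_ord.
    by rewrite prodr_const card_ord.
  rewrite (eq_bigr (fun=> 1 + 'X)) => [|k _]; last by rewrite ltnNge leq_addr /= addrC.
  by rewrite prodr_const card_ord.
apply: eq_bigr => g _; rewrite /cast (rmorph_nat toC) evx_mon; congr (_ * _).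
by apply: eq_bigr => i _; case: (net _ i) => d //=; rewrite E.
Qed.

Lemma numerator_root (y : C) : root (map_poly intr numerator) y -> exists2 x : R, x < 0 & y = x%:C%C.
Proof.
rewrite rootE horner_numerator => /eqP ry.
have J0 : Lam m K (binomial_coef m y) = 0 by rewrite (@Lam_gamma m K) // ry mulr0.
have no_upper (w : C) : 0 < complex.Im w -> 0 < complex.Im (w * y) -> False.
  move=> w0 wy0; have mm : (2 * m <= m + m)%N by rewrite mul2n addnn.
  have := @stable_wt m (m + m) K R m_gt0 mm (leqnn _)
    (fun k => w * if (k < m)%N then y else 1).
  rewrite (valx_homogeneous m_gt0 mm (leqnn K) w) ?valx_binomial ?J0 ?mulr0 ?eqxx // => H.
  have : false by apply: H => k; case: ifP; rewrite ?mulr1.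
  by [].
case: y ry J0 no_upper => a b ry _ no_upper.
have [b0|bn0] := eqVneq b 0; last first.
  (* For this w both Im w and Im (w * y) = a + ((1 - a) / b) * b equal 1. *)
  case: (no_upper (Complex ((1 - a) / b) 1)) => //=.
  by rewrite divfK // mul1r subrK.
have a0 : a <= 0.
  rewrite leNgt; apply/negP => a0; apply: (no_upper (Complex 0 1)) => //=.
  by rewrite mul0r mul1r add0r.
exists a; last by rewrite b0.
(* The value y = 0 remains; it is excluded by the positive constant coefficient. *)
rewrite lt_neqAle a0 andbT; apply/eqP => a00.
have /eqP := ry; rewrite b0 a00 -horner_numerator -[Complex 0 0]/(0 : C) horner_coef0 coef_map /=.
by rewrite intr_eq0 gt_eqF // numerator_gt0.
Qed.

End Roots.

Lemma hstar_numerator : hstar m.+2 = yvar ^+ N * (map_poly intr numerator).[yvar].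
Proof.
have K1 : (Kmin m 0 <= Kmin m 1)%N by rewrite /Kmin; nia.
by rewrite (hstar_Lam m_gt0 (leqnn _)) horner_numerator -(Lam_gamma K1).
Qed.

Lemma lcoef_numerator k :
  (map_poly intr numerator).[yvar] k = if k is Posz i then (numerator`_i)%:~R else 0.
Proof.
rewrite (@horner_coef_wide _ (2 * e).+1) ?(leq_trans (size_poly _ _)) ?size_numerator // lcoef_sum.
under eq_bigr => i _ do rewrite coef_map lcoef_intM lvarXE.
case: k => [k|k]; last by rewrite big1 // => i _; rewrite mulr0.
have [ke|ke] := ltnP k (2 * e).+1; last first.
  rewrite nth_default ?(leq_trans size_numerator) // big1 // => i _.
  rewrite eqz_nat (_ : (k == i) = false) ?mulr0 //.
  by apply/negbTE; rewrite neq_ltn (leq_trans (ltn_ord i) ke) orbT.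
rewrite (bigD1 (Ordinal ke)) //= eqxx mulr1 big1 ?addr0 // => i ik.
rewrite eqz_nat (_ : (k == i) = false) ?mulr0 //.
by apply: contraNF ik => /eqP ki; apply/eqP/val_inj.
Qed.

Lemma lcoef_hstar k : hstar m.+2 k = if k - N%:Z is Posz i then (numerator`_i)%:~R else 0.
Proof. by rewrite hstar_numerator exprnP lcoef_varzM lcoef_numerator. Qed.

Lemma numerator_newton k : (0 < k < 2 * e)%N ->
  ((k.+1 * (2 * e - k).+1)%:R / (k * (2 * e - k))%:R : rat)
    * (numerator`_k.-1)%:~R * (numerator`_k.+1)%:~R <= (numerator`_k)%:~R ^+ 2.
Proof.
(* Real algebraic numbers suffice as an archimedean real closed field: the inequality to be
   descended involves integers only. *)
move=> ke; pose Rd : archiRcfType := realalg.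
pose p : {poly Rd} := map_poly intr numerator.
have sp : size p = (2 * e).+1.
  rewrite -size_numeratorE; apply: size_map_inj_poly => //; exact: intr_inj.
have toCp : map_poly (real_complex Rd) p = map_poly intr numerator.
  by rewrite -map_poly_comp; apply: eq_map_poly => x /=; rewrite (rmorph_int (real_complex Rd)).
have ps : real_stable p.
  move=> z z0; rewrite toCp; apply/negP => /numerator_root [x _ zx].
  by move: z0; rewrite zx /= ltxx.
have pp i : (i <= 2 * e)%N -> 0 < p`_i.
  by move=> ie; rewrite coef_map /= ltr0z numerator_gt0.
have := newton sp ke ps pp; rewrite !coef_map /= => h.
have hZ : (k.+1 * (2 * e - k).+1)%N%:Z * numerator`_k.-1 * numerator`_k.+1 <=
    (k * (2 * e - k))%N%:Z * numerator`_k ^+ 2.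
  by rewrite -(ler_int Rd) expr2 !intrM -!pmulrn -expr2.
have D0 : 0 < (k * (2 * e - k))%:R :> rat by rewrite ltr0n muln_gt0; lia.
move: hZ; rewrite -(ler_int rat) expr2 !intrM -!pmulrn -expr2 => hQ.
set X := (k.+1 * _)%:R in hQ *; set D := (k * _)%:R in hQ D0 *.
rewrite [leLHS](_ : _ = X * (numerator`_k.-1)%:~R * (numerator`_k.+1)%:~R / D); last by ring.
by rewrite ler_pdivrMr // [leRHS]mulrC.
Qed.

End Numerator.

(** For m = 1 there is no pair and the empty flow is the only one; through [Lam_gamma] this
    evaluates [gamma 1 0] without enumerating arrays. *)
Lemma Lam_one (V : comNzRingType) (y : V) K : Lam 1 K (binomial_coef 1 y) = y.
Proof.
have no_pair : pairs 1 -> False.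
  by move=> p; have := src_lt_tgt p; rewrite !ord1.
rewrite /Lam (big_pred1 [ffun=> ord0]) => [|g]; last first.
  by apply/esym/eqP/ffunP => p; case: (no_pair p).
rewrite /wt big1 ?mul1r => [|p]; last by case: (no_pair p).
rewrite big_ord1 (_ : net _ _ = Posz 0); last first.
  by rewrite /net /excess !big1 // => p; case: (no_pair p).
by rewrite /= -horner_coef0 !expr1 hornerM !hornerD !hornerX !hornerC add0r addr0 mulr1.
Qed.

Lemma gamma_one : gamma 1 0 = 1%N.
Proof.
have := @Lam_gamma 1 (Kmin 1 0) (leqnn _) int 1; rewrite Lam_one.
rewrite (_ : ordN 1 = 1%N) // (_ : halfe 1 = 0%N) // big_nat1 subnn !expr1n expr0 !mulr1 mul1r.
by rewrite natz => -[].
Qed.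

Lemma numerator_one : numerator 1 = 1.
Proof.
by rewrite /numerator big_ord1 /= gamma_one scale1r !expr0 mulr1.
Qed.

Theorem theorem1p2 (m : nat) (hm : (1 <= m)%N) :
  let N := ordN m in
  let e := halfe m in
  [/\ (* (i), gamma expansion *)
      forall j, (j <= e)%N -> finite_set (gamma_index m j) /\ (0 < gamma m j)%N,
      hstar m.+2 = yvar ^+ N *
        \sum_(0 <= j < e.+1)
           (gamma m j)%:R * yvar ^+ j * (1 + yvar) ^+ (2 * e - 2 * j)
    & exists A : {poly int},
      [/\ (* (i), the polynomial A_m *)
          [/\ hstar m.+2 = yvar ^+ N * (map_poly intr A).[yvar],
              (size A <= (2 * e).+1)%N,
              forall k, (k <= 2 * e)%N -> 0 < A`_k,
              has_order (hstar m.+2) N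
            & has_degree (hstar m.+2) (N + 2 * e)%N],
          (* (ii) *)
          forall R : realType,
          let AC : {poly R[i]%C} := map_poly intr A in
          let HC : {poly R[i]%C} := 'X^N * AC in
          [/\ forall z : R[i]%C, root AC z -> negative_real z,
              mup 0 HC = N
            & forall z : R[i]%C, root HC z -> z != 0 -> negative_real z],
          (* (iii) *)
          [/\ forall k, (k <= 2 * e)%N -> A`_k = A`_(2 * e - k),
              (1 <= e)%N ->
                0 < A`_0 /\ forall k, (k < e)%N -> A`_k < A`_k.+1
            & forall k, (1 <= k < 2 * e)%N ->
                ((k.+1 * (2 * e - k).+1)%:R / (k * (2 * e - k))%:R : rat)
                  * (A`_k.-1)%:~R * (A`_k.+1)%:~R <= (A`_k)%:~R ^+ 2]
        & m = 1%N -> hstar 3 = yvar /\ A = 1]].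
Proof.
move=> N e; split.
- move=> j je; split; first exact: (@finite_gamma_index m (Kmin m 0)).
  exact: (@gamma_gt0 m (Kmin m 0)).
- by rewrite (hstar_numerator hm) horner_numerator.
exists (numerator m); split; first split.
- exact: hstar_numerator.
- exact: size_numerator.
- exact: numerator_gt0.
- split=> [|k kN]; rewrite lcoef_hstar //.
    by rewrite subrr intr_eq0 gt_eqF // numerator_gt0.
  by case E: (k - N%:Z) => [i|] //; lia.
- split=> [|k kN]; rewrite lcoef_hstar //.
    rewrite (_ : (N + 2 * e)%N%:Z - N%:Z = (2 * e)%N%:Z); last by lia.
    by rewrite intr_eq0 gt_eqF // numerator_gt0.
  case E: (k - N%:Z) => [i|] //; rewrite nth_default // (leq_trans (size_numerator m)) //.
  by rewrite -/e; lia.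
- move=> R AC HC; have AC0 : ~~ root AC 0.
    rewrite rootE horner_coef0 coef_map /= intr_eq0 gt_eqF //.
    exact: numerator_gt0.
  split=> [z||z]; first exact: numerator_root.
    rewrite /HC mupMl // -['X]subr0 -polyC0 mup_XsubCX eqxx //.
  rewrite rootM => /orP[|/(numerator_root hm) //].
  by rewrite rootE hornerXn expf_eq0 => /andP[_ ->].
- split=> [k ke|e0|k ke].
  + exact: numerator_sym.
  + split; first exact: numerator_gt0.
    by move=> k; apply: numerator_lt.
  + exact: numerator_newton.
move=> m1; rewrite m1 numerator_one; split=> //.
rewrite (hstar_numerator (m := 1)) // numerator_one rmorph1 hornerC mulr1.
by rewrite (_ : ordN 1 = 1%N) // expr1.
Qed.
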